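(* Let $n$ be a positive integer. The collection $\mathcal{D}_n=\{\mathcal{D}_n(j)\}_{j\ge 0}$, with the composition operations $\circ_i$, the right $\Sigma_j$-actions and the unit constructed in the context, is an operad in orthogonal spectra. Moreover there is a map of operads $\mathcal{D}_n\to\mathcal{H}$.
   Context: Spaces are compactly generated. An orthogonal spectrum $L$ is a continuous functor from finite dimensional real inner product spaces and linear isometric isomorphisms to based spaces with natural, unital, associative maps $\sigma:L(V)\wedge S^W\to L(V\oplus W)$. $\wedge$ is the symmetric monoidal smash product with unit $S$, $S(V)=S^V$. A map $K\wedge L\to X$ is the same as a family of maps $K(V)\wedge L(W)\to X(V\oplus W)$, natural in $V,W$ and compatible with the left and right structure maps. **Operads.** An operad $\mathcal{P}$ in orthogonal spectra consists of orthogonal spectra $\mathcal{P}(j)$, $j\ge0$, with right $\Sigma_j$-action, $\mathcal{P}(0)=S$, maps $\circ_i:\mathcal{P}(m)\wedge\mathcal{P}(k)\to\mathcal{P}(m+k-1)$ for $k\ge0$, $1\le i\le m$, and a unit $1:S\to\mathcal{P}(1)$, such that: (i) on $\mathcal{P}(m)\wedge\mathcal{P}(k)\wedge\mathcal{P}(l)$, with $\pi$ the twist of the last two factors, $\circ_i(\circ_j\wedge\mathrm{id})$ equals $\circ_{j+l-1}(\circ_i\wedge\mathrm{id})(\mathrm{id}\wedge\pi)$ for $i<j$, equals $\circ_j(\mathrm{id}\wedge\circ_{i-j+1})$ for $j\le i<j+k$, and equals $\circ_j(\circ_{i-k+1}\wedge\mathrm{id})(\mathrm{id}\wedge\pi)$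 for $j+k\le i$; (ii) for $\rho\in\Sigma_m$, $\upsilon\in\Sigma_k$, acting by $\rho\wedge\upsilon$ and then applying $\circ_i$ equals applying $\circ_{\rho(i)}$ and then acting by $\rho\circ_i\upsilon$; (iii) $\circ_i(\mathrm{id}\wedge1)$ and $\circ_1(1\wedge\mathrm{id})$ are the canonical isomorphisms. Maps of operads are families of equivariant maps commuting with all structure. Here $\rho\circ_i\upsilon\in\Sigma_{m+k-1}$ has the permutation matrix obtained from that of $\rho$ (with $Ae_t=e_{\rho(t)}$) by replacing the entry $1$ in column $i$ and row $\rho(i)$ by the permutation matrix of $\upsilon$ (an empty matrix if $k=0$). **$\mathcal{H}$.** Write $\mathbb{Z}/2=\{\pm1\}$, and let $\tau_k:\mathbb{Z}/2\to\Sigma_k$ send $-1$ to the order reversing permutation. $\mathcal{H}$ is the suspension operad $\mathcal{H}(j)(V)=((\mathbb{Z}/2)^j\times\Sigma_j)_+\wedge S^V$ of the discrete operad with $(x,\rho).\nu=(x,\rho\nu)$ and $(x,\rho)\circ_i(y,\upsilon)=(x\circ_{\rho(i)}y,\ \rho\circ_i(\tau_k(x_{\rho(i)})\upsilon))$, where $(x_1,\dots,x_m)\circ_i(y_1,\dots,y_k)$ is obtained by replacing $x_i$ by $y_1,\dots,y_k$ if $x_i=1$ and by $-y_k,\dots,-y_1$ if $x_i=-1$. **$\mathcal{D}_n$.** For $j\ge0$ and $V$ a finite dimensional real inner product space, $D_n(j;V)$ is the group generated by the space $X$ of pairs $(\phi,r)$, with $\phi:\mathbb{R}^n\to V$ a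 linear isometric embedding and $1\le r\le j$, subject to $(\phi,r)(\phi,r)=1$, and $(\phi,r)(\psi,r')=(\psi,r')(\phi,r)$ whenever $\phi(\mathbb{R}^n)\perp\psi(\mathbb{R}^n)$ and $r\ne r'$. The set of elements represented by words of length $\le m$ has the quotient topology from $\coprod_{i\le m}X^i$, and $D_n(j;V)$ has the colimit topology. Set $\mathcal{D}_n(j)(V)=(D_n(j;V)\times\Sigma_j)_+\wedge S^V$, with structure maps induced by $V\subset V\oplus W$ and right action $(x,\rho,v).\nu=(x,\rho\nu,v)$. Let $p:D_n(j;V)\to(\mathbb{Z}/2)^j$ be the homomorphism sending $(\phi,r)$ to the tuple with $-1$ in place $r$ and $1$ elsewhere, with components $p_1,\dots,p_j$. Define $\circ_i:D_n(j;V)\times D_n(k;W)\to D_n(j+k-1;V\oplus W)$ by $x\circ_iy=x\vdash_ic_i(y)$, where (suppressing the inclusions of $V,W$ in $V\oplus W$): $c_i$ is the homomorphism $c_i(\phi,r)=(\phi,r+i-1)$; $z\mapsto\bar z$ is the automorphism of $D_n(j+k-1;V\oplus W)$ sending $(\phi,r)$ to $(\phi,k+2i-r-1)$ if $i\le r<k+i$ and fixing $(\phi,r)$ otherwise; and $\vdash_i$ is the left action of $D_n(j;V)$ on $D_n(j+k-1;V\oplus W)$ given by $(\phi,r)\vdash_iz=(\phi,r)z$ if $r<i$, $=(\phi,i+k-1)(\phi,i+k-2)\cdots(\phi,i)\bar z$ if $r=i$, and $=(\phi,r+k-1)z$ if $r>i$. On products put $(x,\rho)\circ_i(y,\upsilon)=(x\circ_{\rho(i)}y,\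 \rho\circ_i(\tau_k(p_{\rho(i)}(x))\upsilon))$. Together with $S^V\wedge S^W\cong S^{V\oplus W}$ these induce $\circ_i:\mathcal{D}_n(j)\wedge\mathcal{D}_n(k)\to\mathcal{D}_n(j+k-1)$. The unit $S\to\mathcal{D}_n(1)$ is given by the element $(1,\mathrm{id})$. *)

(* Defs.v *)
(* This file uses Mathematical Components with MathComp-Analysis; the real
   numbers are an arbitrary [R : realType]. *)
From HB Require Import structures.
From mathcomp Require Import all_boot all_order all_algebra all_fingroup.
From mathcomp Require Import sesquilinear.
From mathcomp Require Import all_classical reals topology.
From mathcomp Require Import generic_quotient zify.

Set Implicit Arguments.
Unset Strict Implicit.
Unset Printing Implicit Defensive.

Import Order.TTheory GRing.Theory Num.Theory.

Local Open Scope classical_set_scope.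
Local Open Scope quotient_scope.
Local Open Scope ring_scope.

Section CompactlyGenerated.
Context {X : topologicalType}.

Definition kopen (U : set X) : Prop :=
  forall (K : topologicalType) (f : K -> X),
    compact [set: K] -> hausdorff_space K -> continuous f -> open (f @^-1` U).

Lemma kopenT : kopen setT.
Proof. by move=> K f _ _ _; rewrite preimage_setT; exact: openT. Qed.

Lemma kopenI : setI_closed kopen.
Proof.
by move=> A B oA oB K f cK hK cf; apply: openI; [exact: oA|exact: oB].
Qed.

Lemma kopen_bigU (I : Type) (A : I -> set X) :
  (forall i, kopen (A i)) -> kopen (\bigcup_i A i).
Proof.
move=> oA K f cK hK cf; rewrite preimage_bigcup.
by apply: bigcup_open => i _; exact: oA.
Qed.

End CompactlyGenerated.

(* No separation axiom is imposed. *)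
Definition compactly_generated (X : topologicalType) : Prop :=
  forall U : set X, kopen U -> open U.

(* [kify X] is X with the coarsest compactly generated topology that is finer
   than that of X. *)
Definition kify (X : Type) : Type := X.

HB.instance Definition _ (X : choiceType) := Choice.copy (kify X) X.
HB.instance Definition _ (X : topologicalType) :=
  isOpenTopological.Build (kify X) (@kopenT X) (@kopenI X) (@kopen_bigU X).
HB.instance Definition _ (X : ptopologicalType) := Pointed.copy (kify X) X.

(* The categorical product of compactly generated spaces. *)
Definition kprod (X Y : Type) : Type := kify (X * Y)%type.

HB.instance Definition _ (X Y : topologicalType) :=
  Topological.copy (kprod X Y) (kify (X * Y)%type).
HB.instance Definition _ (X Y : ptopologicalType) :=
  Pointed.copy (kprod X Y) (kify (X * Y)%type).

(* A based space is a [ptopologicalType], with base point [point]. *)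

Definition plus (X : Type) : Type := option X.

Section Plus.
Context {X : topologicalType}.

Definition plus_open (U : set (plus X)) : Prop := open (Some @^-1` U : set X).

Lemma plus_openT : plus_open setT.
Proof. by rewrite /plus_open preimage_setT; exact: openT. Qed.

Lemma plus_openI : setI_closed plus_open.
Proof. by move=> A B; exact: openI. Qed.

Lemma plus_open_bigU (I : Type) (A : I -> set (plus X)) :
  (forall i, plus_open (A i)) -> plus_open (\bigcup_i A i).
Proof.
by move=> oA; rewrite /plus_open preimage_bigcup; apply: bigcup_open => i _;
  exact: oA.
Qed.

End Plus.

HB.instance Definition _ (X : choiceType) := Choice.copy (plus X) (option X).
HB.instance Definition _ (X : topologicalType) :=
  isOpenTopological.Build (plus X)
    (@plus_openT X) (@plus_openI X) (@plus_open_bigU X).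
HB.instance Definition _ (X : topologicalType) := isPointed.Build (plus X) None.

Section Smash.
Variables X Y : ptopologicalType.

Definition in_wedge (p : kprod X Y) : bool :=
  (p.1 == point) || (p.2 == point).

Definition smash_rel (p q : kprod X Y) : bool :=
  (p == q) || (in_wedge p && in_wedge q).

Lemma smash_rel_equiv : equiv_class_of smash_rel.
Proof.
split=> [p|p q|q p r]; rewrite /smash_rel ?eqxx//.
- by rewrite eq_sym andbC.
- by move=> /orP[/eqP->//|/andP[Hp Hq]] /orP[/eqP<-|/andP[_ ->]];
    rewrite ?Hp ?Hq orbT.
Qed.

Canonical smash_equiv := EquivRelPack smash_rel_equiv.

Definition smash : ptopologicalType := quotient_topology {eq_quot smash_equiv}.

Definition smash_pair (x : X) (y : Y) : smash := \pi_smash ((x, y) : kprod X Y).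

(* The function on X ∧ Y given by f on pairs, provided that f is constant on the
   wedge, see [smash_recE]. *)
Definition smash_rec (Z : Type) (f : X -> Y -> Z) (q : smash) : Z :=
  f (repr q).1 (repr q).2.

Lemma smash_recE (Z : Type) (z : Z) (f : X -> Y -> Z) :
  (forall y, f point y = z) -> (forall x, f x point = z) ->
  forall x y, smash_rec f (smash_pair x y) = f x y.
Proof.
move=> f1 f2 x y; rewrite /smash_rec.
have : smash_rel (repr (smash_pair x y)) (x, y).
  by apply/eqmodP; rewrite reprK.
case: (repr _) => x' y' /=.
have wE (p : kprod X Y) : in_wedge p -> f p.1 p.2 = z.
  by case/orP => /eqP ->.
by case/orP => [/eqP[-> ->]//|/andP[/wE /= -> /wE /= ->]].
Qed.

Lemma smash_surj (q : smash) : exists x y, q = smash_pair x y.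
Proof.
exists (repr q).1, (repr q).2.
by rewrite /smash_pair -surjective_pairing reprK.
Qed.

End Smash.

Local Notation "x ∧ y" := (smash_pair x y) (at level 40).

Record ips (R : realType) := Ips {
  ips_sort :> vectType R;
  ips_dot : {dot ips_sort for idfun} }.

Section InnerProductSpaces.
Context {R : realType}.

Definition dotp (V : ips R) : V -> V -> R := ips_dot V.

Definition ips_norm (V : ips R) (x : V) : R := Num.sqrt (dotp x x).

(* The underlying topological space of V. *)
Definition ips_space (V : ips R) : Type := V.

Section IpsTopology.
Variable V : ips R.

Definition ips_open (U : set (ips_space V)) : Prop :=
  forall x : V, U x ->
    exists2 e : R, 0 < e & forall y : V, ips_norm (y - x) < e -> U y.

Lemma ips_openT : ips_open setT.
Proof. by move=> x _; exists 1. Qed.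

Lemma ips_openI : setI_closed ips_open.
Proof.
move=> A B oA oB x [/oA[e e0 He] /oB[d d0 Hd]].
exists (Num.min e d); first by rewrite lt_min e0.
by move=> y; rewrite lt_min => /andP[/He ? /Hd ?].
Qed.

Lemma ips_open_bigU (I : Type) (A : I -> set (ips_space V)) :
  (forall i, ips_open (A i)) -> ips_open (\bigcup_i A i).
Proof.
by move=> oA x [i _ /oA[e e0 He]]; exists e => // y /He; exists i.
Qed.

HB.instance Definition _ := Choice.copy (ips_space V) V.
HB.instance Definition _ := isOpenTopological.Build (ips_space V)
  ips_openT ips_openI ips_open_bigU.

End IpsTopology.

Section DirectSum.
Variables V W : ips R.

Definition dsum_dot (x y : V * W) : R := dotp x.1 y.1 + dotp x.2 y.2.

Lemma dsum_dot_bilinear :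
  bilinear_for ( *%R : R -> R -> R) (idfun \; *%R : R -> R -> R) dsum_dot.
Proof.
split=> [u a x y|u a x y]; rewrite /dsum_dot /dotp/=.
  by rewrite !linearPl/= mulrDr addrACA.
by rewrite !linearPr/= mulrDr addrACA.
Qed.

Lemma dsum_dot_sym x y :
  dsum_dot x y = (-1) ^+ false * (idfun : R -> R) (dsum_dot y x).
Proof.
rewrite expr0 mul1r /= /dsum_dot /dotp.
by congr (_ + _); rewrite hermitian_subproof expr0 mul1r.
Qed.

Lemma dsum_dot_pos u : u != 0 -> 0 < dsum_dot u u.
Proof.
have ge0 (U : ips R) (x : U) : 0 <= dotp x x.
  have [->|x0] := eqVneq x 0; first by rewrite /dotp linear0l.
  by apply/ltW; exact: neq0_dnorm_gt0.
move=> u0; have {u0} : (u.1 != 0) || (u.2 != 0).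
  rewrite -negb_and; apply: contraNN u0 => /andP[/eqP u1 /eqP u2].
  by apply/eqP; rewrite [u]surjective_pairing u1 u2.
rewrite /dsum_dot => /orP[u0|u0].
  by apply: ltr_pwDl => //; exact: neq0_dnorm_gt0.
by apply: ltr_wpDl => //; exact: neq0_dnorm_gt0.
Qed.

HB.instance Definition _ := bilinear_isBilinear.Build R (V * W)%type (V * W)%type
  R *%R (idfun \; *%R) dsum_dot dsum_dot_bilinear.
HB.instance Definition _ := isHermitianSesquilinear.Build R (V * W)%type
  false idfun dsum_dot dsum_dot_sym.
HB.instance Definition _ := isDotProduct.Build R (V * W)%type
  dsum_dot dsum_dot_pos.

Definition dsum : ips R := @Ips R (V * W)%type dsum_dot.

End DirectSum.

Section Standard.
Variable n : nat.

Definition std_dot (x y : 'rV[R]_n) : R := \sum_(i < n) x 0 i * y 0 i.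

Lemma std_dot_bilinear :
  bilinear_for ( *%R : R -> R -> R) (idfun \; *%R : R -> R -> R) std_dot.
Proof.
split=> [u a x y|u a x y]; rewrite /std_dot /= mulr_sumr -big_split /=;
  apply: eq_bigr => i _; rewrite !mxE; first by rewrite mulrDl mulrA.
by rewrite mulrDr mulrCA.
Qed.

Lemma std_dot_sym x y :
  std_dot x y = (-1) ^+ false * (idfun : R -> R) (std_dot y x).
Proof.
by rewrite expr0 mul1r /=; apply: eq_bigr => i _; rewrite mulrC.
Qed.

Lemma std_dot_pos u : u != 0 -> 0 < std_dot u u.
Proof.
move=> u0; rewrite lt_def; apply/andP; split; last first.
  by apply: sumr_ge0 => i _; rewrite -expr2 sqr_ge0.
apply: contraNN u0; rewrite psumr_eq0; last by move=> i _; rewrite -expr2 sqr_ge0.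
move=> /allP u0; apply/eqP/rowP => i; rewrite mxE.
by have := u0 i (mem_index_enum _); rewrite /= mulf_eq0 orbb => /eqP.
Qed.

HB.instance Definition _ := bilinear_isBilinear.Build R 'rV[R]_n 'rV[R]_n
  R *%R (idfun \; *%R) std_dot std_dot_bilinear.
HB.instance Definition _ := isHermitianSesquilinear.Build R 'rV[R]_n
  false idfun std_dot std_dot_sym.
HB.instance Definition _ := isDotProduct.Build R 'rV[R]_n std_dot std_dot_pos.

Definition std : ips R := @Ips R 'rV[R]_n std_dot.

End Standard.

End InnerProductSpaces.

Local Notation "V ⊕ W" := (dsum V W) (at level 50, left associativity).

Section Isometries.
Context {R : realType}.
Implicit Types U V W : ips R.

Record emb V W := Emb {
  emb_fun :> V -> W;
  emb_linear : linear emb_fun;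
  emb_isometric : forall x y, dotp (emb_fun x) (emb_fun y) = dotp x y }.

HB.instance Definition _ V W := gen_eqMixin (emb V W).
HB.instance Definition _ V W := gen_choiceMixin (emb V W).

(* The topology of the operator norm. *)
Definition emb_open V W (A : set (emb V W)) : Prop :=
  forall f, A f -> exists2 e : R, 0 < e &
    forall g : emb V W,
      (forall x, ips_norm (g x - f x) <= e * ips_norm x) -> A g.

Lemma emb_openT V W : emb_open (@setT (emb V W)).
Proof. by move=> f _; exists 1. Qed.

Lemma emb_openI V W : setI_closed (@emb_open V W).
Proof.
move=> A B oA oB f [/oA[e e0 He] /oB[d d0 Hd]].
exists (Num.min e d); first by rewrite lt_min e0.
move=> g Hg; split; [apply: He|apply: Hd] => x; apply: le_trans (Hg x) _;
  by rewrite ler_wpM2r ?sqrtr_ge0// ge_min lexx ?orbT.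
Qed.

Lemma emb_open_bigU V W (I : Type) (A : I -> set (emb V W)) :
  (forall i, emb_open (A i)) -> emb_open (\bigcup_i A i).
Proof.
by move=> oA f [i _ /oA[e e0 He]]; exists e => // g /He; exists i.
Qed.

HB.instance Definition _ V W := isOpenTopological.Build (emb V W)
  (@emb_openT V W) (@emb_openI V W) (@emb_open_bigU V W).

Record liso V W := Liso {
  liso_emb :> emb V W;
  liso_bij : bijective liso_emb }.

HB.instance Definition _ V W := gen_eqMixin (liso V W).
HB.instance Definition _ V W := gen_choiceMixin (liso V W).
HB.instance Definition _ V W := Topological.copy (liso V W)
  (initial_topology (@liso_emb V W : liso V W -> emb V W)).

Definition emb_comp U V W (g : emb V W) (f : emb U V) : emb U W.
Proof.
by exists (g \o f) => [a x y|x y] /=; rewrite ?emb_linear ?emb_isometric.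
Defined.

Definition emb_inl V W : emb V (V ⊕ W).
Proof.
exists (fun x => (x, 0)) => [a x y|x y].
  by congr pair => /=; rewrite scaler0 addr0.
by rewrite {1}/dotp /= /dsum_dot /= {2}/dotp linear0l addr0.
Defined.

Definition emb_inr V W : emb W (V ⊕ W).
Proof.
exists (fun x => (0, x)) => [a x y|x y].
  by congr pair => /=; rewrite scaler0 addr0.
by rewrite {1}/dotp /= /dsum_dot /= {1}/dotp linear0l add0r.
Defined.

Definition liso_id V : liso V V.
Proof. by exists (@Emb V V id (fun _ _ _ => erefl) (fun _ _ => erefl)); exists id. Defined.

Definition liso_comp U V W (g : liso V W) (f : liso U V) : liso U W.
Proof. by exists (emb_comp g f); apply: bij_comp; exact: liso_bij. Defined.

Definition liso_dsum V V' W W' (f : liso V V') (g : liso W W') :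
  liso (V ⊕ W) (V' ⊕ W').
Proof.
unshelve eexists.
  exists (fun p => (f p.1, g p.2)) => [a x y|x y] /=.
    by rewrite !emb_linear.
  by rewrite /dotp /= /dsum_dot !emb_isometric.
case: (liso_bij f) => f' fK f'K; case: (liso_bij g) => g' gK g'K.
by exists (fun p => (f' p.1, g' p.2)) => -[x y] /=; rewrite ?fK ?gK ?f'K ?g'K.
Defined.

(* (U ⊕ V) ⊕ W ≅ U ⊕ (V ⊕ W) *)
Definition liso_assoc U V W : liso (U ⊕ V ⊕ W) (U ⊕ (V ⊕ W)).
Proof.
unshelve eexists.
  exists (fun p => (p.1.1, (p.1.2, p.2))) => [a x y|x y] //=.
  by rewrite /dotp /= /dsum_dot /= /dotp /= /dsum_dot /= addrA.
by exists (fun p => ((p.1, p.2.1), p.2.2)) => [[[x y] z]|[x [y z]]].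
Defined.

(* U ⊕ (V ⊕ W) ≅ (U ⊕ V) ⊕ W *)
Definition liso_assoc' U V W : liso (U ⊕ (V ⊕ W)) (U ⊕ V ⊕ W).
Proof.
unshelve eexists.
  exists (fun p => ((p.1, p.2.1), p.2.2)) => [a x y|x y] //=.
  by rewrite /dotp /= /dsum_dot /= /dotp /= /dsum_dot /= addrA.
by exists (fun p => (p.1.1, (p.1.2, p.2))) => [[x [y z]]|[[x y] z]].
Defined.

(* V ⊕ W ≅ W ⊕ V *)
Definition liso_swap V W : liso (V ⊕ W) (W ⊕ V).
Proof.
unshelve eexists.
  exists (fun p => (p.2, p.1)) => [a x y|x y] //=.
  by rewrite /dotp /= /dsum_dot /= addrC.
by exists (fun p => (p.2, p.1)) => [[x y]|[x y]].
Defined.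

(* (U ⊕ V) ⊕ W ≅ (U ⊕ W) ⊕ V *)
Definition liso_swap23 U V W : liso (U ⊕ V ⊕ W) (U ⊕ W ⊕ V) :=
  liso_comp (liso_assoc' U W V)
    (liso_comp (liso_dsum (liso_id U) (liso_swap V W)) (liso_assoc U V W)).

(* V ⊕ 0 ≅ V, with R^0 as the zero space *)
Definition liso_dsum0 V : liso (V ⊕ std 0) V.
Proof.
unshelve eexists.
  exists fst => [a x y|x y] //=.
  by rewrite {2}/dotp /= /dsum_dot {3}/dotp /= /std_dot big_ord0 addr0.
exists (fun x => (x, 0)) => [[x y]|x] //=.
by congr pair; apply/rowP => -[].
Defined.

Definition sph V : ptopologicalType := one_point_compactification (ips_space V).

Definition sph_map V W (f : V -> W) (v : sph V) : sph W :=
  omap (f : ips_space V -> ips_space W) v.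

(* The homeomorphism S^V ∧ S^W ≅ S^(V ⊕ W) on pairs. *)
Definition sph_pair V W (v : sph V) (w : sph W) : sph (V ⊕ W) :=
  if v is Some a then if w is Some b then Some (a, b) else None else None.

End Isometries.

Section Spectra.
Context {R : realType}.

Record spectrum_data := SpectrumData {
  sp_obj :> ips R -> ptopologicalType;
  sp_map : forall V W, liso V W -> sp_obj V -> sp_obj W;
  sp_str : forall V W, smash (sp_obj V) (sph W) -> sp_obj (V ⊕ W) }.

Record is_spectrum (L : spectrum_data) : Prop := {
  sp_cg : forall V, compactly_generated (L V);
  (* continuity of the functor, in adjoint form *)
  sp_map_continuous : forall V W,
    continuous (fun p : kprod (liso V W) (L V) => sp_map p.1 p.2);
  sp_map_point : forall V W (f : liso V W), sp_map f (point : L V) = point;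
  sp_map_id : forall V (x : L V), sp_map (liso_id V) x = x;
  sp_map_comp : forall U V W (g : liso V W) (f : liso U V) (x : L U),
    sp_map (liso_comp g f) x = sp_map g (sp_map f x);
  sp_str_continuous : forall V W, continuous (@sp_str L V W);
  sp_str_point : forall V W, @sp_str L V W point = point;
  sp_str_natural : forall V V' W W' (f : liso V V') (g : liso W W')
      (x : L V) (w : sph W),
    sp_str (sp_map f x ∧ sph_map g w) = sp_map (liso_dsum f g) (sp_str (x ∧ w));
  sp_str_unital : forall V (x : L V),
    sp_map (liso_dsum0 V) (sp_str (x ∧ (Some 0 : sph (std 0)))) = x;
  sp_str_assoc : forall U V W (x : L U) (v : sph V) (w : sph W),
    sp_map (liso_assoc U V W) (sp_str (sp_str (x ∧ v) ∧ w)) =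
    sp_str (x ∧ sph_pair v w) }.

Record is_spectrum_map (K L : spectrum_data) (f : forall V, K V -> L V) :
    Prop := {
  spm_continuous : forall V, continuous (f V);
  spm_point : forall V, f V point = point;
  spm_natural : forall V W (a : liso V W) (x : K V),
    f W (sp_map a x) = sp_map a (f V x);
  spm_str : forall V W (x : K V) (w : sph W),
    f (V ⊕ W) (sp_str (x ∧ w)) = sp_str (f V x ∧ w) }.

Definition sphere : spectrum_data := @SpectrumData sph
  (fun V W f => sph_map f) (fun V W => smash_rec (@sph_pair R V W)).

(* A map K ∧ L -> X out of the smash product of spectra, given by the
   corresponding family of maps K(V) ∧ L(W) -> X(V ⊕ W).  The left structure
   map of K is [sp_str] with the sphere moved past, so compatibility with it
   involves the exchange of the last two summands. *)
Record is_smash_map (K L X : spectrum_data)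
    (b : forall V W, smash (K V) (L W) -> X (V ⊕ W)) : Prop := {
  sm_continuous : forall V W, continuous (b V W);
  sm_point : forall V W, b V W point = point;
  sm_natural : forall V V' W W' (f : liso V V') (g : liso W W') x y,
    b V' W' (sp_map f x ∧ sp_map g y) = sp_map (liso_dsum f g) (b V W (x ∧ y));
  sm_right : forall V W U (x : K V) (y : L W) (u : sph U),
    sp_map (liso_assoc V W U) (sp_str (b V W (x ∧ y) ∧ u)) =
    b V (W ⊕ U) (x ∧ sp_str (y ∧ u));
  sm_left : forall V W U (x : K V) (y : L W) (u : sph U),
    sp_map (liso_swap23 V W U) (sp_str (b V W (x ∧ y) ∧ u)) =
    b (V ⊕ U) W (sp_str (x ∧ u) ∧ y) }.

End Spectra.

Arguments spectrum_data : clear implicits.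
Arguments sphere {R}.

(* Places are numbered from 0, so [i : 'I_m] stands for the place i + 1.  The
   product of MathComp permutations is composition in diagrammatic order: the
   product ρν, first ν and then ρ, is [(nu * rho)%g]. *)

Section BlockPerm.
Variables m k : nat.

Lemma inner_subproof (i : 'I_m) (r : 'I_k) : (i + r < (m + k).-1)%N.
Proof.
case: i r => i im [r rk] /=; rewrite -ltnS prednK; last first.
  by rewrite addn_gt0 (leq_ltn_trans _ im).
by rewrite -addSn -addnS leq_add.
Qed.

(* The place of the (r+1)-st entry of the block put in at place i. *)
Definition inner (i : 'I_m) (r : 'I_k) : 'I_(m + k).-1 :=
  Ordinal (inner_subproof i r).

Lemma outer_subproof (i : 'I_m) (s : 'I_m.-1) :
  ((if s < i then nat_of_ord s else s + k) < (m + k).-1)%N.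
Proof.
have m0 : (0 < m)%N by case: i => i; exact: leq_ltn_trans.
have -> : ((m + k).-1 = m.-1 + k)%N by rewrite -{1}(prednK m0).
case: ifP => _; last by rewrite ltn_add2r.
by rewrite (leq_trans (ltn_ord s)) ?leq_addr.
Qed.

(* The new place of the place [lift i s]. *)
Definition outer (i : 'I_m) (s : 'I_m.-1) : 'I_(m + k).-1 :=
  Ordinal (outer_subproof i s).

Lemma block_split_subproof (i : 'I_m) (t : 'I_(m + k).-1) :
  {z : 'I_m.-1 + 'I_k |
    t = match z with inl s => outer i s | inr r => inner i r end}.
Proof.
have im := ltn_ord i; have tmk := ltn_ord t.
have m0 : (0 < m)%N by exact: leq_ltn_trans im.
have im1 : (i <= m.-1)%N by rewrite -ltnS prednK.
have mkE : ((m + k).-1 = m.-1 + k)%N by rewrite -{1}(prednK m0).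
have tmk' : (t < m.-1 + k)%N by rewrite -mkE.
have [ti|it] := ltnP t i.
  exists (inl (Ordinal (leq_trans ti im1))); apply: val_inj => /=.
  by rewrite ti.
have [tik|ikt] := ltnP t (i + k).
  have rk : (t - i < k)%N by rewrite ltn_subLR.
  by exists (inr (Ordinal rk)); apply: val_inj; rewrite /= subnKC.
have kt : (k <= t)%N by exact: leq_trans (leq_addl _ _) ikt.
have sm : (t - k < m.-1)%N by rewrite ltn_subLR // [(k + _)%N]addnC.
exists (inl (Ordinal sm)); apply: val_inj => /=.
by rewrite ltn_subLR // [(k + i)%N]addnC ltnNge ikt /= subnK.
Qed.

Definition block_split (i : 'I_m) (t : 'I_(m + k).-1) : 'I_m.-1 + 'I_k :=
  sval (block_split_subproof i t).

Lemma block_splitP (i : 'I_m) (t : 'I_(m + k).-1) :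
  t = match block_split i t with inl s => outer i s | inr r => inner i r end.
Proof. exact: svalP (block_split_subproof i t). Qed.

Lemma outer_inj (i : 'I_m) : injective (outer i).
Proof.
move=> s s' /(congr1 val) /=.
have le_lt (a b : 'I_m.-1) : (a < i)%N -> (i <= b)%N -> val a = (b + k)%N -> False.
  by move=> ai ib ab; move: ai; rewrite ab ltnNge (leq_trans ib) ?leq_addr.
case: ltnP => si; case: ltnP => si' e; apply: val_inj => //=.
- by case: (le_lt s s').
- by case: (le_lt s' s).
- by move/eqP: e; rewrite eqn_add2r => /eqP.
Qed.

Lemma inner_inj (i : 'I_m) : injective (inner i).
Proof. by move=> r r' /(congr1 val) /= /addnI /val_inj. Qed.

Lemma outer_inner (i : 'I_m) s r : outer i s <> inner i r.
Proof.
move=> /(congr1 val) /=; case: ltnP => si e.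
  by move: si; rewrite e ltnNge leq_addr.
by move: (ltn_ord r); rewrite -(ltn_add2l i) -e ltn_add2r ltnNge si.
Qed.

Lemma perm_lift_subproof (i : 'I_m) (rho : 'S_m) (s : 'I_m.-1) :
  {s' : 'I_m.-1 | rho (lift i s) = lift (rho i) s'}.
Proof.
have: rho i != rho (lift i s) by rewrite (inj_eq perm_inj) neq_lift.
by case/unlift_some => s' e _; exists s'.
Qed.

(* ρ ∘_i υ : the 1 in column i and row ρ(i) of the matrix of ρ is replaced by
   the matrix of υ. *)
Definition perm_circ_fun (i : 'I_m) (rho : 'S_m) (ups : 'S_k)
    (t : 'I_(m + k).-1) : 'I_(m + k).-1 :=
  match block_split i t with
  | inr r => inner (rho i) (ups r)
  | inl s => outer (rho i) (sval (perm_lift_subproof i rho s))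
  end.

Lemma perm_circ_inj i rho ups : injective (perm_circ_fun i rho ups).
Proof.
move=> t t'; have := block_splitP i t; have := block_splitP i t'.
rewrite /perm_circ_fun; case: (block_split i t') (block_split i t) =>
  [s'|r'] [s|r] -> ->.
- move=> /outer_inj ss'; congr outer; apply: (@lift_inj _ i).
  apply: (@perm_inj _ rho).
  by rewrite (svalP (perm_lift_subproof i rho s)) ss'
    -(svalP (perm_lift_subproof i rho s')).
- by move=> /esym/outer_inner.
- by move=> /outer_inner.
- by move=> /inner_inj/perm_inj ->.
Qed.

Definition perm_circ (i : 'I_m) (rho : 'S_m) (ups : 'S_k) : 'S_(m + k).-1 :=
  perm (@perm_circ_inj i rho ups).

End BlockPerm.

(* τ_k, with [true] standing for -1. *)
Definition tau (k : nat) (e : bool) : 'S_k :=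
  if e then perm (@rev_ord_inj k) else 1%g.

Section Operads.
Context {R : realType}.

Record operad_data := OperadData {
  op_sp :> nat -> spectrum_data R;
  op_act : forall j, 'S_j -> forall V, op_sp j V -> op_sp j V;
  op_circ : forall m k, 'I_m -> forall V W,
    smash (op_sp m V) (op_sp k W) -> op_sp (m + k).-1 (V ⊕ W);
  op_unit : forall V, sph V -> op_sp 1 V;
  op_zero : forall V, sph V -> op_sp 0 V }.

Arguments op_act P {j} nu {V} x : rename.
Arguments op_circ P {m k} i {V W} q : rename.
Arguments op_unit P {V} v : rename.
Arguments op_zero P {V} v : rename.

(* Equality of points of P(a)(V) and P(b)(V), where a = b is provable but need
   not hold by computation. *)
Definition arity_eq (P : operad_data) (V : ips R) (a b : nat)
    (x : P a V) (y : P b V) : Prop :=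
  exists e : a = b, ecast c (P c V) e x = y.

(* The equations between maps out of iterated smash products are stated on
   points x ∧ y ∧ z of P(m)(U) ∧ P(k)(V) ∧ P(l)(W).  With places numbered from 0
   the places j + l - 1, i - j + 1 and i - k + 1 of the associativity laws become
   j + l - 1, i - j and i + 1 - k. *)
Record is_operad (P : operad_data) : Prop := {
  op_spectrum : forall j, is_spectrum (P j);
  op_act_map : forall j (nu : 'S_j), is_spectrum_map (@op_act P j nu);
  op_act1 : forall j V (x : P j V), op_act P 1%g x = x;
  op_actM : forall j (rho nu : 'S_j) V (x : P j V),
    op_act P nu (op_act P rho x) = op_act P (nu * rho)%g x;
  op_circ_map : forall m k (i : 'I_m), is_smash_map (@op_circ P m k i);
  op_unit_map : @is_spectrum_map R sphere (P 1%N) (@op_unit P);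
  (* The identification of P(0) with S. *)
  op_zero_map : @is_spectrum_map R sphere (P 0%N) (@op_zero P);
  op_zero_iso : exists2 g : forall V, P 0%N V -> sph V,
    @is_spectrum_map R (P 0%N) sphere g &
    forall V, cancel (@op_zero P V) (g V) /\ cancel (g V) (@op_zero P V);
  op_circ_lt : forall m k l (i' j : 'I_m) (i : 'I_(m + k).-1)
      (j' : 'I_(m + l).-1) U V W (x : P m U) (y : P k V) (z : P l W),
    (i < j)%N -> i' = i :> nat -> j' = (j + l).-1 :> nat ->
    arity_eq (op_circ P i (op_circ P j (x ∧ y) ∧ z))
      (sp_map (liso_swap23 U W V) (op_circ P j' (op_circ P i' (x ∧ z) ∧ y)));
  op_circ_mid : forall m k l (j : 'I_m) (i : 'I_(m + k).-1) (i' : 'I_k)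
      U V W (x : P m U) (y : P k V) (z : P l W),
    (j <= i < j + k)%N -> i' = (i - j)%N :> nat ->
    arity_eq (sp_map (liso_assoc U V W) (op_circ P i (op_circ P j (x ∧ y) ∧ z)))
      (op_circ P j (x ∧ op_circ P i' (y ∧ z)));
  op_circ_ge : forall m k l (i' j : 'I_m) (i : 'I_(m + k).-1)
      (j' : 'I_(m + l).-1) U V W (x : P m U) (y : P k V) (z : P l W),
    (j + k <= i)%N -> i' = (i.+1 - k)%N :> nat -> j' = j :> nat ->
    arity_eq (op_circ P i (op_circ P j (x ∧ y) ∧ z))
      (sp_map (liso_swap23 U W V) (op_circ P j' (op_circ P i' (x ∧ z) ∧ y)));
  op_circ_act : forall m k (i : 'I_m) (rho : 'S_m) (ups : 'S_k) V W
      (x : P m V) (y : P k W),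
    op_circ P i (op_act P rho x ∧ op_act P ups y) =
    op_act P (perm_circ i rho ups) (op_circ P (rho i) (x ∧ y));
  op_unit_r : forall m (i : 'I_m) V W (x : P m V) (w : sph W),
    arity_eq (op_circ P i (x ∧ op_unit P w)) (sp_str (x ∧ w));
  op_unit_l : forall k (i : 'I_1) V W (v : sph V) (y : P k W),
    arity_eq (op_circ P i (op_unit P v ∧ y))
      (sp_map (liso_swap W V) (sp_str (y ∧ v))) }.

Record operad := Operad {
  operad_of :> operad_data;
  operadP : is_operad operad_of }.

Record operad_map (P Q : operad) := OperadMap {
  om_fun : forall j V, P j V -> Q j V;
  om_map : forall j, is_spectrum_map (@om_fun j);
  om_act : forall j (nu : 'S_j) V (x : P j V),
    om_fun (op_act P nu x) = op_act Q nu (om_fun x);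
  om_circ : forall m k (i : 'I_m) V W (x : P m V) (y : P k W),
    om_fun (op_circ P i (x ∧ y)) = op_circ Q i (om_fun x ∧ om_fun y);
  om_unit : forall V (v : sph V), om_fun (op_unit P v) = op_unit Q v;
  om_zero : forall V (v : sph V), om_fun (op_zero P v) = op_zero Q v }.

End Operads.

Arguments operad_data : clear implicits.
Arguments operad : clear implicits.

(* The data out of which both H and D_n are made.  [ls_sign x r] is true when
   the sign of x at place r is -1. *)
Record layers (R : realType) := Layers {
  ls_space :> nat -> ips R -> topologicalType;
  ls_map : forall j (V W : ips R), emb V W -> ls_space j V -> ls_space j W;
  ls_circ : forall m k, 'I_m -> forall V W : ips R,
    ls_space m V -> ls_space k W -> ls_space (m + k).-1 (V ⊕ W);
  ls_sign : forall j (V : ips R), ls_space j V -> 'I_j -> bool;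
  ls_one : forall j (V : ips R), ls_space j V }.

Section TwistedSuspension.
Context {R : realType}.
Variable A : layers R.

Definition susp_cells j (V : ips R) : topologicalType :=
  kprod (A j V) (discrete_topology 'S_j).

Definition susp_obj j (V : ips R) : ptopologicalType :=
  smash (plus (susp_cells j V)) (sph V).

Definition susp_pt j (V : ips R) (x : A j V) (rho : 'S_j) (v : sph V) :
    susp_obj j V :=
  (Some (x, rho) : plus (susp_cells j V)) ∧ v.

(* A function out of [susp_obj j V] that sends the base point to z. *)
Definition susp_rec j (V : ips R) (Z : Type) (z : Z)
    (f : A j V -> 'S_j -> sph V -> Z) : susp_obj j V -> Z :=
  @smash_rec (plus (susp_cells j V)) (sph V) Z
    (fun a v => if a is Some (x, rho) then f x rho v else z).

Lemma susp_recE j (V : ips R) (Z : Type) (z : Z)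
    (f : A j V -> 'S_j -> sph V -> Z) :
  (forall x rho, f x rho point = z) ->
  forall x rho v, susp_rec z f (susp_pt x rho v) = f x rho v.
Proof.
move=> fz x rho v; rewrite /susp_rec /susp_pt.
by rewrite (@smash_recE _ _ _ z)// => -[[a b]|] //=; rewrite fz.
Qed.

Definition susp_map j (V W : ips R) (f : liso V W) :
    susp_obj j V -> susp_obj j W :=
  susp_rec point (fun x rho v => susp_pt (ls_map f x) rho (sph_map f v)).

Definition susp_str j (V W : ips R) :
    smash (susp_obj j V) (sph W) -> susp_obj j (V ⊕ W) :=
  smash_rec (fun a w => susp_rec point (fun x rho v =>
    susp_pt (ls_map (emb_inl V W) x) rho (sph_pair v w)) a).

Definition susp_spectrum j : spectrum_data R :=
  @SpectrumData R (susp_obj j) (@susp_map j) (@susp_str j).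

Definition susp_act j (nu : 'S_j) (V : ips R) : susp_obj j V -> susp_obj j V :=
  susp_rec point (fun x rho v => susp_pt x (nu * rho)%g v).

Definition susp_circ m k (i : 'I_m) (V W : ips R) :
    smash (susp_obj m V) (susp_obj k W) -> susp_obj (m + k).-1 (V ⊕ W) :=
  smash_rec (fun a b =>
    susp_rec point (fun x rho v =>
      susp_rec point (fun y ups w =>
        susp_pt (ls_circ (rho i) x y)
          (perm_circ i rho (ups * tau k (ls_sign x (rho i)))%g)
          (sph_pair v w)) b) a).

Definition susp_one j (V : ips R) (v : sph V) : susp_obj j V :=
  susp_pt (ls_one A j V) 1%g v.

Definition susp_operad : operad_data R :=
  @OperadData R susp_spectrum susp_act susp_circ (susp_one 1) (susp_one 0).

End TwistedSuspension.

Section CalH.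
Variable R : realType.

(* (Z/2)^j with true for -1 and false for 1. *)
Definition signs (j : nat) : Type := discrete_topology {ffun 'I_j -> bool}.

HB.instance Definition _ j := Topological.copy (signs j)
  (discrete_topology {ffun 'I_j -> bool}).

Definition signs_circ m k (i : 'I_m) (x : signs m) (y : signs k) :
    signs (m + k).-1 :=
  [ffun t => match block_split i t with
             | inl s => (x : {ffun _}) (lift i s)
             | inr r => if (x : {ffun _}) i
                        then ~~ (y : {ffun _}) (rev_ord r)
                        else (y : {ffun _}) r
             end].

Definition H_layers : layers R :=
  @Layers R (fun j _ => signs j) (fun _ _ _ _ x => x)
    (fun m k i _ _ x y => signs_circ i x y)
    (fun j _ x r => (x : {ffun 'I_j -> bool}) r)
    (fun j _ => [ffun => false]).

Definition calH : operad_data R := susp_operad H_layers.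

End CalH.

Section Dgroup.
Context {R : realType}.
Variables (n j : nat) (V : ips R).

(* The space X of generators. *)
Definition gen : Type := (emb (std n) V * discrete_topology 'I_j)%type.

HB.instance Definition _ := Topological.copy gen
  (emb (std n) V * discrete_topology 'I_j)%type.

Definition perp (phi psi : emb (std n) V) : Prop :=
  forall a b, dotp (phi a) (psi b) = 0.

(* The generators being involutions, every element of the group is represented
   by a word in X, and the inverse of a word is the reversed word. *)
Inductive weq : seq gen -> seq gen -> Prop :=
| weq_refl u : weq u u
| weq_sym u v : weq u v -> weq v u
| weq_trans u v w : weq u v -> weq v w -> weq u w
| weq_cat u u' v v' : weq u u' -> weq v v' -> weq (u ++ v) (u' ++ v')
| weq_invol g : weq [:: g; g] [::]
| weq_comm (g h : gen) : perp g.1 h.1 -> g.2 <> h.2 -> weq [:: g; h] [:: h; g].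

Definition weqb (u v : seq gen) : bool := `[< weq u v >].

Lemma weqb_equiv : equiv_class_of weqb.
Proof.
split=> [u|u v|v u w]; first by apply/asboolP; exact: weq_refl.
  by apply/idP/idP => /asboolP/weq_sym/asboolP.
by move=> /asboolP uv /asboolP vw; apply/asboolP; exact: weq_trans vw.
Qed.

Canonical weq_equiv := EquivRelPack weqb_equiv.

Definition dgrp : Type := {eq_quot weq_equiv}.

HB.instance Definition _ := Choice.on dgrp.

Definition word (u : seq gen) : dgrp := \pi_{eq_quot weq_equiv} u.

Definition letters (x : dgrp) : seq gen := repr (x : {eq_quot weq_equiv}).

Lemma lettersK x : word (letters x) = x.
Proof. exact: reprK. Qed.

Lemma wordP u v : word u = word v <-> weq u v.
Proof.
by split=> [/eqmodP/asboolP//|uv]; apply/eqmodP/asboolP.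
Qed.

Lemma letters_word u : weq (letters (word u)) u.
Proof. by apply/wordP; rewrite lettersK. Qed.

Definition dmul (x y : dgrp) : dgrp := word (letters x ++ letters y).
Definition dinv (x : dgrp) : dgrp := word (rev (letters x)).

Lemma dmulE u v : dmul (word u) (word v) = word (u ++ v).
Proof. by apply/wordP/weq_cat; exact: letters_word. Qed.

Lemma weq_rev u v : weq u v -> weq (rev u) (rev v).
Proof.
elim=> [{}u|{}u {}v _ IH|{}u {}v w _ IH _|{}u u' {}v v' _ IH _ IH'|g|g h p gh].
- exact: weq_refl.
- exact: weq_sym.
- exact: weq_trans.
- by rewrite !rev_cat; exact: weq_cat.
- exact: weq_invol.
- by apply/weq_sym/weq_comm.
Qed.

Lemma weq_cat_rev u : weq (u ++ rev u) [::].
Proof.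
elim: u => [|g u IH]; first exact: weq_refl.
rewrite rev_cons -cats1 -cat1s -catA [u ++ _]catA.
apply: weq_trans (weq_invol g); rewrite -[[:: g; g]]/([:: g] ++ ([::] ++ [:: g])).
by do 2![apply: weq_cat; rewrite //; try exact: weq_refl].
Qed.

Lemma dmulA : associative dmul.
Proof.
move=> x y z; rewrite -[x]lettersK -[y]lettersK -[z]lettersK.
by rewrite !dmulE catA.
Qed.

Lemma dmul1 : left_id (word [::]) dmul.
Proof. by move=> x; rewrite -[x]lettersK dmulE. Qed.

Lemma dmulr1 : right_id (word [::]) dmul.
Proof. by move=> x; rewrite -[x]lettersK dmulE cats0. Qed.

Lemma dmulV : right_inverse (word [::]) dinv dmul.
Proof.
move=> x; rewrite /dinv -{1}[x]lettersK dmulE.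
by apply/wordP; exact: weq_cat_rev.
Qed.

Lemma dmulVr : left_inverse (word [::]) dinv dmul.
Proof.
move=> x; rewrite /dinv -{2}[x]lettersK dmulE; apply/wordP.
by rewrite -{2}[letters x]revK; exact: weq_cat_rev.
Qed.

HB.instance Definition _ := isGroup.Build dgrp dmulA dmul1 dmulr1 dmulVr dmulV.

(* [filt_word m] maps the coproduct of the X^i, i <= m, onto the set of elements
   represented by words of length <= m. *)
Definition filt_word (m : nat)
    (w : {i : 'I_m.+1 & kify (prod_topology (fun _ : 'I_i => gen))}) : dgrp :=
  word (codom (projT2 w : 'I_(projT1 w) -> gen)).

(* U meets the elements of length <= m in a set that is open in the quotient
   topology. *)
Definition filt_open (m : nat) (U : set dgrp) : Prop :=
  open (@filt_word m @^-1` U).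

Definition dgrp_open (U : set dgrp) : Prop := forall m, filt_open m U.

Lemma dgrp_openT : dgrp_open setT.
Proof. by move=> m; rewrite /filt_open preimage_setT; exact: openT. Qed.

Lemma dgrp_openI : setI_closed dgrp_open.
Proof. by move=> A B oA oB m; apply: openI; [exact: oA|exact: oB]. Qed.

Lemma dgrp_open_bigU (I : Type) (A : I -> set dgrp) :
  (forall i, dgrp_open (A i)) -> dgrp_open (\bigcup_i A i).
Proof.
move=> oA m; rewrite /filt_open preimage_bigcup.
by apply: bigcup_open => i _; exact: oA.
Qed.

HB.instance Definition _ := isOpenTopological.Build dgrp
  dgrp_openT dgrp_openI dgrp_open_bigU.

(* The element (φ, r), also for r given as a natural number; the value 1 for
   r >= j is not used. *)
Definition dgen (phi : emb (std n) V) (r : nat) : dgrp :=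
  if insub r is Some r' then word [:: (phi, r' : 'I_j)] else 1%g.

Lemma dgen_ord phi (r : 'I_j) : dgen phi r = word [:: (phi, r)].
Proof. by rewrite /dgen valK. Qed.

Lemma dgen_invol phi r : (dgen phi r * dgen phi r = 1)%g.
Proof.
rewrite /dgen; case: insubP => [r' _ _|_]; last by rewrite mulg1.
by rewrite [LHS]dmulE; apply/wordP; exact: weq_invol.
Qed.

Lemma dgen_comm phi psi r s : perp phi psi -> r <> s ->
  (dgen phi r * dgen psi s = dgen psi s * dgen phi r)%g.
Proof.
move=> p rs; rewrite /dgen; case: insubP => [r' _ rE|_]; last first.
  by rewrite mul1g mulg1.
case: insubP => [s' _ sE|_]; last by rewrite mul1g mulg1.
rewrite [LHS]dmulE [RHS]dmulE; apply/wordP/weq_comm => //= rs'.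
by apply: rs; rewrite -rE -sE rs'.
Qed.

(* The homomorphism to G given on generators by f, see [dgrp_homE]. *)
Definition dgrp_hom (G : groupType) (f : emb (std n) V -> nat -> G) (x : dgrp) : G :=
  (\big[*%g/1%g]_(g <- letters x) f g.1 (g.2 : 'I_j))%g.

Lemma dgrp_homE (G : groupType) (f : emb (std n) V -> nat -> G) :
  (forall phi r, f phi r * f phi r = 1)%g ->
  (forall phi psi r s, perp phi psi -> (r < j)%N -> (s < j)%N -> r <> s ->
    f phi r * f psi s = f psi s * f phi r)%g ->
  forall u, dgrp_hom f (word u) =
    (\big[*%g/1%g]_(g <- u) f g.1 (g.2 : 'I_j))%g.
Proof.
move=> f1 f2 u0; rewrite /dgrp_hom; move: (letters _) (letters_word u0) => u1.
elim=> [//|u v _ ->//|u v w _ -> _ ->//| | | ].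
- by move=> u u' v v' _ IH _ IH'; rewrite !big_cat IH IH'.
- by move=> g; rewrite !big_cons big_nil mulg1 f1.
- move=> g h p gh; rewrite !big_cons big_nil !mulg1 f2 //.
  by move=> /val_inj.
Qed.

Lemma dgrp_homM (G : groupType) (f : emb (std n) V -> nat -> G) :
  (forall phi r, f phi r * f phi r = 1)%g ->
  (forall phi psi r s, perp phi psi -> (r < j)%N -> (s < j)%N -> r <> s ->
    f phi r * f psi s = f psi s * f phi r)%g ->
  {morph dgrp_hom f : x y / (x * y)%g}.
Proof.
move=> f1 f2 x y; rewrite -[x]lettersK -[y]lettersK [(_ * _)%g]dmulE.
by rewrite !(dgrp_homE f1 f2) big_cat.
Qed.

(* The component p_r of the homomorphism p, see [dsignE]. *)
Definition dsign (x : dgrp) (r : 'I_j) : bool :=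
  odd (count (fun g : gen => (g.2 : 'I_j) == r) (letters x)).

Lemma dsignE u r :
  dsign (word u) r = odd (count (fun g : gen => (g.2 : 'I_j) == r) u).
Proof.
rewrite /dsign; move: (letters _) (letters_word u) => u1.
elim=> [//|u2 v _ ->//|u2 v w _ -> _ ->//| | | ].
- by move=> u2 u' v v' _ IH _ IH'; rewrite !count_cat !oddD IH IH'.
- by move=> g /=; rewrite addn0 addnn odd_double.
- by move=> g h _ _ /=; rewrite addnCA.
Qed.

End Dgroup.

Arguments dgrp {R}.

Section CalD.
Context {R : realType}.
Variable n : nat.

Definition dgrp_map j (V W : ips R) (f : emb V W) : dgrp n j V -> dgrp n j W :=
  dgrp_hom (fun phi r => dgen j (emb_comp f phi) r).

Lemma perp_comp (V W : ips R) (f : emb V W) (phi psi : emb (std n) V) :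
  perp phi psi -> perp (emb_comp f phi) (emb_comp f psi).
Proof. by move=> p a b; rewrite /= emb_isometric. Qed.

Lemma dgrp_mapE j (V W : ips R) (f : emb V W) u :
  dgrp_map f (word u) =
  (\big[*%g/1%g]_(g <- u) dgen j (emb_comp f g.1) (g.2 : 'I_j))%g.
Proof.
apply: dgrp_homE => [phi r|phi psi r s p _ _ rs]; first exact: dgen_invol.
by apply: dgen_comm rs; exact: perp_comp.
Qed.

Section Circ.
Variables (m k : nat) (i : 'I_m) (V : ips R).
Local Notation G := (dgrp n (m + k).-1 V).

(* The homomorphism c_i. *)
Definition dshift : dgrp n k V -> G :=
  dgrp_hom (fun phi r => dgen _ phi (i + r)%N).

Lemma dshiftE u :
  dshift (word u) =
  (\big[*%g/1%g]_(g <- u) dgen _ g.1 (i + (g.2 : 'I_k))%N)%g.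
Proof.
apply: dgrp_homE => [phi r|phi psi r s p _ _ rs]; first exact: dgen_invol.
by apply: dgen_comm => // /addnI.
Qed.

(* [dbar] is the automorphism sending z to its bar; with places numbered from 0,
   k + 2i - r - 1 is unchanged. *)
Definition bar_place (r : nat) : nat :=
  if (i <= r < k + i)%N then (k + 2 * i - 1 - r)%N else r.

Lemma bar_placeK : involutive bar_place.
Proof.
move=> r; rewrite /bar_place; case h : (i <= r < k + i)%N; last by rewrite h.
by rewrite ifT; lia.
Qed.

Definition dbar : G -> G := dgrp_hom (fun phi r => dgen _ phi (bar_place r)).

Lemma dbarE u :
  dbar (word u) =
  (\big[*%g/1%g]_(g <- u) dgen _ g.1 (bar_place (g.2 : 'I_(m + k).-1)))%g.
Proof.
apply: dgrp_homE => [phi r|phi psi r s p _ _ rs]; first exact: dgen_invol.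
by apply: dgen_comm => // /(can_inj bar_placeK).
Qed.

(* (φ, i + k - 1) ... (φ, i + 1) (φ, i) *)
Definition dblock (phi : emb (std n) V) : G :=
  (\big[*%g/1%g]_(q <- rev (iota i k)) dgen _ phi q)%g.

(* (φ, r) ⊢_i z *)
Definition dact1 (g : gen n m V) (z : G) : G :=
  let r : nat := (g.2 : 'I_m) in
  if (r < i)%N then (dgen _ g.1 r * z)%g
  else if r == i then
    (dblock g.1 * dbar z)%g
  else (dgen _ g.1 (r + k).-1 * z)%g.

(* x ⊢_i z *)
Definition dact (x : dgrp n m V) (z : G) : G := foldr dact1 z (letters x).

Lemma dbarM : {morph dbar : x y / (x * y)%g}.
Proof.
apply: dgrp_homM => [phi r|phi psi r s p _ _ rs]; first exact: dgen_invol.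
by apply: dgen_comm => // /(can_inj bar_placeK).
Qed.

Lemma dbar1 : dbar 1%g = 1%g.
Proof. by rewrite -[1%g]/(word [::]) dbarE big_nil. Qed.

Lemma dbar_gen phi r : dbar (dgen _ phi r) = dgen _ phi (bar_place r).
Proof.
rewrite /dgen; case: insubP => [r' _ <-|rj].
  by rewrite dbarE big_seq1 /dgen.
rewrite dbar1 insubF//; apply/negbTE; move: rj; rewrite /bar_place.
by have := ltn_ord i; case: ifP; lia.
Qed.

Lemma dbarK : involutive dbar.
Proof.
move=> x; rewrite -[x]lettersK; elim: (letters x) => [|g u IH].
  by rewrite (_ : word [::] = 1%g) // !dbar1.
have -> : word (g :: u) = (dgen _ g.1 (g.2 : 'I__) * word u)%g.
  by rewrite dgen_ord [RHS]dmulE; case: g.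
by rewrite !dbarM !dbar_gen bar_placeK IH.
Qed.

Lemma dblock_bar phi : (dblock phi * dbar (dblock phi) = 1)%g.
Proof.
suff -> : dbar (dblock phi) = (dblock phi)^-1%g by rewrite mulgV.
rewrite /dblock (big_morph _ dbarM dbar1) -prodgV.
have barE : [seq bar_place q | q <- rev (iota i k)] = iota i k.
  apply: (@eq_from_nth _ 0%N); rewrite size_map size_rev// size_iota => q qk.
  rewrite (nth_map 0%N) ?size_rev ?size_iota// nth_rev ?size_iota//.
  rewrite !nth_iota//; last by lia.
  by rewrite /bar_place ifT; lia.
rewrite -[in RHS]barE big_map; apply: eq_bigr => q _.
rewrite dbar_gen; apply: (@mulgI _ (dgen (m + k).-1 phi (bar_place q))).
by rewrite dgen_invol mulgV.
Qed.

Lemma dact1_invol g : involutive (dact1 g).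
Proof.
move=> z; rewrite /dact1 /=; case: ltngtP => _;
  rewrite ?mulgA ?dgen_invol ?mul1g//.
by rewrite dbarM dbarK mulgA dblock_bar mul1g.
Qed.

Lemma dblock_comm phi psi r : perp phi psi -> ~~ (i <= r < i + k)%N ->
  (dblock phi * dgen _ psi r = dgen _ psi r * dblock phi)%g.
Proof.
move=> p ri; symmetry; rewrite /dblock big_seq_cond.
apply: commute_prod => q; rewrite andbT mem_rev mem_iota => qi.
apply/esym/dgen_comm => // qr; move: ri; rewrite -qr qi //.
Qed.

Lemma dact1_comm g h z : perp g.1 h.1 -> g.2 <> h.2 ->
  dact1 g (dact1 h z) = dact1 h (dact1 g z).
Proof.
move=> p gh; have {gh} : ((g.2 : 'I_m) : nat) <> (h.2 : 'I_m).
  by move=> e; apply: gh; exact: val_inj.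
have p' : perp h.1 g.1.
  move=> a b; rewrite /dotp hermitian_subproof expr0 mul1r; exact: p.
rewrite /dact1.
move: (nat_of_ord _) (nat_of_ord (h.2 : 'I_m)) => r s rs.
have gen_comm r' s' : r' <> s' ->
    (dgen _ g.1 r' * (dgen _ h.1 s' * z) =
     dgen (m + k).-1 h.1 s' * (dgen _ g.1 r' * z))%g.
  by move=> rs'; rewrite !mulgA dgen_comm.
have block_comm phi psi q : perp phi psi -> bar_place q = q ->
    ~~ (i <= q < i + k)%N ->
    (dblock phi * dbar (dgen _ psi q * z) =
     dgen _ psi q * (dblock phi * dbar z))%g.
  by move=> pp qE qi; rewrite dbarM dbar_gen qE !mulgA dblock_comm.
have bar_out q : ~~ (i <= q < i + k)%N -> bar_place q = q.
  by rewrite /bar_place addnC => /negbTE ->.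
have [ri|ri|ri] := ltngtP r i; have [si|si|si] := ltngtP s i;
  try (by apply: gen_comm; lia); try (by case: rs; rewrite ri si).
- by rewrite block_comm//; [apply: bar_out|]; lia.
- by rewrite block_comm//; [apply: bar_out|]; lia.
- by rewrite block_comm//; [apply: bar_out|]; lia.
- by rewrite block_comm//; [apply: bar_out|]; lia.
Qed.

Lemma dactE u z : dact (word u) z = foldr dact1 z u.
Proof.
rewrite /dact; move: (letters _) (letters_word u) => u1 uu1.
elim: uu1 z => [//|u2 v _ IH z|u2 v w _ IH _ IH' z| | | ].
- by rewrite IH.
- by rewrite IH IH'.
- by move=> u2 u' v v' _ IH _ IH' z; rewrite !foldr_cat IH IH'.
- by move=> g z /=; exact: dact1_invol.
- by move=> g h p gh z /=; exact: dact1_comm.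
Qed.

End Circ.

Definition dcirc m k (i : 'I_m) (V W : ips R)
    (x : dgrp n m V) (y : dgrp n k W) : dgrp n (m + k).-1 (V ⊕ W) :=
  dact i (dgrp_map (emb_inl V W) x) (dshift i (dgrp_map (emb_inr V W) y)).

Definition D_layers : layers R :=
  @Layers R (fun j V => dgrp n j V) dgrp_map dcirc (@dsign R n)
    (fun j V => 1%g).

Definition calD : operad_data R := susp_operad D_layers.

End CalD.

(* Main.v *)
(* D_n and H are both built by [susp_operad] from layers A(j, V), so the operad
   axioms reduce to unit laws and two composition laws for layers, [is_layers]:
   one for insertions at distinct places, one for nested insertions.  In D_n an
   element acts letter by letter: a letter at the place of insertion becomes a
   block and reverses the block that was inserted there.  Insertions of y and z
   at distinct places then differ only in the order of the letters of y and z,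
   which have distinct places and orthogonal images and therefore commute.  For
   a nested insertion, the reversal of the large block is the reversal of the
   outer block followed by that of the inner one.  The sign homomorphism p
   turns these compositions into those of (Z/2)^j and gives the map to H.

   Continuity is tested on maps from compact Hausdorff spaces: by the tube lemma
   a k-product with a fixed factor preserves quotient maps, so every structure
   map may be tested on words and on explicit points of smash products.  For the
   spheres to be compactly generated one needs closed balls to be compact, where
   the coordinates of a vector are bounded by inverting a Gram matrix. *)
From HB Require Import structures.
Require Import Defs.
From mathcomp Require Import all_boot all_order all_algebra.
From mathcomp Require Import all_fingroup sesquilinear.
From mathcomp Require Import all_classical reals topology normed_module.
From mathcomp Require Import generic_quotient zify lra ring.

Set Implicit Arguments.
Unset Strict Implicit.
Unset Printing Implicit Defensive.

Import Order.TTheory GRing.Theory Num.Theory.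
Import numFieldNormedType.Exports.

Local Open Scope classical_set_scope.
Local Open Scope quotient_scope.
Local Open Scope ring_scope.

Local Notation "x ∧ y" := (smash_pair x y) (at level 40).
Local Notation "V ⊕ W" := (dsum V W) (at level 50, left associativity).

(** * Continuity in compactly generated spaces *)

Section Probes.

(** Two obstacles shape the proof. The arities of the two sides of an associativity law, such as
    [((m + k).-1 + l).-1] and [((m + l).-1 + k).-1], are equal only by a proof. Permutations, signs
    and words are therefore compared at places in nat, where the laws become arithmetic of [out] and
    of reversals; casts stay confined to [perm_eqv], [layer_eqv] and [arity_eq]. The other obstacle
    is that a map from a compact space into a quotient need not lift to representatives. Continuity
    in two variables is therefore stated for compact Hausdorff test spaces and reduced by
    [kopen_quotient] to representatives of one variable while the other stays a parameter. The
    permutations in a composition are twisted by [tau] because a sign -1 of x reverses the inserted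
    block: place c of y then appears as place [k.-1 - c]. The two sides of the nested law match
    because the reversal of [k + l - 1] places is itself a block permutation made of two
    reversals. *)

Lemma kify_openE (X : topologicalType) (U : set X) :
  @open (kify X) U = kopen U.
Proof. by []. Qed.

Lemma kify_cg (X : topologicalType) : compactly_generated (kify X).
Proof.
move=> U kU; rewrite kify_openE => K f cK hK cf; apply: kU => //.
by apply/continuousP => A oA; exact: (oA K f cK hK cf).
Qed.

Lemma continuous_kify (K X : topologicalType) (f : K -> X) :
  compact [set: K] -> hausdorff_space K -> continuous f ->
  continuous (f : K -> kify X).
Proof. by move=> cK hK cf; apply/continuousP => A oA; exact: (oA K f cK hK cf).
Qed.

Lemma kify_continuous (X : topologicalType) : continuous (id : kify X -> X).
Proof.
apply/continuousP => A oA; suff : kopen (A : set X) by [].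
by move=> K f cK hK /continuousP; exact.
Qed.

Lemma cg_compact_hausdorff (X : topologicalType) :
  compact [set: X] -> hausdorff_space X -> compactly_generated X.
Proof. by move=> cX hX U; apply; rewrite // => x. Qed.

(** Continuity for the topology of [kify X], expressed without changing the type, so that X itself
    need not be compactly generated. *)
Definition probe_continuous (X Z : topologicalType) (f : X -> Z) : Prop :=
  forall (K : topologicalType) (g : K -> X), compact [set: K] ->
    hausdorff_space K -> continuous g -> continuous (f \o g).

(** Continuity on [kprod X Y]. The curried form allows the two variables to be treated one after the
    other. *)
Definition probe_continuous2 (X Y Z : topologicalType) (f : X -> Y -> Z) :
    Prop :=
  forall (K : topologicalType) (a : K -> X) (b : K -> Y), compact [set: K] ->
    hausdorff_space K -> continuous a -> continuous b ->
    continuous (fun t => f (a t) (b t)).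

Lemma cg_continuous (X Z : topologicalType) (f : X -> Z) :
  compactly_generated X -> probe_continuous f -> continuous f.
Proof.
move=> cX pf; apply/continuousP => A oA; apply: cX => K g cK hK cg.
by move/continuousP : (pf K g cK hK cg); exact.
Qed.

Lemma continuous_fst_comp (K X Y : topologicalType) (g : K -> X * Y) :
  continuous g -> continuous (fst \o g).
Proof. by move=> cg t; apply: continuous_comp; [exact: cg|exact: cvg_fst]. Qed.

Lemma continuous_snd_comp (K X Y : topologicalType) (g : K -> X * Y) :
  continuous g -> continuous (snd \o g).
Proof. by move=> cg t; apply: continuous_comp; [exact: cg|exact: cvg_snd]. Qed.

Lemma continuous_pair (K X Y : topologicalType) (a : K -> X) (b : K -> Y) :
  continuous a -> continuous b -> continuous (fun t => (a t, b t)).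
Proof. by move=> ca cb t; apply: cvg_pair; [exact: ca|exact: cb]. Qed.

Lemma kprod_continuous (X Y Z : topologicalType) (f : X -> Y -> Z) :
  probe_continuous2 f -> continuous (fun p : kprod X Y => f p.1 p.2).
Proof.
move=> pf; apply/continuousP => A oA.
suff : kopen ((fun p : X * Y => f p.1 p.2) @^-1` A) by [].
move=> K g cK hK cg.
move/continuousP: (pf K (fst \o g) (snd \o g) cK hK (continuous_fst_comp cg)
  (continuous_snd_comp cg)); exact.
Qed.

Lemma continuous_kpair (K X Y : topologicalType) (a : K -> X) (b : K -> Y) :
  compact [set: K] -> hausdorff_space K -> continuous a -> continuous b ->
  continuous (fun t => (a t, b t) : kprod X Y).
Proof.
by move=> cK hK ca cb; apply: continuous_kify => //; exact: continuous_pair.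
Qed.

Lemma kprod_continuous_fst (K X Y : topologicalType) (g : K -> kprod X Y) :
  continuous g -> continuous (fst \o g).
Proof.
move=> cg; apply: (@continuous_fst_comp K X Y g).
move=> t; apply: (@continuous_comp _ _ _ g (id : kprod X Y -> X * Y)%type).
  exact: cg.
exact: (@kify_continuous (X * Y)%type (g t)).
Qed.

Lemma kprod_continuous_snd (K X Y : topologicalType) (g : K -> kprod X Y) :
  continuous g -> continuous (snd \o g).
Proof.
move=> cg; apply: (@continuous_snd_comp K X Y g).
move=> t; apply: (@continuous_comp _ _ _ g (id : kprod X Y -> X * Y)%type).
  exact: cg.
exact: (@kify_continuous (X * Y)%type (g t)).
Qed.

Lemma hausdorff_prod (X Y : topologicalType) :
  hausdorff_space X -> hausdorff_space Y -> hausdorff_space (X * Y)%type.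
Proof.
have nX p (A : set X) : nbhs p.1 A -> nbhs (p : X * Y) (A `*` setT).
  by move=> nA; exists (A, setT) => //; split => //; exact: filterT.
have nY p (A : set Y) : nbhs p.2 A -> nbhs (p : X * Y) (setT `*` A).
  by move=> nA; exists (setT, A) => //; split => //; exact: filterT.
move=> hX hY [p1 p2] [q1 q2] pq; congr pair.
  apply: hX => A B nA nB.
  by have [[x y] [[Ax _] [Bx _]]] :=
    pq _ _ (nX (p1, p2) A nA) (nX (q1, q2) B nB); exists x.
apply: hY => A B nA nB.
by have [[x y] [[_ Ay] [_ By]]] := pq _ _ (nY (p1, p2) A nA) (nY (q1, q2) B nB);
  exists y.
Qed.

(** The tube lemma: compactness, in the form of near-coverings, merges the neighbourhoods found at
    each point of C into one neighbourhood of l0. *)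
Lemma open_tube (L K : topologicalType) (N : set (L * K)) (C : set K) :
  open N -> compact C -> open [set l | forall c, C c -> N (l, c)].
Proof.
move=> oN cC; rewrite openE => l0 Nl0; rewrite /interior/=.
move/compact_near_coveringP: cC => nC.
apply: (nC L (nbhs l0) (fun l c => N (l, c)) _) => c Cc;
  have : nbhs (l0, c) N by apply: open_nbhs_nbhs; split=> //; exact: Nl0.
case=> -[A B] [/= nA nB] ABN; exists (B, A) => //= -[c' l'] [/= Bc' Al'].
exact: ABN.
Qed.

(* The set of y such that {y} × D is contained in U is open for every compact D
   in K, because its preimages in the X_i are, by the tube lemma. *)
Lemma kopen_quotient (I : Type) (X : I -> topologicalType)
    (Y Z : topologicalType) (q : forall i, X i -> Y) :
  (forall i, compactly_generated (X i)) ->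
  (forall y, exists i x, q i x = y) ->
  (forall U : set Y, (forall i, open (q i @^-1` U)) -> open U) ->
  forall U : set (Y * Z),
    (forall i, kopen [set p : X i * Z | U (q i p.1, p.2)]) -> kopen U.
Proof.
move=> cX qsurj qfin U kU K f cK hK cf; rewrite openE => t0 Ut0.
have [i [x0 qx0]] := qsurj (f t0).1.
have cb := continuous_snd_comp cf.
pose N := [set t | U (q i x0, (f t).2)].
have oN : open N.
  apply: (kU i K (fun t => (x0, (f t).2))) => //.
  by apply: continuous_pair => // t; exact: cvg_cst.
have Nt0 : nbhs t0 N.
  apply: open_nbhs_nbhs; split => //; move: Ut0.
  by rewrite /N /= qx0 /= -surjective_pairing.
(* A compact Hausdorff space is regular, so t0 has a closed, hence compact, neighbourhood inside
   N. *)
have [C nC CN] : exists2 C, nbhs t0 C & closure C `<=` N.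
  by have [] := @compact_regular K t0 setT hK cK filterT N Nt0 => C; exists C.
pose D := closure C.
have cD : compact D by apply: subclosed_compact cK _ => //;
  exact: closed_closure.
pose B := [set y | forall c, D c -> U (y, (f c).2)].
have oB : open B.
  apply: qfin => j; apply: cX => L g cL hL cg.
  rewrite [X in open X](_ : _ =
    [set l | forall c, D c -> [set p : L * K | U (q j (g p.1), (f p.2).2)]
      (l, c)])//.
  apply: open_tube => //.
  apply: (kU j (L * K)%type (fun p => (g p.1, (f p.2).2))).
  - by rewrite -setXTT; exact: compact_setX.
  - exact: hausdorff_prod.
  - apply: continuous_pair => p.
      by apply: (@continuous_comp _ _ _ fst g); [exact: cvg_fst|exact: cg].
    apply: (@continuous_comp _ _ _ snd (snd \o f)); first exact: cvg_snd.
    exact: cb.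
have Bt0 : nbhs (f t0).1 B.
  apply: open_nbhs_nbhs; split => // c Dc; rewrite -qx0; exact: CN.
have ca := continuous_fst_comp cf.
have nB : \forall t \near t0, B (f t).1 by exact: (ca t0 _ Bt0).
(* The diagonal: for t in C with [(f t).1] in B, the condition defining B, taken at c = t, says that
   [f t] lies in U. *)
rewrite /interior /=; near=> t; have Bt : B (f t).1 by near: t.
have Ct : C t by near: t.
by rewrite /= [f t]surjective_pairing; apply: Bt; exact: subset_closure.
Unshelve. all: by end_near. Qed.

(** The probe into Y is not lifted to any [X i]; [kopen_quotient] takes the place of a lift. A
    family of maps is allowed because a group element is covered by words of all lengths. *)
Lemma probe_continuous2_quotient (I : Type) (X : I -> topologicalType)
    (Y Z T : topologicalType) (q : forall i, X i -> Y) (f : Y -> Z -> T) :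
  (forall i, compactly_generated (X i)) ->
  (forall y, exists i x, q i x = y) ->
  (forall U : set Y, (forall i, open (q i @^-1` U)) -> open U) ->
  (forall i, probe_continuous2 (fun x z => f (q i x) z)) ->
  probe_continuous2 f.
Proof.
move=> cX qsurj qfin pf K a b cK hK ca cb; apply/continuousP => A oA.
apply: (@kopen_quotient I X Y Z q cX qsurj qfin [set p | A (f p.1 p.2)] _
  K (fun t => (a t, b t))) => //; last exact: continuous_pair.
move=> i L g cL hL cg.
have := pf i L _ _ cL hL (continuous_fst_comp cg) (continuous_snd_comp cg).
by move/continuousP; exact.
Qed.

Lemma probe_continuous2C (X Y Z : topologicalType) (f : X -> Y -> Z) :
  probe_continuous2 f -> probe_continuous2 (fun y x => f x y).
Proof. by move=> pf K a b cK hK ca cb; exact: pf. Qed.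

Lemma near_discrete (K : topologicalType)
    (D : discreteTopologicalType) (r : K -> D) t0 :
  continuous r -> \forall t \near t0, r t = r t0.
Proof.
move=> cr; apply: (cr t0 [set d | d = r t0]); rewrite nbhs_principalE.
exact/principal_filterP.
Qed.

Lemma continuous_discrete (K : topologicalType) (D : discreteTopologicalType)
    (Z : topologicalType) (f : D -> K -> Z) (r : K -> D) :
  continuous r -> (forall d, continuous (f d)) ->
  continuous (fun t => f (r t) t).
Proof.
move=> cr cf t0.
apply: cvg_trans (cf (r t0) t0); apply: near_eq_cvg.
by apply: filterS (near_discrete t0 cr) => t ->.
Qed.

Lemma continuous_into_discrete (K : topologicalType)
    (D : discreteTopologicalType) (r : K -> D) :
  (forall t0, \forall t \near t0, r t = r t0) -> continuous r.
Proof.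
move=> nr t0 A; rewrite nbhs_principalE => /principal_filterP At0.
by apply: filterS (nr t0) => t /= ->.
Qed.

(** The added point is open and closed, so the two cases can be separated locally. The hypothesis
    speaks of maps x on all of K, because in its application K must remain a compact test space. *)
Lemma continuous_plus (K X Z : topologicalType) (a : K -> plus X) (z : Z)
    (f : X -> K -> Z) :
  continuous a ->
  (forall x : K -> X, continuous x -> continuous (fun t => f (x t) t)) ->
  continuous (fun t => if a t is Some x then f x t else z).
Proof.
move=> ca cf t0; case E : (a t0) => [x0|].
  have near_some : \forall t \near t0, a t <> None.
    apply: (ca t0 [set d | d <> None]); rewrite nbhsE.
    exists [set d | d <> None] => //; split; last by rewrite /= E.
    rewrite /open /= /plus_open; rewrite [X in open X](_ : _ = setT) //.
      exact: openT.
    by apply/seteqP; split.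
  (* The constant value x0 extends x over the clopen set where a is None. *)
  pose x t := if a t is Some x then x else x0.
  have cx : continuous x.
    apply/continuousP => A oA.
    pose A' : set (plus X) := fun d => if d is Some y then A y else A x0.
    have -> : x @^-1` A = a @^-1` A'.
      by apply/seteqP; split => t; rewrite /= /x /A'; case: (a t).
    by move/continuousP: ca; apply.
  have := cf x cx t0; rewrite /continuous_at [x t0]/x E => cvgf.
  apply: cvg_trans cvgf; apply: near_eq_cvg.
  by apply: filterS near_some => t; rewrite /x; case: (a t).
have near_none : \forall t \near t0, a t = None.
  apply: (ca t0 [set d | d = None]); rewrite nbhsE.
  exists [set d | d = None] => //; split => //.
  rewrite /open /= /plus_open; rewrite [X in open X](_ : _ = set0) //.
    exact: open0.
  by apply/seteqP; split.
by apply: cvg_near_cst; rewrite E; apply: filterS near_none => t ->.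
Qed.

Lemma continuous_some (K X : topologicalType) (x : K -> X) :
  continuous x -> continuous (fun t => Some (x t) : plus X).
Proof.
by move=> /continuousP cx; apply/continuousP => A oA;
  exact: (cx (Some @^-1` A)).
Qed.

End Probes.

(** * Smash products as quotients of k-products *)

Section SmashContinuity.
Variables X Y : ptopologicalType.

Lemma smash_pair_point (x : X) : x ∧ (point : Y) = point.
Proof.
by apply/eqmodP; rewrite /= /smash_rel /in_wedge /= !eqxx !orbT.
Qed.

Lemma smash_point_pair (y : Y) : (point : X) ∧ y = point.
Proof.
by apply/eqmodP; rewrite /= /smash_rel /in_wedge /= !eqxx !orbT.
Qed.

Lemma smash_quotient (U : set (smash X Y)) :
  open [set p : kprod X Y | U (p.1 ∧ p.2)] -> open U.
Proof.
rewrite [X in open X -> _](_ : _ = \pi_(smash X Y) @^-1` U) //.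
by apply/seteqP; split => -[].
Qed.

Lemma smash_cg : compactly_generated (smash X Y).
Proof.
move=> U kU; apply: smash_quotient; apply: kify_cg => K g cK hK cg.
apply: (kU K (fun t => (g t).1 ∧ (g t).2)) => // t.
rewrite (_ : (fun t => _) = \pi_(smash X Y) \o g); last first.
  by apply/funext => s /=; rewrite /smash_pair -surjective_pairing.
by apply: continuous_comp; [exact: cg|exact: pi_continuous].
Qed.

Lemma continuous_smash_pair (K : topologicalType) (a : K -> X) (b : K -> Y) :
  compact [set: K] -> hausdorff_space K -> continuous a -> continuous b ->
  continuous (fun t => a t ∧ b t).
Proof.
move=> cK hK ca cb t.
apply: (@continuous_comp _ _ _ (fun t => (a t, b t) : kprod X Y)
  (\pi_(smash X Y))); first exact: continuous_kpair.
exact: pi_continuous.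
Qed.

Lemma probe_continuous2_smash (Z T : topologicalType)
    (f : smash X Y -> Z -> T) :
  (forall (K : topologicalType) (a : K -> X) (b : K -> Y) (c : K -> Z),
     compact [set: K] -> hausdorff_space K -> continuous a -> continuous b ->
     continuous c -> continuous (fun t => f (a t ∧ b t) (c t))) ->
  probe_continuous2 f.
Proof.
move=> pf.
apply: (@probe_continuous2_quotient unit (fun=> kprod X Y) _ _ _
    (fun _ p => p.1 ∧ p.2)).
- by move=> _; exact: kify_cg.
- move=> y; have [x1 [x2 ->]] := smash_surj y.
  by exists tt, ((x1, x2) : kprod X Y).
- by move=> U /(_ tt); exact: smash_quotient.
- move=> _ K g c cK hK cg cc; apply: pf => //.
    exact: kprod_continuous_fst.
  exact: kprod_continuous_snd.
Qed.

Lemma smash_continuous (T : topologicalType) (f : smash X Y -> T) :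
  probe_continuous2 (fun x y => f (x ∧ y)) -> continuous f.
Proof.
move=> /kprod_continuous /continuousP cf; apply/continuousP => A oA.
exact/smash_quotient/cf.
Qed.

End SmashContinuity.

(** * Inner product spaces *)

Section Norm.
Context {R : realType}.
Implicit Types U V W : ips R.

Lemma dotpC V (x y : V) : dotp x y = dotp y x.
Proof. by rewrite /dotp hermitian_subproof expr0 mul1r. Qed.

Lemma dotpDl V (x y z : V) : dotp (x + y) z = dotp x z + dotp y z.
Proof. by rewrite /dotp linearDl. Qed.

Lemma dotpZl V a (x z : V) : dotp (a *: x) z = a * dotp x z.
Proof. by rewrite /dotp linearZl. Qed.

Lemma dotp0l V (z : V) : dotp 0 z = 0.
Proof. by rewrite /dotp linear0l. Qed.

Lemma dotp_ge0 V (x : V) : 0 <= dotp x x.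
Proof.
have [->|x0] := eqVneq x 0; first by rewrite dotp0l.
by apply/ltW; exact: neq0_dnorm_gt0.
Qed.

Lemma dotp_eq0 V (x : V) : dotp x x = 0 -> x = 0.
Proof.
move=> x0; apply/eqP; apply: contraT => nx0.
by have : 0 < dotp x x; [exact: neq0_dnorm_gt0|rewrite x0 ltxx].
Qed.

Lemma dotp_suml V (I : Type) (r : seq I) (F : I -> V) (z : V) :
  dotp (\sum_(i <- r) F i) z = \sum_(i <- r) dotp (F i) z.
Proof.
elim: r => [|i r IH]; first by rewrite !big_nil dotp0l.
by rewrite !big_cons dotpDl IH.
Qed.

Lemma dotp_cauchy_schwarz V (x y : V) :
  dotp x y ^+ 2 <= dotp x x * dotp y y.
Proof.
have [->|y0] := eqVneq y 0; first by rewrite dotpC dotp0l expr0n /=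
  dotp0l mulr0.
have yy : 0 < dotp y y by exact: neq0_dnorm_gt0.
(* This vector is [dotp y y] times the component of x orthogonal to y. *)
have := dotp_ge0 (dotp y y *: x + (- dotp x y) *: y).
rewrite !(dotpDl, dotpZl) ![dotp _ (_ + _)]dotpC !(dotpDl, dotpZl)
  [dotp y x]dotpC.
set a := dotp x x; set b := dotp y y in yy *; set c := dotp x y => H.
have {H} : 0 <= b * (a * b - c ^+ 2) by apply: le_trans H _; rewrite le_eqVlt;
  apply/orP; left; apply/eqP; ring.
by rewrite pmulr_rge0// subr_ge0.
Qed.

Lemma ips_norm_ge0 V (x : V) : 0 <= ips_norm x.
Proof. exact: sqrtr_ge0. Qed.

Lemma ips_norm_sqr V (x : V) : ips_norm x ^+ 2 = dotp x x.
Proof. by rewrite sqr_sqrtr// dotp_ge0. Qed.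

Lemma ips_norm0 V : ips_norm (0 : V) = 0.
Proof. by rewrite /ips_norm dotp0l sqrtr0. Qed.

Lemma ips_norm_eq0 V (x : V) : ips_norm x = 0 -> x = 0.
Proof. by move=> x0; apply: dotp_eq0; rewrite -ips_norm_sqr x0 expr0n. Qed.

Lemma ips_normZ V a (x : V) : ips_norm (a *: x) = `|a| * ips_norm x.
Proof.
rewrite /ips_norm dotpZl dotpC dotpZl mulrA -expr2 sqrtrM ?sqr_ge0//.
by rewrite sqrtr_sqr.
Qed.

Lemma ips_normN V (x : V) : ips_norm (- x) = ips_norm x.
Proof. by rewrite -scaleN1r ips_normZ normrN1 mul1r. Qed.

Lemma ips_distC V (x y : V) : ips_norm (x - y) = ips_norm (y - x).
Proof. by rewrite -ips_normN opprB. Qed.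

Lemma dotp_le_norm V (x y : V) : `|dotp x y| <= ips_norm x * ips_norm y.
Proof.
rewrite -(@ler_pXn2r _ 2)// ?nnegrE ?normr_ge0 ?mulr_ge0 ?ips_norm_ge0//.
by rewrite exprMn !ips_norm_sqr real_normK ?num_real// dotp_cauchy_schwarz.
Qed.

Lemma ips_normD V (x y : V) : ips_norm (x + y) <= ips_norm x + ips_norm y.
Proof.
rewrite -(@ler_pXn2r _ 2)// ?nnegrE ?addr_ge0 ?ips_norm_ge0//.
rewrite ips_norm_sqr sqrrD !ips_norm_sqr dotpDl ![dotp _ (x + y)]dotpC !dotpDl.
rewrite [dotp y x]dotpC -addrA addrA [dotp x x + _ + _]addrC.
have := le_trans (ler_norm _) (dotp_le_norm x y); lra.
Qed.

Lemma ips_dist_triangle V (y x z : V) :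
  ips_norm (x - z) <= ips_norm (x - y) + ips_norm (y - z).
Proof. by have := ips_normD (x - y) (y - z); rewrite addrA subrK. Qed.

Lemma emb_norm V W (f : emb V W) x : ips_norm (f x) = ips_norm x.
Proof. by rewrite /ips_norm emb_isometric. Qed.

Lemma embB V W (f : emb V W) x y : f (x - y) = f x - f y.
Proof. by rewrite addrC -scaleN1r emb_linear scaleN1r addrC. Qed.

Lemma embP V W (f g : emb V W) : f =1 g -> f = g.
Proof.
case: f g => [f fl fi] [g gl gi] /= /funext fg; subst g.
by congr Emb; exact: Prop_irrelevance.
Qed.

End Norm.

(** * Topology of inner product spaces and compactness of balls *)

Section IpsTopologyFacts.
Context {R : realType}.
Implicit Types U V W : ips R.

Lemma open_ball V (x : V) (d : R) :
  @open (ips_space V) [set y : V | ips_norm (y - x) < d].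
Proof.
move=> y /= yd; exists (d - ips_norm (y - x)); first by rewrite subr_gt0.
move=> z zy; apply: le_lt_trans (ips_dist_triangle y z x) _.
by rewrite -ltrBrDr.
Qed.

Lemma ips_nbhs_ball V (x : V) (d : R) : 0 < d ->
  nbhs (x : ips_space V) [set y : V | ips_norm (y - x) < d].
Proof.
move=> d0; apply: (@open_nbhs_nbhs (ips_space V)); split;
  first exact: open_ball.
by rewrite /= subrr ips_norm0.
Qed.

Lemma ips_nbhs_ballP V (x : V) (A : set (ips_space V)) :
  nbhs (x : ips_space V) A -> exists2 d : R, 0 < d &
    forall y : V, ips_norm (y - x) < d -> A y.
Proof.
rewrite nbhsE => -[B [oB Bx] BA]; have [d d0 Bd] := oB x Bx.
by exists d => // y /Bd /BA.
Qed.

Lemma continuous_ips (K : topologicalType) V (h : K -> ips_space V) :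
  (forall t0 (d : R), 0 < d ->
     \forall t \near t0, ips_norm ((h t : V) - h t0) < d) ->
  continuous h.
Proof.
move=> ch t0 A /ips_nbhs_ballP[d d0 dA].
rewrite /nbhs /=; near=> t; apply: dA; near: t; exact: ch.
Unshelve. all: by end_near. Qed.

Lemma continuous_emb (K : topologicalType) V W (h : K -> emb V W) :
  (forall t0 (d : R), 0 < d ->
     \forall t \near t0, forall x,
       ips_norm (h t x - h t0 x) <= d * ips_norm x) ->
  continuous h.
Proof.
move=> ch t0 A; rewrite nbhsE => -[B [oB Bh] BA]; have [d d0 Bd] := oB _ Bh.
rewrite /nbhs /=; near=> t; apply/BA/Bd; near: t; exact: ch.
Unshelve. all: by end_near. Qed.

Lemma near_emb (K : topologicalType) V W (h : K -> emb V W) t0 (d : R) :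
  0 < d -> continuous h ->
  \forall t \near t0, forall x, ips_norm (h t x - h t0 x) <= d * ips_norm x.
Proof.
(* The bound d alone would not give an open set, since the topology is defined by non-strict
   inequalities; the slack d - c makes B open. *)
move=> d0 ch; pose B := [set g : emb V W | exists2 c, c < d &
  forall x, ips_norm (g x - h t0 x) <= c * ips_norm x].
have nB : nbhs (h t0) B.
  apply: open_nbhs_nbhs; split; last first.
    by exists 0 => // x; rewrite subrr ips_norm0 mul0r.
  move=> g [c cd gc]; exists ((d - c) / 2) => [|g' gg']; first by lra.
  exists (c + (d - c) / 2) => [|x]; first by lra.
  apply: le_trans (ips_dist_triangle (g x) _ _) _.
  by rewrite mulrDl addrC; apply: lerD.
have nhB : \forall t \near t0, B (h t) by exact: (ch t0 _ nB).
apply: filterS nhB => t [c cd hc] x; by apply: le_trans (hc x) _;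
  rewrite ler_wpM2r ?ips_norm_ge0// ltW.
Qed.

Lemma continuous_emb_comp (K : topologicalType) U V W (g : K -> emb V W)
    (f : K -> emb U V) :
  continuous g -> continuous f -> continuous (fun t => emb_comp (g t) (f t)).
Proof.
move=> cg cf; apply: continuous_emb => t0 d d0.
have d20 : 0 < d / 2 by lra.
apply: filterS2 (near_emb t0 d20 cg) (near_emb t0 d20 cf) => t gt ft x /=.
apply: le_trans (ips_dist_triangle (g t0 (f t x)) _ _) _.
rewrite -embB emb_norm [d]splitr mulrDl; apply: lerD => //.
by rewrite -[ips_norm x](emb_norm (f t)).
Qed.

Lemma continuous_liso_emb V W : continuous (@liso_emb _ V W).
Proof. exact: initial_continuous. Qed.

Lemma ips_pair_dist V W (x x0 : V) (y y0 : W) (d : R) :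
  ips_norm (x - x0) < d / 2 -> ips_norm (y - y0) < d / 2 ->
  ips_norm (((x, y) : V ⊕ W) - (x0, y0)) < d.
Proof.
move=> xd yd.
have -> : ((x, y) : V ⊕ W) - (x0, y0) =
  emb_inl V W (x - x0) + emb_inr V W (y - y0).
  by congr pair; rewrite /= ?addr0 ?add0r.
apply: le_lt_trans (ips_normD _ _) _; rewrite !emb_norm.
by rewrite [d]splitr ltrD.
Qed.

Lemma compact_bounded V (C : set (ips_space V)) :
  compact C -> exists M : R, forall x : V, C x -> ips_norm x <= M.
Proof.
move/compact_near_coveringP => nC.
have : \forall n \near \oo, forall x : V, C x -> ips_norm x <= n%:R :> R.
  apply: (nC nat \oo (fun n (x : V) => ips_norm x <= n%:R :> R) _) => x Cx.
  exists ([set y : V | ips_norm (y - x) < 1],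
    [set n | ips_norm (x : V) + 1 <= n%:R]).
    by split; [exact: ips_nbhs_ball|exact: nbhs_infty_ger].
  move=> [y n] [/= yx xn]; apply: le_trans xn.
  have := ips_dist_triangle (x : V) y 0; rewrite !subr0 => /le_trans; apply.
  by rewrite addrC lerD2l ltW.
by case=> N _ /(_ N (leqnn N)); exists N%:R.
Qed.

Lemma closed_cball V (M : R) : @closed (ips_space V)
  [set x : V | ips_norm x <= M].
Proof.
rewrite -openC; suff : ips_open (~` [set x : V | ips_norm x <= M]) by [].
move=> x /= /negP; rewrite -ltNge => Mx.
exists (ips_norm x - M); first by rewrite subr_gt0.
move=> y yx; apply/negP; rewrite -ltNge.
by have := ips_dist_triangle y x 0; rewrite !subr0 ips_distC; lra.
Qed.

(** The Gram matrix G takes the coordinates of x to its inner products with the basis vectors. Its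
    inverse recovers the coordinates from numbers that Cauchy-Schwarz bounds. *)
Lemma coord_bounded V : exists2 B : R, 0 <= B &
  forall (x : V) i, `|coord (vbasis fullv) i x| <= B * ips_norm x.
Proof.
set n := \dim (fullv : {vspace V}).
pose b : n.-tuple V := vbasis (fullv : {vspace V}).
pose G := (\matrix_(i, j) dotp b`_i b`_j : 'M[R]_n).
have dotE (x : V) (j : 'I_n) : dotp x b`_j = \sum_i coord b i x * G i j.
  rewrite {1}(coord_vbasis (memvf x)) dotp_suml; apply: eq_bigr => i _.
  by rewrite dotpZl mxE.
have freeb : free b by exact: basis_free (vbasisP _).
(* A vector killed by G gives an x orthogonal to the whole basis, hence to itself. *)
have Gu : G \in unitmx.
  rewrite -row_free_unit; apply: inj_row_free => v vG.
  pose x := \sum_i v 0 i *: b`_i.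
  have cx i : coord b i x = v 0 i by exact: coord_sum_free.
  have xb (j : 'I_n) : dotp x b`_j = 0.
    rewrite dotE; under eq_bigr do rewrite cx.
    by move/rowP: vG => /(_ j); rewrite !mxE.
  have x0 : x = 0.
    apply: dotp_eq0; rewrite {1}/x dotp_suml big1// => i _.
    by rewrite dotpZl dotpC xb mulr0.
  by apply/rowP => i; rewrite -cx x0 linear0 mxE.
pose F i (j : 'I_n) := ips_norm b`_j * `|invmx G j i|.
exists (\sum_i \sum_j F i j) => [|x i].
  by do 2![apply: sumr_ge0 => ? _]; rewrite mulr_ge0 ?ips_norm_ge0.
have -> : coord b i x = \sum_(j < n) dotp x b`_j * invmx G j i.
  have /rowP/(_ i) : (\row_i coord b i x) *m G *m invmx G = \row_i coord b i x.
    by rewrite mulmxK.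
  rewrite [X in _ = X -> _]mxE => <-; rewrite mxE; apply: eq_bigr => j _.
  by rewrite mxE dotE; congr (_ * _); apply: eq_bigr => k _; rewrite mxE.
apply: le_trans (ler_norm_sum _ _ _) _.
apply: (@le_trans _ _ ((\sum_j F i j) * ips_norm x)).
  rewrite mulr_suml; apply: ler_sum => j _.
  by rewrite normrM mulrAC ler_wpM2r// mulrC dotp_le_norm.
rewrite ler_wpM2r ?ips_norm_ge0// [leRHS](bigD1 i)//= lerDl.
by do 2![apply: sumr_ge0 => ? _]; rewrite mulr_ge0 ?ips_norm_ge0.
Qed.

(** By [coord_bounded] the ball lies in the image of a cube of coordinates under the continuous map
    L. The cube is compact by Tychonoff, and the ball is closed. *)
Lemma compact_cball V (M : R) :
  @compact (ips_space V) [set x : V | ips_norm x <= M].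
Proof.
have [B B0 HB] := coord_bounded V.
pose n : nat := \dim (fullv : {vspace V}).
pose b : n.-tuple V := vbasis (fullv : {vspace V}).
pose T : topologicalType := prod_topology (fun _ : 'I_n => R : topologicalType).
pose L (c : T) : ips_space V := \sum_(i < n) c i *: b`_i.
have cL : continuous L.
  apply: continuous_ips => c0 d d0.
  pose N : R := \sum_(i < n) ips_norm b`_i.
  have N0 : 0 <= N by apply: sumr_ge0 => i _; exact: ips_norm_ge0.
  (* The summand 1 avoids a division by zero when V is the zero space. *)
  have e0 : 0 < d / (N + 1) by rewrite divr_gt0// ltr_wpDl.
  have : \forall c \near c0, forall i : 'I_n, `|c i - c0 i| < d / (N + 1).
    apply: (@filter_forall T _ (fun i c => `|c i - c0 i| < d / (N + 1))
      (nbhs c0) _) => i.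
    have nb := nbhsx_ballx (c0 i : R) _ e0.
    have pc : \forall c \near c0, ball (c0 i : R) (d / (N + 1)) (c i).
      exact: (@proj_continuous 'I_n (fun=> R : topologicalType) i c0 _ nb).
    near=> c; rewrite distrC; have : ball (c0 i : R) (d / (N + 1)) (c i) by
      near: c.
    by [].
  move=> nc; near=> c; have cc : forall i : 'I_n,
    `|c i - c0 i| < d / (N + 1) by near: c.
  have -> : (L c : V) - L c0 = \sum_i (c i - c0 i) *: b`_i.
    by rewrite /L -sumrB; apply: eq_bigr => i _; rewrite scalerBl.
  apply: (@le_lt_trans _ _ (\sum_i `|c i - c0 i| * ips_norm b`_i)).
    elim/big_ind2: _ => [|x x' y y' xx yy|i _]; first by rewrite ips_norm0.
      by apply: le_trans (ips_normD _ _) _; exact: lerD.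
    by rewrite ips_normZ.
  apply: (@le_lt_trans _ _ (d / (N + 1) * N)).
    by rewrite mulr_sumr; apply: ler_sum => i _;
      rewrite ler_wpM2r ?ips_norm_ge0// ltW.
  by rewrite mulrAC ltr_pdivrMr ?ltr_wpDl// ltr_pM2l// ltrDl.
(* The radius M may be negative, hence the absolute value. *)
pose Q := [set c : T | forall i,
  (`[- (B * `|M|), B * `|M|]%classic : set R) (c i)].
have cQ : compact Q.
  apply: (@tychonoff 'I_n (fun=> R : topologicalType)
    (fun=> `[- (B * `|M|), B * `|M|]%classic : set R)) => i.
  exact: segment_compact.
have cLQ : compact (L @` Q).
  by apply: continuous_compact cQ; exact: continuous_subspaceT.
apply: subclosed_compact cLQ _; first exact: closed_cball.
move=> x /= xM; exists (fun i => coord b i (x : V)); last first.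
  by rewrite /L [RHS](coord_vbasis (memvf (x : V))).
move=> i /=; rewrite in_itv /= -ler_norml; apply: le_trans (HB _ _) _.
by rewrite ler_wpM2l// (le_trans xM)// ler_norm.
Unshelve. all: by end_near. Qed.

End IpsTopologyFacts.

(** * One-point compactifications *)

Section Spheres.
Context {R : realType}.
Implicit Types U V W : ips R.

Definition sph_far V (M : R) : set (sph V) :=
  fun v => if v is Some x then M < ips_norm (x : V) : Prop else True.

Definition sph_ball V (x : V) (d : R) : set (sph V) :=
  fun v => if v is Some y then ips_norm ((y : V) - x) < d : Prop else False.

(** Neighbourhoods of infinity are complements of closed compact sets, so this rests on the
    compactness of closed balls. *)
Lemma nbhs_sph_infty V (M : R) :
  nbhs (None : sph V) (@sph_far V M).
Proof.
exists [set x : ips_space V | ips_norm (x : V) <= M].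
  by split; [exact: compact_cball|exact: closed_cball].
by move=> v [[x /= Mx <-]|->] //; rewrite /sph_far real_ltNge ?num_real//;
  exact/negP.
Qed.

Lemma nbhs_sph_inftyP V (A : set (sph V)) :
  nbhs (None : sph V) A -> exists M : R,
    A None /\ forall x : V, M < ips_norm x -> A (Some x).
Proof.
move=> [C [cC _] CA]; have [M CM] := compact_bounded cC.
exists M; split => [|x Mx]; apply: CA; [by right|left].
by exists x => //= /CM; rewrite leNgt Mx.
Qed.

Lemma nbhs_sph_some V (x : V) (d : R) : 0 < d ->
  nbhs (Some x : sph V) (sph_ball x d).
Proof.
move=> d0; suff : nbhs (x : ips_space V)
  [set y : V | ips_norm (y - x) < d] by [].
exact: ips_nbhs_ball.
Qed.

Lemma nbhs_sph_someP V (x : V) (A : set (sph V)) : nbhs (Some x : sph V) A ->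
  exists2 d : R, 0 < d & forall y : V, ips_norm (y - x) < d -> A (Some y).
Proof. by move=> /ips_nbhs_ballP. Qed.

Lemma sph_hausdorff V : hausdorff_space (sph V).
Proof.
have far (x : V) : cluster (nbhs (None : sph V)) (Some x : sph V) -> False.
  move=> /(_ _ _ (nbhs_sph_infty V (ips_norm x + 1)) (nbhs_sph_some x ltr01)).
  case=> -[y|] [] //= xy yx; have := ips_dist_triangle x (y : V) 0;
    rewrite !subr0.
  by lra.
move=> [x|] [y|] //.
- move=> xy; have [->//|nxy] := eqVneq x y; exfalso.
  have d0 : 0 < ips_norm ((x : V) - y) / 2.
    rewrite divr_gt0// lt_neqAle ips_norm_ge0 andbT eq_sym.
    apply: contraNN nxy => /eqP/ips_norm_eq0/eqP; rewrite subr_eq0.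
    by move=> /eqP ->.
  have := xy _ _ (nbhs_sph_some x d0) (nbhs_sph_some y d0).
  case=> -[z|] [] //= zx zy; have := ips_dist_triangle (z : V) x y.
  by rewrite [ips_norm ((x : V) - z)]ips_distC; lra.
- by rewrite /cluster => xy; case: (far x) => A B nA nB; rewrite setIC;
  exact: xy.
- by move=> /far.
Qed.

Lemma sph_cg V : compactly_generated (sph V).
Proof.
apply: cg_compact_hausdorff; last exact: sph_hausdorff.
exact: one_point_compactification_compact.
Qed.

(** At infinity, isometries preserve the norm, so the estimate is uniform in f. Near a finite x0,
    the motion of the vector and that of the isometry at x0 each take half of d. *)
Lemma continuous_sph_map (K : topologicalType) V W (f : K -> liso V W)
    (v : K -> sph V) :
  continuous f -> continuous v -> continuous (fun t => sph_map (f t) (v t)).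
Proof.
move=> cf cv t0 A; case E : (v t0) => [x0|] /=.
  move=> /nbhs_sph_someP[d d0 dA].
  have d20 : 0 < d / 2 by lra.
  have c0 : 0 < d / 2 / (ips_norm (x0 : V) + 1).
    by rewrite divr_gt0// ltr_wpDl ?ips_norm_ge0.
  have nf : \forall t \near t0, forall x, ips_norm (f t x - f t0 x) <=
      d / 2 / (ips_norm (x0 : V) + 1) * ips_norm x.
    apply: (@near_emb _ _ _ _ (fun t => liso_emb (f t))) => //.
    by move=> t; apply: continuous_comp; [exact: cf|exact: continuous_liso_emb].
  have nv : \forall t \near t0, sph_ball x0 (d / 2) (v t).
    by apply: (cv t0); rewrite E; exact: nbhs_sph_some.
  apply: filterS2 nf nv => t nf /=; case: (v t) => //= y yx; apply: dA.
  apply: le_lt_trans (ips_dist_triangle (f t x0) _ _) _.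
  rewrite -embB emb_norm [d]splitr; apply: ltr_leD => //.
  apply: le_trans (nf x0) _; rewrite mulrAC ler_pdivrMr ?ltr_wpDl
    ?ips_norm_ge0//.
  by rewrite ler_wpM2l ?(ltW d20)// lerDl.
move=> /nbhs_sph_inftyP[M [A0 MA]].
have nv : \forall t \near t0, sph_far M (v t).
  by apply: (cv t0); rewrite E; exact: nbhs_sph_infty.
apply: filterS nv => t /=; case: (v t) => //= y My.
by apply: MA; rewrite emb_norm.
Qed.

Lemma ips_norm_fst V W (x : V ⊕ W) : ips_norm x.1 <= ips_norm x.
Proof.
rewrite /ips_norm ler_sqrt ?dotp_ge0// [leRHS]/(dsum_dot x x) lerDl.
exact: dotp_ge0.
Qed.

Lemma ips_norm_snd V W (x : V ⊕ W) : ips_norm x.2 <= ips_norm x.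
Proof.
rewrite /ips_norm ler_sqrt ?dotp_ge0// [leRHS]/(dsum_dot x x) lerDr.
exact: dotp_ge0.
Qed.

Lemma sph_pair_infty V W (v : sph V) : sph_pair v (None : sph W) = None.
Proof. by case: v. Qed.

(** The norm of a pair dominates those of both components, so one component near infinity suffices,
    wherever the other one is. *)
Lemma continuous_sph_pair (K : topologicalType) V W (v : K -> sph V)
    (w : K -> sph W) :
  continuous v -> continuous w -> continuous (fun t => sph_pair (v t) (w t)).
Proof.
move=> cv cw t0 A; case Ev : (v t0) => [x0|]; last first.
  move=> /nbhs_sph_inftyP[M [A0 MA]].
  have nv : \forall t \near t0, sph_far M (v t).
    by apply: (cv t0); rewrite Ev; exact: nbhs_sph_infty.
  apply: filterS nv => t /=; case: (v t) => //= y My; case: (w t) => // z.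
  exact/MA/(lt_le_trans My)/(ips_norm_fst ((y, z) : V ⊕ W)).
case Ew : (w t0) => [y0|]; last first.
  move=> /nbhs_sph_inftyP[M [A0 MA]].
  have nw : \forall t \near t0, sph_far M (w t).
    by apply: (cw t0); rewrite Ew; exact: nbhs_sph_infty.
  apply: filterS nw => t /=; case: (w t) => [z Mz|];
    last by rewrite sph_pair_infty.
  case: (v t) => //= y; exact/MA/(lt_le_trans Mz)/(ips_norm_snd
    ((y, z) : V ⊕ W)).
move=> /nbhs_sph_someP[d d0 dA].
have d20 : 0 < d / 2 by lra.
have nv : \forall t \near t0, sph_ball x0 (d / 2) (v t).
  by apply: (cv t0); rewrite Ev; exact: nbhs_sph_some.
have nw : \forall t \near t0, sph_ball y0 (d / 2) (w t).
  by apply: (cw t0); rewrite Ew; exact: nbhs_sph_some.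
apply: filterS2 nv nw => t /=; case: (v t) => // x xx; case: (w t) => // y yy.
apply: dA; exact: ips_pair_dist.
Qed.

End Spheres.

(** * Permutations of places *)

(* The place of q, for q <> i, after place i is replaced by k places. *)
Definition out (i k q : nat) : nat := if (q < i)%N then q else (q + k).-1.

Section PlacePermutations.
Local Open Scope nat_scope.

(* Permutations and signs are compared as functions on nat, since the arities of
   the two sides of an operad axiom are not convertible. *)
Definition nat_perm N (s : 'S_N) (t : nat) : nat :=
  if insub t is Some t' then s (t' : 'I_N) else t.

Lemma nat_permE N (s : 'S_N) (t : 'I_N) : nat_perm s t = s t.
Proof. by rewrite /nat_perm valK. Qed.

Lemma nat_perm_lt N (s : 'S_N) t : t < N -> nat_perm s t < N.
Proof. by move=> tN; rewrite -[t]/(val (Ordinal tN)) nat_permE. Qed.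

Lemma nat_perm_neq N (s : 'S_N) t u : t < N -> u < N -> t <> u ->
  nat_perm s t <> nat_perm s u.
Proof.
move=> tN uN tu e; apply: tu.
have := nat_permE s (Ordinal tN); rewrite /= e (nat_permE s (Ordinal uN)).
by move=> /val_inj/perm_inj/(congr1 val).
Qed.

Arguments nat_perm_neq {N} s {t u}.

Definition perm_eqv a b (s : 'S_a) (u : 'S_b) : Prop :=
  exists e : a = b, ecast c 'S_c e s = u.

Lemma perm_eqvP a b (s : 'S_a) (u : 'S_b) : a = b ->
  (forall t, t < a -> nat_perm s t = nat_perm u t) -> perm_eqv s u.
Proof.
move=> e; case: b / e u => u su; exists erefl; apply/permP => t.
by apply: val_inj; have := su t (ltn_ord t); rewrite !nat_permE.
Qed.

Lemma eq_perm_nat N (s u : 'S_N) :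
  (forall t, t < N -> nat_perm s t = nat_perm u t) -> s = u.
Proof.
move=> su; apply/permP => t.
by apply: val_inj; have := su t (ltn_ord t); rewrite !nat_permE.
Qed.

Lemma nat_perm1 N t : nat_perm (1%g : 'S_N) t = t.
Proof. by rewrite /nat_perm; case: insubP => // t' _ <-; rewrite perm1. Qed.

Lemma nat_permM N (s u : 'S_N) t : nat_perm (s * u)%g t =
  nat_perm u (nat_perm s t).
Proof.
rewrite /nat_perm; case: insubP => [t' _ _|/negbTE tN];
  first by rewrite valK permM.
by rewrite insubF.
Qed.

Lemma nat_perm_tau k e t : t < k -> nat_perm (tau k e) t =
  if e then k.-1 - t else t.
Proof.
move=> tk; case: e; last exact: nat_perm1.
by rewrite -{1}[t]/(val (Ordinal tk)) nat_permE permE /=; lia.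
Qed.

Lemma nat_perm_inner m k (i : 'I_m) (rho : 'S_m) (ups : 'S_k) r : r < k ->
  nat_perm (perm_circ i rho ups) (i + r) = rho i + nat_perm ups r.
Proof.
move=> rk; have -> : i + r = nat_of_ord (inner i (Ordinal rk)) by [].
rewrite nat_permE permE /perm_circ_fun.
have := block_splitP i (inner i (Ordinal rk)).
case: (block_split _ _) => [s /esym/outer_inner//|r' /inner_inj <-].
by rewrite /= -(nat_permE ups (Ordinal rk)).
Qed.

Lemma nat_perm_outer m k (i : 'I_m) (rho : 'S_m) (ups : 'S_k) s :
  s < m -> s <> i ->
  nat_perm (perm_circ i rho ups) (out i k s) = out (rho i) k (nat_perm rho s).
Proof.
move=> sm si; have : i != Ordinal sm by apply/eqP => /(congr1 val) /esym.
case/unlift_some => s' sE _.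
have outE (a : 'I_m) b : out a k (lift a b) = outer k a b.
  by rewrite /out /= /bump; case: leqP => ab /=; do !case: ifP; lia.
have -> : out i k s = nat_of_ord (outer k i s') by rewrite -outE -sE.
rewrite nat_permE permE /perm_circ_fun.
have := block_splitP i (outer k i s').
case: (block_split _ _) => [s2 /outer_inj <-|r /outer_inner//].
case: perm_lift_subproof => s3 /= es3.
by have /= -> := nat_permE rho (Ordinal sm); rewrite sE es3 outE.
Qed.

(** Block substitution respects products of permutation matrices, the second block being put in at
    the place [r1 i] to which the first permutation moves i. *)
Lemma perm_circM m k (i : 'I_m) (r1 r2 : 'S_m) (u1 u2 : 'S_k) :
  perm_circ i (r1 * r2)%g (u1 * u2)%g =
  (perm_circ i r1 u1 * perm_circ (r1 i) r2 u2)%g.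
Proof.
apply/permP => t; rewrite permM !permE /perm_circ_fun.
have := block_splitP i t; case: (block_split i t) => [s|r] tE.
  case: (perm_lift_subproof i (r1 * r2)%g s) => s' /=; rewrite !permM => es'.
  case: (perm_lift_subproof i r1 s) es' => s1 /= -> es'.
  have := block_splitP (r1 i) (outer k (r1 i) s1).
  case: (block_split _ _) => [s2 /outer_inj <-|r /outer_inner//].
  case: perm_lift_subproof => s3 /= es3; congr outer.
  by apply: (@lift_inj _ (r2 (r1 i))); rewrite -es3 -es'.
have := block_splitP (r1 i) (inner (r1 i) (u1 r)).
case: (block_split _ _) => [s /esym/outer_inner//|r' /inner_inj <-].
by rewrite !permM.
Qed.

Definition nat_sign N (x : 'I_N -> bool) (t : nat) : bool :=
  if insub t is Some t' then x t' else false.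

Lemma nat_signE N (x : 'I_N -> bool) (t : 'I_N) : nat_sign x t = x t.
Proof. by rewrite /nat_sign valK. Qed.

(** The composition of (Z/2)^j on functions on nat: when [x i] holds, the sum with [x i] negates the
    inserted block and the index [k.-1 - (t - i)] reverses it. *)
Definition sign_circ (i k : nat) (x y : nat -> bool) (t : nat) : bool :=
  if t < i then x t
  else if t < i + k then x i (+) y (if x i then k.-1 - (t - i) else t - i)
  else x (t.+1 - k).

Lemma sign_circ_inner i k x y r : r < k ->
  sign_circ i k x y (i + r) = x i (+) y (if x i then k.-1 - r else r).
Proof. by move=> rk; rewrite /sign_circ ltnNge leq_addr ltn_add2l rk addKn. Qed.

Lemma sign_circ_outer i k x y s : s <> i -> sign_circ i k x y (out i k s) = x s.
Proof.
move=> si; rewrite /sign_circ /out; case: (ltnP s i) => [->//|ls].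
by do 2![rewrite ifF; last by lia]; congr x; lia.
Qed.

(** The counterpart of [block_split] on nat: it drives all comparisons of places below. *)
Lemma outP m i k t : i < m -> t < (m + k).-1 ->
  (exists2 r, r < k & t = i + r) \/
  (exists s, [/\ s < m, s <> i & t = out i k s]).
Proof.
move=> im tN; have [ti|it] := ltnP t i.
  by right; exists t; rewrite /out ti; split => //; lia.
have [tik|tik] := ltnP t (i + k); first by left; exists (t - i); lia.
right; exists (t.+1 - k); rewrite /out; split; try by lia.
by rewrite ifF; lia.
Qed.

(** Places after two insertions: [out a l b] is where b goes when a is replaced by l places, so both
    sides name place r of the block at a. *)
Lemma out_block a b k l r : a <> b -> r < l ->
  out (out a l b) k (a + r) = out b k a + r.
Proof. by rewrite /out => ab rl; do !case: ifP; lia. Qed.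

Lemma out_out a b k l u : a <> b -> u <> a -> u <> b ->
  out (out b k a) l (out b k u) = out (out a l b) k (out a l u).
Proof. by rewrite /out => ab ua ub; do !case: ifP; lia. Qed.

Lemma out_shift j a b l : b <> a -> out (j + a) l (j + b) = j + out a l b.
Proof. by rewrite /out => ba; do !case: ifP; lia. Qed.

Lemma out_nested j a k l u : a < k -> u <> j ->
  out (j + a) l (out j k u) = out j (k + l).-1 u.
Proof. by rewrite /out => ak uj; do !case: ifP; lia. Qed.

Lemma out_neq i k s r : s <> i -> r < k -> out i k s <> i + r.
Proof. by rewrite /out => si rk; case: ifP; lia. Qed.

Lemma out_lt m i k s : i < m -> s < m -> s <> i -> out i k s < (m + k).-1.
Proof. by rewrite /out => im sm si; case: ifP; lia. Qed.

Lemma out_inj i k s u : s <> i -> u <> i -> out i k s = out i k u -> s = u.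
Proof. by rewrite /out => si ui; do !case: ifP; lia. Qed.

Lemma out1 i s : s <> i -> out i 1 s = s.
Proof. by rewrite /out => si; case: ifP; lia. Qed.

(** Phrased with [out], the two associativity laws for different places become one. A place lies in
    the block of [zeta], in that of [ups], or outside both. *)
Lemma perm_circ_disjoint m k l (i' j : 'I_m) (i : 'I_(m + k).-1)
    (j' : 'I_(m + l).-1) (rho : 'S_m) (ups : 'S_k) (zeta : 'S_l) :
  i' <> j -> i = out j k i' :> nat -> j' = out i' l j :> nat ->
  perm_eqv (perm_circ i (perm_circ j rho ups) zeta)
           (perm_circ j' (perm_circ i' rho zeta) ups).
Proof.
move=> ij iE j'E; have im := ltn_ord i'; have jm := ltn_ord j.
have {}ij : i' <> j :> nat by move=> e; apply: ij; exact: val_inj.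
have ji : j <> i' :> nat by move/esym.
have rij := nat_perm_neq rho im jm ij; rewrite !nat_permE in rij.
have valL : perm_circ j rho ups i = out (rho j) k (rho i') :> nat.
  by rewrite -nat_permE iE nat_perm_outer// nat_permE.
have valR : perm_circ i' rho zeta j' = out (rho i') l (rho j) :> nat.
  by rewrite -nat_permE j'E nat_perm_outer// nat_permE.
apply: perm_eqvP => [|t tN]; first by lia.
have [[r rl ->]|[s [sN si ->]]] := outP (ltn_ord i) tN.
  rewrite nat_perm_inner// valL {1}iE -(out_block _ ij rl) -j'E.
  have j'r : i' + r <> j' by rewrite j'E; exact/nesym/out_neq.
  rewrite nat_perm_outer//; last by lia.
  rewrite nat_perm_inner// valR out_block//; last exact: nat_perm_lt.
have [[r rk sE]|[u [um uj sE]]] := outP jm sN.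
  rewrite nat_perm_outer// valL sE nat_perm_inner// iE (out_block _ ji rk) -j'E.
  by rewrite nat_perm_inner// valR out_block ?nat_perm_lt//; exact/nesym.
have ui : u <> i' by move=> ui; apply: si; rewrite sE ui iE.
have ru := nat_perm_neq rho um im ui; have ru' := nat_perm_neq rho um jm uj.
rewrite !nat_permE in ru ru'.
rewrite nat_perm_outer// valL sE nat_perm_outer// iE
  (out_out _ _ (nesym ji) ui uj) -j'E.
have lt' : out i' l u < (m + l).-1 by exact: out_lt.
have nj' : out i' l u <> j' by rewrite j'E => e; apply: uj; exact: out_inj e.
by rewrite nat_perm_outer// nat_perm_outer// valR out_out.
Qed.

Lemma perm_circ_nested m k l (j : 'I_m) (i' : 'I_k) (i : 'I_(m + k).-1)
    (rho : 'S_m) (ups : 'S_k) (zeta : 'S_l) :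
  i = j + i' :> nat ->
  perm_eqv (perm_circ i (perm_circ j rho ups) zeta)
           (perm_circ j rho (perm_circ i' ups zeta)).
Proof.
move=> iE; have jm := ltn_ord j; have i'k := ltn_ord i'.
have valL : perm_circ j rho ups i = rho j + ups i' :> nat.
  by rewrite -nat_permE iE nat_perm_inner// nat_permE.
apply: perm_eqvP => [|t tN]; first by lia.
have [[r rl ->]|[s [sN si ->]]] := outP (ltn_ord i) tN.
  rewrite nat_perm_inner// valL iE -!addnA nat_perm_inner; last by lia.
  by rewrite nat_perm_inner.
have [[r rk sE]|[u [um uj sE]]] := outP jm sN.
  have ri : r <> i' by move=> ri; apply: si; rewrite sE ri.
  rewrite nat_perm_outer// valL sE nat_perm_inner// iE !out_shift//; last first.
    by have := nat_perm_neq ups rk i'k ri; rewrite !nat_permE.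
  by rewrite nat_perm_inner ?nat_perm_outer//; exact: out_lt.
have ru := nat_perm_neq rho um jm uj; rewrite !nat_permE in ru.
rewrite nat_perm_outer// valL sE nat_perm_outer// iE !out_nested//.
by rewrite nat_perm_outer.
Qed.

(** Reversing a row with a block in it means reversing the order of the outer entries, the block
    counting as one, and reversing inside the block. *)
Lemma perm_circ_tau k l (c : 'I_k) e :
  perm_circ c (tau k e) (tau l e) = tau (k + l).-1 e.
Proof.
apply: eq_perm_nat => t tN; rewrite nat_perm_tau//.
have ck := ltn_ord c; have tauc := nat_perm_tau e ck; rewrite nat_permE in tauc.
have [[r rl tE]|[s [sk sc tE]]] := outP ck tN.
  by rewrite tE nat_perm_inner// tauc nat_perm_tau//; case: e {tauc}; lia.
have := tN; rewrite tE nat_perm_outer// tauc nat_perm_tau//.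
by case: e {tauc} => //; rewrite /out; do !case: ifP; lia.
Qed.

Lemma tauM k e f : (tau k e * tau k f)%g = tau k (e (+) f).
Proof.
apply: eq_perm_nat => t tk; rewrite nat_permM.
by rewrite !nat_perm_tau//; case: e f => -[] //=; lia.
Qed.

Lemma perm_circ_unit_r m (i : 'I_m) (rho : 'S_m) e :
  perm_eqv (perm_circ i rho (tau 1 e)) rho.
Proof.
apply: perm_eqvP => [|t tN]; first by lia.
have [[[|//] _ ->]|[s [sm si ->]]] := outP (ltn_ord i) tN.
  by rewrite nat_perm_inner// nat_perm_tau// addn0 nat_permE; case: e; lia.
rewrite nat_perm_outer// !out1//.
by have := nat_perm_neq rho sm (ltn_ord i) si; rewrite nat_permE.
Qed.

Lemma perm_circ_unit_l k (i : 'I_1) (ups : 'S_k) :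
  perm_eqv (perm_circ i (1%g : 'S_1) ups) ups.
Proof.
apply: perm_eqvP => // t tk; have i0 : i = 0 :> nat by rewrite ord1.
have tE : t = i + t by rewrite i0.
by rewrite {1}tE nat_perm_inner// perm1 i0.
Qed.

End PlacePermutations.

(** * Layers and their suspensions *)

Section EmbDsum.
Context {R : realType}.
Implicit Types U V W : ips R.

Definition emb_dsum V V' W W' (f : emb V V') (g : emb W W') :
  emb (V ⊕ W) (V' ⊕ W').
Proof.
exists (fun p => (f p.1, g p.2)) => [a x y|x y] /=;
  first by rewrite !emb_linear.
by rewrite /dotp /= /dsum_dot !emb_isometric.
Defined.

End EmbDsum.

Section Layers.
Context {R : realType}.

Definition layer_eqv (A : layers R) (V : ips R) a b (x : A a V) (y : A b V) :
  Prop := exists e : a = b, ecast c (A c V) e x = y.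

(** Conditions under which the suspended layers form an operad. In [ls_circ_nested] the place
    [k.-1 - c] occurs because a sign -1 of x at b reverses the block put in there. The law
    [ls_circ_disjoint] serves both orders of the places, and [ls_arity0] yields P(0) = S. *)
Record is_layers (A : layers R) : Prop := {
  ls_map_id : forall j V (x : A j V), ls_map (liso_id V) x = x;
  ls_map_comp : forall j U V W (g : emb V W) (f : emb U V) (x : A j U),
    ls_map (emb_comp g f) x = ls_map g (ls_map f x);
  ls_map_continuous : forall j V W,
    probe_continuous2 (fun (f : emb V W) (x : A j V) => ls_map f x);
  ls_circ_continuous : forall m k (i : 'I_m) V W,
    probe_continuous2 (@ls_circ _ A m k i V W);
  ls_circ_map : forall m k (i : 'I_m) V V' W W' (f : emb V V') (g : emb W W')
    (x : A m V) (y : A k W),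
    ls_circ i (ls_map f x) (ls_map g y) = ls_map (emb_dsum f g) (ls_circ i x y);
  ls_sign_continuous : forall j V (r : 'I_j),
    @probe_continuous (A j V) (discrete_topology bool) (fun x => ls_sign x r);
  ls_sign_map : forall j V W (f : emb V W) (x : A j V) r,
    ls_sign (ls_map f x) r = ls_sign x r;
  ls_sign_circ : forall m k (i : 'I_m) V W (x : A m V) (y : A k W) t,
    ls_sign (ls_circ i x y) t =
    sign_circ i k (nat_sign (ls_sign x)) (nat_sign (ls_sign y)) t;
  ls_sign_one : forall j V r, ls_sign (ls_one A j V) r = false;
  ls_map_one : forall j V W (f : emb V W), ls_map f (ls_one A j V) =
    ls_one A j W;
  ls_arity0 : forall V (x : A 0 V), x = ls_one A 0 V;
  ls_circ_disjoint : forall m k l (a b : 'I_m) (a' : 'I_(m + k).-1)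
    (b' : 'I_(m + l).-1) U V W (x : A m U) (y : A k V) (z : A l W),
    a <> b -> a' = out b k a :> nat -> b' = out a l b :> nat ->
    layer_eqv (ls_circ a' (ls_circ b x y) z)
      (ls_map (liso_swap23 U W V) (ls_circ b' (ls_circ a x z) y));
  ls_circ_nested : forall m k l (b : 'I_m) (c : 'I_k) (a : 'I_(m + k).-1)
    U V W (x : A m U) (y : A k V) (z : A l W),
    a = (b + (if ls_sign x b then k.-1 - c else c))%N :> nat ->
    layer_eqv (ls_map (liso_assoc U V W) (ls_circ a (ls_circ b x y) z))
      (ls_circ b x (ls_circ c y z));
  ls_circ_one : forall m (i : 'I_m) V W (x : A m V),
    layer_eqv (ls_circ i x (ls_one A 1 W)) (ls_map (emb_inl V W) x);
  ls_one_circ : forall k (i : 'I_1) V W (y : A k W),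
    layer_eqv (ls_circ i (ls_one A 1 V) y) (ls_map (emb_inr V W) y) }.

End Layers.

(** * Formulas and continuity on points of suspensions *)

Section SuspensionPoints.
Context {R : realType}.
Variable A : layers R.
Implicit Types V W : ips R.

Lemma susp_pt_infty j V (x : A j V) rho :
  susp_pt x rho (point : sph V) = point.
Proof. exact: smash_pair_point. Qed.

Lemma suspP j V (q : susp_obj A j V) :
  q = point \/ exists x rho v, q = susp_pt x rho v.
Proof.
have [[[x rho]|] [v ->]] := smash_surj q; last by left; exact: smash_point_pair.
by right; exists x, rho, v.
Qed.

Lemma susp_cg j V : compactly_generated (susp_obj A j V).
Proof. exact: smash_cg. Qed.

Lemma susp_rec_point j V (Z : Type) (z : Z) (f : A j V -> 'S_j -> sph V -> Z) :
  (forall x rho, f x rho point = z) -> susp_rec z f point = z.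
Proof.
move=> fz; rewrite -(@smash_pair_point (plus (susp_cells A j V)) (sph V) None).
by rewrite /susp_rec (@smash_recE _ _ _ z)// => -[[]|].
Qed.

Lemma continuous_susp_pt (K : topologicalType) j V (x : K -> A j V) rho
    (v : K -> sph V) :
  compact [set: K] -> hausdorff_space K -> continuous x -> continuous v ->
  continuous (fun t => susp_pt (x t) rho (v t)).
Proof.
move=> cK hK cx cv; apply: continuous_smash_pair => //.
apply: (@continuous_some K (susp_cells A j V) (fun t => (x t, rho))).
by apply: continuous_kpair => // t; exact: cvg_cst.
Qed.

(** The variable y is carried along so that one smash factor can be analysed while the other is a
    parameter. The permutation is discrete, hence locally constant along a probe, and may be
    fixed. *)
Lemma probe_continuous2_susp j V (Y T : topologicalType) (z : T)
    (f : Y -> A j V -> 'S_j -> sph V -> T) :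
  (forall y x rho, f y x rho point = z) ->
  (forall rho (K : topologicalType) y x v,
    compact [set: K] -> hausdorff_space K -> continuous y ->
    continuous x -> continuous v ->
    continuous (fun t : K => f (y t) (x t) rho (v t))) ->
  probe_continuous2 (fun (q : susp_obj A j V) y => susp_rec z (f y) q).
Proof.
move=> fz cf; apply: probe_continuous2_smash => K a b c cK hK ca cb cc.
have -> : (fun t => susp_rec z (f (c t)) (a t ∧ b t)) =
    (fun t => if a t is Some p then f (c t) p.1 p.2 (b t) else z).
  apply/funext => t; rewrite /susp_rec (@smash_recE _ _ _ z)//.
    by case: (a t) => [[]|].
  by move=> -[[x rho]|].
pose F (p : susp_cells A j V) t := f (c t) p.1 p.2 (b t).
apply: (@continuous_plus K (susp_cells A j V) T a z F ca) => p cp.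
have cp1 := kprod_continuous_fst cp; have cp2 := kprod_continuous_snd cp.
apply: (@continuous_discrete K (discrete_topology 'S_j) T
  (fun rho t => f (c t) (p t).1 rho (b t)) (snd \o p) cp2) => rho.
exact: cf.
Qed.

Lemma continuous_susp_rec j V (T : topologicalType) (z : T)
    (f : A j V -> 'S_j -> sph V -> T) :
  (forall x rho, f x rho point = z) ->
  (forall rho, probe_continuous2 (fun x v => f x rho v)) ->
  continuous (susp_rec z f).
Proof.
move=> fz cf; apply: cg_continuous; first exact: susp_cg.
move=> K g cK hK cg.
apply: (@probe_continuous2_susp j V (susp_obj A j V) T z (fun=> f) _ _ K g g)
  => // rho L _ x v cL hL _ cx cv; exact: cf.
Qed.

Lemma susp_map_pt j V W (f : liso V W) (x : A j V) rho v :
  susp_map f (susp_pt x rho v) = susp_pt (ls_map f x) rho (sph_map f v).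
Proof. by rewrite /susp_map susp_recE// => *; exact: susp_pt_infty. Qed.

Lemma susp_map_point j V W (f : liso V W) :
  susp_map f (point : susp_obj A j V) = point.
Proof. by rewrite /susp_map susp_rec_point// => *; exact: susp_pt_infty. Qed.

Let str V W j (a : susp_obj A j V) (w : sph W) : susp_obj A j (V ⊕ W) :=
  susp_rec point (fun x rho v =>
    susp_pt (ls_map (emb_inl V W) x) rho (sph_pair v w)) a.

Let str_point V W j (w : sph W) : str (point : susp_obj A j V) w = point.
Proof. by rewrite /str susp_rec_point// => *; exact: susp_pt_infty. Qed.

Let str_infty V W j (a : susp_obj A j V) : str a (point : sph W) = point.
Proof.
have [->|[x [rho [v ->]]]] := suspP a; first by rewrite str_point.
rewrite /str susp_recE ?sph_pair_infty => *; exact: susp_pt_infty.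
Qed.

Lemma susp_str_pt j V W (x : A j V) rho v (w : sph W) :
  susp_str (susp_pt x rho v ∧ w) =
  susp_pt (ls_map (emb_inl V W) x) rho (sph_pair v w).
Proof.
rewrite /susp_str (smash_recE (@str_point V W j) (@str_infty V W j)) /str
  susp_recE//.
by move=> *; exact: susp_pt_infty.
Qed.

Lemma susp_str_point j V W (w : sph W) :
  susp_str ((point : susp_obj A j V) ∧ w) = point.
Proof.
by rewrite /susp_str (smash_recE (@str_point V W j) (@str_infty V W j))
  str_point.
Qed.

Lemma susp_act_pt j (nu : 'S_j) V (x : A j V) rho v :
  susp_act nu (susp_pt x rho v) = susp_pt x (nu * rho)%g v.
Proof. by rewrite /susp_act susp_recE// => *; exact: susp_pt_infty. Qed.

Lemma susp_act_point j (nu : 'S_j) V :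
  susp_act nu (point : susp_obj A j V) = point.
Proof. by rewrite /susp_act susp_rec_point// => *; exact: susp_pt_infty. Qed.

Section Circ.
Variables (m k : nat) (i : 'I_m) (V W : ips R).

Let circ_in (b : susp_obj A k W) (x : A m V) (rho : 'S_m) (v : sph V) :
    susp_obj A (m + k).-1 (V ⊕ W) :=
  susp_rec point (fun y ups w => susp_pt (ls_circ (rho i) x y)
    (perm_circ i rho (ups * tau k (ls_sign x (rho i)))%g) (sph_pair v w)) b.

Let circ (a : susp_obj A m V) (b : susp_obj A k W) :=
  susp_rec point (circ_in b) a.

Let circ_in_pt (x : A m V) rho v (y : A k W) ups w : circ_in (susp_pt y ups w)
  x rho v =
  susp_pt (ls_circ (rho i) x y)
    (perm_circ i rho (ups * tau k (ls_sign x (rho i)))%g) (sph_pair v w).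
Proof.
by rewrite /circ_in susp_recE// => *; rewrite sph_pair_infty;
  exact: susp_pt_infty.
Qed.

Let circ_in_point x rho v : circ_in point x rho v = point.
Proof.
by rewrite /circ_in susp_rec_point// => *; rewrite sph_pair_infty;
  exact: susp_pt_infty.
Qed.

Let circ_in_infty b x rho : circ_in b x rho point = point.
Proof.
have [->|[y [ups [w ->]]]] := suspP b; first exact: circ_in_point.
by rewrite circ_in_pt; exact: susp_pt_infty.
Qed.

Let circ_point b : circ point b = point.
Proof. by rewrite /circ susp_rec_point// => *; exact: circ_in_infty. Qed.

Let circ_pointr a : circ a point = point.
Proof.
have [->|[x [rho [v ->]]]] := suspP a; first exact: circ_point.
by rewrite /circ susp_recE ?circ_in_point// => *; exact: circ_in_infty.
Qed.

Lemma susp_circ_pt (x : A m V) rho v (y : A k W) ups w :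
  susp_circ i (susp_pt x rho v ∧ susp_pt y ups w) =
  susp_pt (ls_circ (rho i) x y)
    (perm_circ i rho (ups * tau k (ls_sign x (rho i)))%g) (sph_pair v w)
  :> susp_obj A _ _.
Proof.
rewrite /susp_circ (smash_recE circ_point circ_pointr) /circ susp_recE//.
Qed.

Lemma susp_circ_point (b : susp_obj A k W) :
  susp_circ i ((point : susp_obj A m V) ∧ b) = point :> susp_obj A _ (V ⊕ W).
Proof. by rewrite /susp_circ (smash_recE circ_point circ_pointr) circ_point.
Qed.

Lemma susp_circ_pointr (a : susp_obj A m V) :
  susp_circ i (a ∧ (point : susp_obj A k W)) = point :> susp_obj A _ (V ⊕ W).
Proof. by rewrite /susp_circ (smash_recE circ_point circ_pointr) circ_pointr.
Qed.

Lemma susp_circ_continuous : is_layers A ->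
  continuous (@susp_circ _ A m k i V W).
Proof.
move=> AP; apply: smash_continuous.
have -> : (fun x y => susp_circ i (x ∧ y)) = circ.
  by apply/funext => x; apply/funext => y;
    rewrite /susp_circ (smash_recE circ_point circ_pointr).
apply: probe_continuous2_susp => [b x rho|rho K b x v cK hK cb cx cv].
  exact: circ_in_infty.
(* The first factor, already reduced to x and v, becomes a single parameter p for the analysis of
   the second. *)
pose F (p : A m V * sph V) (y : A k W) ups w : susp_obj A (m + k).-1 (V ⊕ W) :=
  susp_pt (ls_circ (rho i) p.1 y)
    (perm_circ i rho (ups * tau k (ls_sign p.1 (rho i)))%g) (sph_pair p.2 w).
suff cF : probe_continuous2 (fun (q : susp_obj A k W) y =>
  susp_rec point (F y) q).
  exact: (cF K b (fun t => (x t, v t)) cK hK cb (continuous_pair cx cv)).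
apply: probe_continuous2_susp => [p y ups|].
  by rewrite /F sph_pair_infty susp_pt_infty.
move=> ups L p y w cL hL cp cy cw.
have cp1 := continuous_fst_comp cp; have cp2 := continuous_snd_comp cp.
(* The sign is locally constant, so the permutation twisted by it may be held fixed. *)
apply: (@continuous_discrete L (discrete_topology bool)
  (susp_obj A (m + k).-1 (V ⊕ W)) (fun s t =>
  susp_pt (ls_circ (rho i) (p t).1 (y t)) (perm_circ i rho (ups * tau k s)%g)
    (sph_pair (p t).2 (w t))) (fun t => ls_sign (p t).1 (rho i))).
  exact: (@ls_sign_continuous _ _ AP _ _ (rho i) _ _ cL hL cp1).
move=> s; apply: continuous_susp_pt => //.
  exact: (@ls_circ_continuous _ _ AP m k (rho i) V W L (fun t => (p t).1) y cL
    hL cp1 cy).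
exact: continuous_sph_pair.
Qed.

End Circ.

Lemma arity_eq_pt V a b (x : A a V) (y : A b V) (rho : 'S_a) (ups : 'S_b) v :
  layer_eqv x y -> perm_eqv rho ups ->
  @arity_eq R (susp_operad A) V a b (susp_pt x rho v) (susp_pt y ups v).
Proof.
(* Proofs of an equality in nat are unique, so both casts run along the same one. *)
move=> [e <-] [e' <-]; rewrite (eq_irrelevance e' e); exists e.
by case: b / e y ups e'.
Qed.

Lemma arity_eq_point V a b : a = b ->
  @arity_eq R (susp_operad A) V a b point point.
Proof. by move=> e; exists e; case: b / e. Qed.

End SuspensionPoints.

(** * The operad laws for suspended layers *)

Section SuspensionOperad.
Context {R : realType}.
Variable A : layers R.
Hypothesis AP : is_layers A.
Implicit Types U V W : ips R.

Lemma sph_map_id V (v : sph V) : sph_map (liso_id V) v = v.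
Proof. by case: v. Qed.

Lemma sph_map_comp U V W (g : liso V W) (f : liso U V) (v : sph U) :
  sph_map (liso_comp g f) v = sph_map g (sph_map f v).
Proof. by case: v. Qed.

Lemma sph_pair_natural V V' W W' (f : liso V V') (g : liso W W') v w :
  sph_pair (sph_map f v) (sph_map g w) =
  sph_map (liso_dsum f g) (sph_pair v w).
Proof. by case: v w => [v|] [w|]. Qed.

Lemma susp_is_spectrum j : is_spectrum (susp_spectrum A j).
Proof.
split=> [V|V W|V W f|V x|U V W g f x|V W|V W|V V' W W' f g x w|V x|U V W x v w].
- exact: susp_cg.
- apply: (@kprod_continuous _ _ _ (fun f x => susp_map f x)).
  apply: probe_continuous2C.
  apply: (@probe_continuous2_susp _ _ _ _ (liso V W) _ point
    (fun f x rho v => susp_pt (ls_map f x) rho (sph_map f v))).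
    by move=> f x rho; exact: susp_pt_infty.
  move=> rho K f x v cK hK cf cx cv; apply: continuous_susp_pt => //;
    last first.
    exact: continuous_sph_map.
  apply: (@ls_map_continuous _ _ AP j V W K (fun t => liso_emb (f t))) => //.
  by move=> t; apply: continuous_comp; [exact: cf|exact: continuous_liso_emb].
- exact: susp_map_point.
- have [->|[y [rho [v ->]]]] := suspP x; first exact: susp_map_point.
  by rewrite /= susp_map_pt ls_map_id// sph_map_id.
- have [->|[y [rho [v ->]]]] := suspP x; first by rewrite /= !susp_map_point.
  by rewrite /= !susp_map_pt -(ls_map_comp AP) sph_map_comp.
- apply: smash_continuous.
  pose F (w : sph W) (x : A j V) rho v :=
    susp_pt (ls_map (emb_inl V W) x) rho (sph_pair v w).
  suff cF : probe_continuous2 (fun (q : susp_obj A j V) w =>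
    susp_rec point (F w) q).
    rewrite (_ : (fun x y => _) = (fun q w => susp_rec point (F w) q))//.
    apply/funext => q; apply/funext => w /=.
    have [->|[y [rho [v ->]]]] := suspP q.
      by rewrite susp_str_point susp_rec_point// => *; exact: susp_pt_infty.
    by rewrite susp_str_pt susp_recE// => *; exact: susp_pt_infty.
  apply: probe_continuous2_susp => [w x rho|rho K w x v cK hK cw cx cv].
    exact: susp_pt_infty.
  apply: continuous_susp_pt => //; last exact: continuous_sph_pair.
  apply: (@ls_map_continuous _ _ AP j V (V ⊕ W) K (fun=> emb_inl V W)) => //.
  by move=> t; exact: cvg_cst.
- by rewrite /= -(@smash_pair_point (susp_obj A j V) (sph W) point)
  susp_str_point.
- have [->|[y [rho [v ->]]]] := suspP x.
    by rewrite /= susp_map_point !susp_str_point susp_map_point.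
  rewrite /= susp_map_pt !susp_str_pt susp_map_pt sph_pair_natural.
  by rewrite -!(ls_map_comp AP); congr (susp_pt (ls_map _ _) _ _);
    apply: embP => z; congr pair; rewrite /= -(subrr (0 : W)) embB subrr.
- have [->|[y [rho [v ->]]]] := suspP x.
    by rewrite /= susp_str_point susp_map_point.
  rewrite /= susp_str_pt susp_map_pt -(ls_map_comp AP); congr susp_pt.
    rewrite -[RHS](ls_map_id AP); congr (ls_map _ _); exact: embP.
  by case: v.
- have [->|[y [rho [u ->]]]] := suspP x.
    by rewrite /= !susp_str_point susp_map_point.
  rewrite /= !susp_str_pt susp_map_pt -!(ls_map_comp AP); congr susp_pt.
    by congr (ls_map _ _); apply: embP.
  by case: u v w => [u|] [v|] [w|].
Qed.

Lemma susp_act_is_map j (nu : 'S_j) :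
  @is_spectrum_map R (susp_spectrum A j) (susp_spectrum A j)
    (@susp_act R A j nu).
Proof.
split=> [V|V|V W a x|V W x w].
- apply: continuous_susp_rec => [x rho|rho]; first exact: susp_pt_infty.
  by move=> K x v cK hK cx cv; exact: continuous_susp_pt.
- exact: susp_act_point.
- have [->|[y [rho [v ->]]]] := suspP x.
    by rewrite /= susp_act_point !susp_map_point susp_act_point.
  by rewrite /= susp_map_pt !susp_act_pt susp_map_pt.
- have [->|[y [rho [v ->]]]] := suspP x.
    by rewrite /= susp_act_point !susp_str_point susp_act_point.
  by rewrite /= susp_str_pt !susp_act_pt susp_str_pt.
Qed.

Lemma susp_circ_is_map m k (i : 'I_m) :
  @is_smash_map R (susp_spectrum A m) (susp_spectrum A k)
    (susp_spectrum A (m + k).-1) (@susp_circ R A m k i).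
Proof.
split=> [V W|V W|V V' W W' f g x y|V W U x y u|V W U x y u].
- exact: susp_circ_continuous.
- rewrite /= -(@smash_pair_point (susp_obj A m V) (susp_obj A k W) point).
  exact: susp_circ_point.
- have [->|[a [rho [v ->]]]] := suspP x.
    by rewrite /= susp_map_point !susp_circ_point susp_map_point.
  have [->|[b [ups [w ->]]]] := suspP y.
    by rewrite /= susp_map_point !susp_circ_pointr susp_map_point.
  rewrite /= !susp_map_pt !susp_circ_pt susp_map_pt sph_pair_natural.
  rewrite ls_sign_map// ls_circ_map//; congr (susp_pt (ls_map _ _) _ _).
- have [->|[a [rho [v ->]]]] := suspP x.
    by rewrite /= !susp_circ_point susp_str_point susp_map_point.
  have [->|[b [ups [w ->]]]] := suspP y.
    by rewrite /= !(susp_circ_pointr, susp_str_point) susp_map_point.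
  rewrite /= susp_circ_pt !susp_str_pt susp_map_pt susp_circ_pt; congr susp_pt.
    (* The inclusion acts on b only; writing a as its image under the identity makes [ls_circ_map]
       applicable. *)
    rewrite -{2}[a](ls_map_id AP) ls_circ_map// -(ls_map_comp AP).
    by congr (ls_map _ _); apply: embP => -[].
  by case: v w u => [v|] [w|] [u|].
- have [->|[a [rho [v ->]]]] := suspP x.
    by rewrite /= !(susp_circ_point, susp_str_point) susp_map_point.
  have [->|[b [ups [w ->]]]] := suspP y.
    by rewrite /= !(susp_circ_pointr, susp_str_point) susp_map_point.
  rewrite /= susp_circ_pt !susp_str_pt susp_map_pt susp_circ_pt ls_sign_map//.
  congr susp_pt.
    rewrite -{2}[b](ls_map_id AP) ls_circ_map// -(ls_map_comp AP).
    by congr (ls_map _ _); apply: embP => -[].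
  by case: v w u => [v|] [w|] [u|].
Qed.

Lemma susp_one_is_map j :
  @is_spectrum_map R sphere (susp_spectrum A j) (@susp_one R A j).
Proof.
split=> [V|V|V W a x|V W x w].
- apply: cg_continuous; first exact: sph_cg.
  move=> K g cK hK cg; apply: continuous_susp_pt => // t; exact: cvg_cst.
- exact: susp_pt_infty.
- by rewrite /= /susp_one susp_map_pt ls_map_one.
- rewrite /= {2}/susp_one susp_str_pt ls_map_one//.
  by rewrite (smash_recE (z := None))// => v; exact: sph_pair_infty.
Qed.

(** In arity 0 both the layer and the symmetric group have one element, so forgetting them inverts
    [susp_one]. *)
Definition susp_zero_inv V : susp_obj A 0 V -> sph V :=
  susp_rec point (fun _ _ v => v).

Lemma susp_zero_inv_is_map :
  @is_spectrum_map R (susp_spectrum A 0) sphere susp_zero_inv.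
Proof.
have invE V (x : A 0 V) rho v : susp_zero_inv (susp_pt x rho v) = v.
  by rewrite /susp_zero_inv susp_recE.
have inv_point V : @susp_zero_inv V point = point.
  by rewrite /susp_zero_inv susp_rec_point.
split=> [V|V|V W a x|V W x w].
- by apply: continuous_susp_rec => // rho K x v.
- exact: inv_point.
- have [->|[y [rho [v ->]]]] := suspP x;
  first by rewrite /= susp_map_point !inv_point.
  by rewrite /= susp_map_pt !invE.
- have pairE (v : sph V) : smash_rec (@sph_pair R V W) (v ∧ w) = sph_pair v w.
    by rewrite (smash_recE (z := None))// => v'; exact: sph_pair_infty.
  have [->|[y [rho [v ->]]]] := suspP x.
    by rewrite /= susp_str_point !inv_point pairE.
  by rewrite /= susp_str_pt !invE pairE.
Qed.

Lemma susp_zero_invK V : cancel (@susp_one R A 0 V) (@susp_zero_inv V) /\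
  cancel (@susp_zero_inv V) (@susp_one R A 0 V).
Proof.
have invE (x : A 0 V) rho v : susp_zero_inv (susp_pt x rho v) = v.
  by rewrite /susp_zero_inv susp_recE.
split=> [v|x]; first exact: invE.
have [->|[y [rho [v ->]]]] := suspP x.
  by rewrite /susp_zero_inv susp_rec_point// /susp_one susp_pt_infty.
rewrite invE /susp_one (ls_arity0 AP y); congr susp_pt.
by apply/permP => -[].
Qed.

(** An insertion at one place leaves the sign of x at the other unchanged ([sgL], [sgR]), so y and z
    undergo the same twists on both sides. *)
Lemma susp_circ_disjoint m k l (i' j : 'I_m) (i : 'I_(m + k).-1)
    (j' : 'I_(m + l).-1) U V W (x : susp_obj A m U) (y : susp_obj A k V)
    (z : susp_obj A l W) :
  i' <> j -> i = out j k i' :> nat -> j' = out i' l j :> nat ->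
  @arity_eq R (susp_operad A) _ _ _
    (susp_circ i (susp_circ j (x ∧ y) ∧ z))
    (susp_map (liso_swap23 U W V)
      (susp_circ j' (susp_circ i' (x ∧ z) ∧ y))).
Proof.
move=> ij iE j'E.
have arE : ((m + k).-1 + l).-1 = ((m + l).-1 + k).-1.
  by have := ltn_ord i; have := ltn_ord j'; lia.
have [->|[a [rho [u ->]]]] := suspP x.
  by rewrite !susp_circ_point susp_map_point; exact: arity_eq_point.
have [->|[b [ups [v ->]]]] := suspP y.
  rewrite !(susp_circ_pointr, susp_circ_point) susp_map_point.
  exact: arity_eq_point.
have [->|[c [zeta [w ->]]]] := suspP z.
  rewrite !(susp_circ_pointr, susp_circ_point) susp_map_point.
  exact: arity_eq_point.
rewrite !susp_circ_pt susp_map_pt.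
have -> : sph_pair (sph_pair u v) w = sph_map (liso_swap23 U W V)
    (sph_pair (sph_pair u w) v).
  by case: u v w => [u|] [v|] [w|].
have im := ltn_ord i'; have jm := ltn_ord j.
have nij : i' <> j :> nat by move/val_inj.
have rij : rho i' <> rho j by move/perm_inj.
set sL := perm_circ j _ _; set sR := perm_circ i' _ _.
have valL : sL i = out (rho j) k (rho i') :> nat.
  by rewrite -nat_permE iE nat_perm_outer// nat_permE.
have valR : sR j' = out (rho i') l (rho j) :> nat.
  by rewrite -nat_permE j'E nat_perm_outer ?nat_permE//; exact: nesym.
have sgL : ls_sign (ls_circ (rho j) a b) (sL i) = ls_sign a (rho i').
  rewrite ls_sign_circ// valL sign_circ_outer ?nat_signE//.
  by move/val_inj.
have sgR : ls_sign (ls_circ (rho i') a c) (sR j') = ls_sign a (rho j).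
  rewrite ls_sign_circ// valR sign_circ_outer ?nat_signE//.
  by move/val_inj/esym.
apply: arity_eq_pt; first exact: ls_circ_disjoint.
by rewrite sgL sgR; exact: perm_circ_disjoint.
Qed.

Lemma susp_circ_nested m k l (j : 'I_m) (i : 'I_(m + k).-1) (i' : 'I_k)
    U V W (x : susp_obj A m U) (y : susp_obj A k V) (z : susp_obj A l W) :
  i = (j + i')%N :> nat ->
  @arity_eq R (susp_operad A) _ _ _
    (susp_map (liso_assoc U V W) (susp_circ i (susp_circ j (x ∧ y) ∧ z)))
    (susp_circ j (x ∧ susp_circ i' (y ∧ z))).
Proof.
move=> iE.
have arE : ((m + k).-1 + l).-1 = (m + (k + l).-1).-1.
  by have := ltn_ord j; have := ltn_ord i'; lia.
have [->|[a [rho [u ->]]]] := suspP x.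
  by rewrite !susp_circ_point susp_map_point; exact: arity_eq_point.
have [->|[b [ups [v ->]]]] := suspP y.
  rewrite !(susp_circ_pointr, susp_circ_point) susp_map_point.
  exact: arity_eq_point.
have [->|[c [zeta [w ->]]]] := suspP z.
  rewrite !(susp_circ_pointr, susp_circ_point) susp_map_point.
  exact: arity_eq_point.
rewrite !susp_circ_pt susp_map_pt.
have -> : sph_map (liso_assoc U V W) (sph_pair (sph_pair u v) w) =
    sph_pair u (sph_pair v w).
  by case: u v w => [u|] [v|] [w|].
set e := ls_sign a (rho j); set f := ls_sign b (ups i').
set s := perm_circ j _ _; have ik := ltn_ord i'.
have si : s i = (rho j + (if e then k.-1 - ups i' else ups i'))%N :> nat.
  rewrite -nat_permE iE nat_perm_inner// nat_permM nat_perm_tau ?nat_permE//.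
have sg : ls_sign (ls_circ (rho j) a b) (s i) = f (+) e.
  rewrite ls_sign_circ// si sign_circ_inner; last first.
    by have := ltn_ord (ups i'); case: (e); lia.
  rewrite nat_signE -/e addbC; congr (_ (+) e); case: (e).
    rewrite subKn ?nat_signE//.
    by have := ltn_ord (ups i'); lia.
  by rewrite nat_signE.
apply: arity_eq_pt; first exact: ls_circ_nested.
(* The twist of z splits into the part due to y and the part e due to x. By [perm_circ_tau] the
   latter joins the twist of y by e into one reversal of the composite block. *)
rewrite sg -tauM mulgA -(perm_circ_tau _ (ups i') e) -perm_circM.
exact: perm_circ_nested.
Qed.

Lemma susp_operad_is_operad : is_operad (susp_operad A).
Proof.
split.
- exact: susp_is_spectrum.
- exact: susp_act_is_map.
- move=> j V x; have [->|[a [rho [v ->]]]] := suspP x;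
  first exact: susp_act_point.
  by rewrite /= susp_act_pt mul1g.
- move=> j rho nu V x; have [->|[a [rho' [v ->]]]] := suspP x.
    by rewrite /= !susp_act_point.
  by rewrite /= !susp_act_pt mulgA.
- exact: susp_circ_is_map.
- exact: susp_one_is_map.
- exact: susp_one_is_map.
- by exists susp_zero_inv; [exact: susp_zero_inv_is_map|exact: susp_zero_invK].
- move=> m k l i' j i j' U V W x y z ij i'E j'E.
  apply: susp_circ_disjoint; rewrite /out.
  + by move=> e; move: ij; rewrite -i'E e ltnn.
  + by rewrite i'E ij.
  + by rewrite i'E ifF//; lia.
- move=> m k l j i i' U V W x y z ij i'E.
  by apply: susp_circ_nested; lia.
- move=> m k l i' j i j' U V W x y z ij i'E j'E.
  apply: susp_circ_disjoint; rewrite /out.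
  + by move=> /(congr1 val) /=; lia.
  + by rewrite i'E ifF//; lia.
  + by rewrite i'E ifT//; lia.
- move=> m k i rho ups V W x y; have [->|[a [rho' [v ->]]]] := suspP x.
    by rewrite /= susp_act_point !susp_circ_point susp_act_point.
  have [->|[b [ups' [w ->]]]] := suspP y.
    by rewrite /= susp_act_point !susp_circ_pointr susp_act_point.
  by rewrite /= !susp_act_pt !susp_circ_pt susp_act_pt -perm_circM permM mulgA.
- move=> m i V W x w; have [->|[a [rho [v ->]]]] := suspP x.
    by rewrite /= susp_circ_point susp_str_point; apply: arity_eq_point; lia.
  rewrite /= susp_circ_pt susp_str_pt mul1g.
  by apply: arity_eq_pt; [exact: ls_circ_one|exact: perm_circ_unit_r].
- move=> k i V W v y; have [->|[b [ups [w ->]]]] := suspP y.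
    by rewrite /= susp_circ_pointr susp_str_point susp_map_point;
      exact: arity_eq_point.
  rewrite /= susp_circ_pt susp_str_pt susp_map_pt perm1 ls_sign_one// mulg1.
  have -> : sph_map (liso_swap W V) (sph_pair w v) = sph_pair v w.
    by case: v w => [v|] [w|].
  apply: arity_eq_pt; last exact: perm_circ_unit_l.
  rewrite -(ls_map_comp AP) (_ : emb_comp _ _ = emb_inr V W); last exact: embP.
  exact: ls_one_circ.
Qed.

End SuspensionOperad.

(** * Maps of operads from maps of layers *)

Section SuspensionMap.
Context {R : realType}.
Variables A B : layers R.

(** The condition [lm_sign] matters for the permutation part of a composition, which depends on the
    signs of the first factor. *)
Record is_layers_map (f : forall j V, A j V -> B j V) : Prop := {
  lm_continuous : forall j V, probe_continuous (@f j V);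
  lm_map : forall j V W (e : emb V W) (x : A j V),
    f j W (ls_map e x) = ls_map e (f j V x);
  lm_circ : forall m k (i : 'I_m) V W (x : A m V) (y : A k W),
    f _ _ (ls_circ i x y) = ls_circ i (f _ _ x) (f _ _ y);
  lm_sign : forall j V (x : A j V) r, ls_sign (f _ _ x) r = ls_sign x r;
  lm_one : forall j V, f j V (ls_one A j V) = ls_one B j V }.

Variable f : forall j V, A j V -> B j V.
Hypothesis fP : is_layers_map f.

Definition susp_layers_map j V : susp_obj A j V -> susp_obj B j V :=
  susp_rec point (fun x rho v => susp_pt (f x) rho v).

Lemma susp_layers_map_pt j V (x : A j V) rho v :
  susp_layers_map (susp_pt x rho v) = susp_pt (f x) rho v.
Proof. by rewrite /susp_layers_map susp_recE// => *; exact: susp_pt_infty. Qed.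

Lemma susp_layers_map_point j V : @susp_layers_map j V point = point.
Proof. by rewrite /susp_layers_map susp_rec_point// => *; exact: susp_pt_infty.
Qed.

Lemma susp_operad_map (hA : is_operad (susp_operad A))
    (hB : is_operad (susp_operad B)) : operad_map (Operad hA) (Operad hB).
Proof.
apply: (@OperadMap R (Operad hA) (Operad hB) susp_layers_map).
- move=> j; split=> [V|V|V W a x|V W x w].
  + apply: continuous_susp_rec => [x rho|rho K x v cK hK cx cv].
      exact: susp_pt_infty.
    apply: continuous_susp_pt => //.
    exact: (@lm_continuous _ fP j V K x cK hK cx).
  + exact: susp_layers_map_point.
  + have [->|[y [rho [v ->]]]] := suspP x.
      by rewrite /= susp_map_point !susp_layers_map_point susp_map_point.
    by rewrite /= susp_map_pt !susp_layers_map_pt susp_map_pt lm_map.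
  + have [->|[y [rho [v ->]]]] := suspP x.
      by rewrite /= susp_str_point !susp_layers_map_point susp_str_point.
    by rewrite /= susp_str_pt !susp_layers_map_pt susp_str_pt lm_map.
- move=> j nu V x; have [->|[y [rho [v ->]]]] := suspP x.
    by rewrite /= susp_act_point !susp_layers_map_point susp_act_point.
  by rewrite /= susp_act_pt !susp_layers_map_pt susp_act_pt.
- move=> m k i V W x y; have [->|[a [rho [v ->]]]] := suspP x.
    by rewrite /= susp_circ_point !susp_layers_map_point susp_circ_point.
  have [->|[b [ups [w ->]]]] := suspP y.
    by rewrite /= susp_circ_pointr !susp_layers_map_point susp_circ_pointr.
  rewrite /= susp_circ_pt !susp_layers_map_pt susp_circ_pt lm_circ//.
  by rewrite lm_sign.
- by move=> V v; rewrite /= /susp_one susp_layers_map_pt lm_one.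
- by move=> V v; rewrite /= /susp_one susp_layers_map_pt lm_one.
Qed.

End SuspensionMap.

(** * The layers of H *)

Section SignLayers.
Variable R : realType.
Implicit Types U V W : ips R.

Lemma nat_signs_inner m k (i : 'I_m) (x : signs m) (y : signs k) r :
  (r < k)%N ->
  nat_sign (signs_circ i x y : {ffun _}) (i + r)%N =
  nat_sign (x : {ffun _}) i (+)
    nat_sign (y : {ffun _}) (if nat_sign (x : {ffun _}) i then k.-1 - r
      else r)%N.
Proof.
move=> rk; have -> : (i + r)%N = nat_of_ord (inner i (Ordinal rk)) by [].
rewrite !nat_signE ffunE.
have := block_splitP i (inner i (Ordinal rk)).
case: (block_split _ _) => [s /esym/outer_inner//|r' /inner_inj <-].
case: ((x : {ffun _}) i) => /=; last by rewrite -nat_signE.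
have -> : (k.-1 - r)%N = nat_of_ord (rev_ord (Ordinal rk)) by rewrite /=; lia.
by rewrite nat_signE.
Qed.

Lemma nat_signs_outer m k (i : 'I_m) (x : signs m) (y : signs k) s :
  (s < m)%N -> s <> i ->
  nat_sign (signs_circ i x y : {ffun _}) (out i k s) =
    nat_sign (x : {ffun _}) s.
Proof.
move=> sm si; have : i != Ordinal sm by apply/eqP => /(congr1 val) /esym.
case/unlift_some => s' sE _.
have -> : out i k s = nat_of_ord (outer k i s').
  have {1}-> : s = nat_of_ord (lift i s') by rewrite -sE.
  by rewrite /out /= /bump; case: leqP => ab /=; do !case: ifP; lia.
rewrite nat_signE ffunE; have := block_splitP i (outer k i s').
case: (block_split _ _) => [s2 /outer_inj <-|r /outer_inner//].
by rewrite -sE -nat_signE.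
Qed.

Lemma nat_signs_circ m k (i : 'I_m) (x : signs m) (y : signs k) t :
  (t < (m + k).-1)%N ->
  nat_sign (signs_circ i x y : {ffun _}) t =
  sign_circ i k (nat_sign (x : {ffun _})) (nat_sign (y : {ffun _})) t.
Proof.
case/(outP (ltn_ord i)) => [[r rk ->]|[s [sm si ->]]].
  by rewrite nat_signs_inner// sign_circ_inner.
by rewrite nat_signs_outer// sign_circ_outer.
Qed.

Lemma signs_eqvP V a b (x : signs a) (y : signs b) : a = b ->
  (forall t, (t < a)%N -> nat_sign (x : {ffun _}) t =
    nat_sign (y : {ffun _}) t) ->
  @layer_eqv R (H_layers R) V a b x y.
Proof.
move=> e; case: b / e y => y xy; exists erefl => /=; apply/ffunP => t.
by have := xy t (ltn_ord t); rewrite !nat_signE.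
Qed.

Lemma probe_continuous_discrete (X : discreteTopologicalType)
  (Y : topologicalType) (g : X -> Y) : probe_continuous g.
Proof.
move=> K h _ _ ch; apply: (@continuous_discrete K X Y (fun x _ => g x) h ch).
by move=> x t; exact: cvg_cst.
Qed.

Lemma probe_continuous2_discrete (X Y : discreteTopologicalType)
  (Z : topologicalType) (g : X -> Y -> Z) : probe_continuous2 g.
Proof.
move=> K a b _ _ ca cb.
apply: (@continuous_discrete K X Z (fun x t => g x (b t)) a ca) => x.
apply: (@continuous_discrete K Y Z (fun y _ => g x y) b cb) => y t.
exact: cvg_cst.
Qed.

Lemma signs_circ_disjoint m k l (a b : 'I_m) (a' : 'I_(m + k).-1)
    (b' : 'I_(m + l).-1) V (x : signs m) (y : signs k) (z : signs l) :
  a <> b -> a' = out b k a :> nat -> b' = out a l b :> nat ->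
  @layer_eqv R (H_layers R) V _ _ (signs_circ a' (signs_circ b x y) z)
    (signs_circ b' (signs_circ a x z) y).
Proof.
move=> ab a'E b'E; have am := ltn_ord a; have bm := ltn_ord b.
have {}ab : a <> b :> nat by move=> e; apply: ab; exact: val_inj.
have ba : b <> a :> nat by exact: nesym.
have a'N := ltn_ord a'; have b'N := ltn_ord b'.
apply: signs_eqvP => [|t tN]; first by lia.
have [[r rl ->]|[s [sN si ->]]] := outP a'N tN.
  have b'r : (a + r)%N <> b' by rewrite b'E; exact/nesym/out_neq.
  rewrite nat_signs_inner// {3}a'E -(out_block _ ab rl) -b'E.
  rewrite nat_signs_outer//; last by lia.
  by rewrite nat_signs_inner// a'E nat_signs_outer.
have [[r rk sE]|[u [um ub sE]]] := outP bm sN.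
  rewrite nat_signs_outer// sE nat_signs_inner// a'E (out_block _ ba rk) -b'E.
  by rewrite nat_signs_inner// b'E nat_signs_outer.
have ua : u <> a by move=> ua; apply: si; rewrite sE ua a'E.
rewrite nat_signs_outer// sE nat_signs_outer// a'E (out_out _ _ ab ua ub) -b'E.
have lt' : (out a l u < (m + l).-1)%N by exact: out_lt.
have nb' : out a l u <> b' by rewrite b'E => e; apply: ub; exact: out_inj e.
by rewrite nat_signs_outer// nat_signs_outer.
Qed.

Lemma signs_circ_nested m k l (b : 'I_m) (c : 'I_k) (a : 'I_(m + k).-1)
    V (x : signs m) (y : signs k) (z : signs l) :
  a = (b + (if (x : {ffun _}) b then k.-1 - c else c))%N :> nat ->
  @layer_eqv R (H_layers R) V _ _ (signs_circ a (signs_circ b x y) z)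
    (signs_circ b x (signs_circ c y z)).
Proof.
rewrite -(nat_signE (x : {ffun _})) => aE.
have bm := ltn_ord b; have ck := ltn_ord c; have aN := ltn_ord a.
apply: signs_eqvP => [|t tN]; first by lia.
have [[r rl ->]|[s [sN sa ->]]] := outP aN tN.
  rewrite nat_signs_inner// {1 2}aE nat_signs_inner; last by case: ifP; lia.
  rewrite aE -addnA nat_signs_inner; last by case: ifP; lia.
  case: (nat_sign _ b) => /=; last by rewrite nat_signs_inner.
  (* Under the reversal of the composite block, place r of the block put in at [k.-1 - c] comes from
     place [l.-1 - r] of the block at c; the two reversals of z then cancel or combine. *)
  have -> : ((k + l).-1.-1 - (k.-1 - c + r) = c + (l.-1 - r))%N by lia.
  rewrite nat_signs_inner; last by lia.
  rewrite subKn; last by lia.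
  rewrite subKn; last by lia.
  by rewrite addNb; case: (nat_sign _ c) => /=.
have [[r rk sE]|[u [um ub sE]]] := outP bm sN.
  have rc : r <> (if nat_sign (x : {ffun _}) b then k.-1 - c else c)%N.
    by move=> rc; apply: sa; rewrite sE aE rc.
  rewrite nat_signs_outer// sE nat_signs_inner// aE out_shift//.
  rewrite nat_signs_inner; last by apply: out_lt => //; case: ifP; lia.
  case: (nat_sign _ b) rc => /= rc; last by rewrite nat_signs_outer.
  have -> : ((k + l).-1.-1 - out (k.-1 - c) l r = out c l (k.-1 - r))%N.
    by rewrite /out; do !case: ifP; lia.
  by rewrite nat_signs_outer//; lia.
rewrite nat_signs_outer// sE nat_signs_outer// aE out_nested//;
  last by case: ifP; lia.
by rewrite nat_signs_outer.
Qed.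

Lemma H_is_layers : is_layers (H_layers R).
Proof.
split=> //=.
- move=> j V W K a b cK hK ca cb t; exact: cb.
- by move=> m k i V W; exact: probe_continuous2_discrete.
- by move=> j V r; exact: probe_continuous_discrete.
- by move=> m k i V W x y t; rewrite -nat_signs_circ// nat_signE.
- by move=> j V r; rewrite ffunE.
- by move=> V x; apply/ffunP => -[].
- by move=> *; exact: signs_circ_disjoint.
- by move=> *; exact: signs_circ_nested.
- move=> m i V W x; apply: signs_eqvP => [|t tN]; first by lia.
  have [[[|//] _ ->]|[s [sm si ->]]] := outP (ltn_ord i) tN.
    rewrite nat_signs_inner// addn0 subn0 if_same.
    by rewrite -[0%N]/(nat_of_ord (@ord0 0)) [X in _ (+) X]nat_signE
      ffunE addbF.
  by rewrite nat_signs_outer// out1.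
- move=> k i V W y; apply: signs_eqvP => // t tk.
  have i0 : i = 0%N :> nat by rewrite ord1.
  have tE : t = (i + t)%N by rewrite i0.
  have := @nat_signs_inner 1 k i [ffun => false] y t tk.
  by rewrite nat_signE ffunE addFb -tE.
Qed.

End SignLayers.

(** * Words *)

(* Elements of D_n(j; V) are handled through words whose places are natural
   numbers, so that words of different arities can be compared. *)
Section Words.
Local Open Scope nat_scope.
Variable T : Type.
Implicit Types (u v w z : seq (T * nat)) (phi : T).

Definition bar (i k r : nat) : nat :=
  if i <= r < k + i then k + 2 * i - 1 - r else r.

Definition relabel (p : nat -> nat) u : seq (T * nat) :=
  [seq (g.1, p g.2) | g <- u].

Definition block phi (i k : nat) : seq (T * nat) :=
  [seq (phi, i + q) | q <- rev (iota 0 k)].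

(** The action of a letter before any relation is imposed; [out] merges the cases of a letter to the
    left and to the right of i. *)
Definition word_act1 (k i : nat) (g : T * nat) z : seq (T * nat) :=
  if g.2 == i then block g.1 i k ++ relabel (bar i k) z
  else (g.1, out i k g.2) :: z.

Definition word_act (k i : nat) u z : seq (T * nat) :=
  foldr (word_act1 k i) z u.

(** Since [dgen] is 1 outside the range of places, only letters within it denote generators;
    [boundedP] recovers a word in X. *)
Definition bounded (N : nat) u : bool := all (fun g => g.2 < N) u.

Definition word_sign u (t : nat) : bool := odd (count (fun g => g.2 == t) u).

Lemma barK i k : involutive (bar i k).
Proof.
by move=> r; rewrite /bar; case h : (i <= r < k + i);
  [rewrite ifT; lia|rewrite h].
Qed.

Lemma relabel_cat p u v : relabel p (u ++ v) = relabel p u ++ relabel p v.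
Proof. exact: map_cat. Qed.

Lemma relabel_comp p q u : relabel p (relabel q u) = relabel (p \o q) u.
Proof. by rewrite /relabel -map_comp. Qed.

Lemma eq_relabel p q u : p =1 q -> relabel p u = relabel q u.
Proof. by move=> pq; apply: eq_map => g; rewrite pq. Qed.

Lemma eq_relabel_bounded N p q u : bounded N u ->
  (forall r, r < N -> p r = q r) -> relabel p u = relabel q u.
Proof.
move=> + pq; elim: u => [//|g u IH] /= /andP[gN uN].
by rewrite /= pq// IH.
Qed.

Lemma relabel_block p phi i j k : (forall q, q < k -> p (i + q) = j + q) ->
  relabel p (block phi i k) = block phi j k.
Proof.
move=> pE; rewrite /relabel /block -map_comp; apply/eq_in_map => q.
by rewrite mem_rev mem_iota => /pE /= ->.
Qed.

Lemma block_cat phi i k l : block phi i (k + l) =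
  block phi (i + k) l ++ block phi i k.
Proof.
rewrite /block iotaD rev_cat map_cat add0n; congr (_ ++ _).
rewrite -[in LHS](addn0 k) iotaDl -map_rev -map_comp; apply: eq_map => q /=.
by rewrite addnA.
Qed.

Lemma word_act_cat k i u v z :
  word_act k i (u ++ v) z = word_act k i u (word_act k i v z).
Proof. exact: foldr_cat. Qed.

Lemma word_act_out k i u z : all (fun g => g.2 != i) u ->
  word_act k i u z = relabel (out i k) u ++ z.
Proof.
elim: u => [//|g u IH] /= /andP[/negbTE gi /IH ->].
by rewrite /word_act1 gi.
Qed.

Lemma all_block (P : pred nat) phi i k : (forall q, q < k -> P (i + q)) ->
  all (fun g => P g.2) (block phi i k).
Proof.
move=> Pi; rewrite /block all_map; apply/allP => q.
by rewrite mem_rev mem_iota => /Pi.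
Qed.

Lemma all_relabel (P : pred nat) p u :
  all (fun g => P g.2) (relabel p u) = all (fun g => P (p g.2)) u.
Proof. by rewrite /relabel all_map. Qed.

Lemma bounded_block N phi i k : i + k <= N -> bounded N (block phi i k).
Proof. by move=> ikN; apply: (all_block (P := fun r => r < N)) => q qk; lia.
Qed.

Lemma bounded_relabel N M p u : (forall r, r < M -> p r < N) ->
  bounded M u -> bounded N (relabel p u).
Proof.
move=> pN; rewrite /bounded (all_relabel (fun r => r < N)); elim: u =>
  [//|g u IH] /= /andP[gM uM].
by rewrite pN ?IH.
Qed.

Lemma bounded_act m k i u z : i < m -> bounded m u -> bounded (m + k).-1 z ->
  bounded (m + k).-1 (word_act k i u z).
Proof.
move=> im + zN; elim: u => [//|[phi r] u IH] /= /andP[/= rm um].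
rewrite /word_act1 /=; case: eqVneq => [_|ri]; last first.
  by rewrite /= IH// andbT out_lt//; exact/eqP.
rewrite /bounded all_cat -!/(bounded _ _) bounded_block; last by lia.
apply: bounded_relabel (IH um) => q; rewrite /bar; case: ifP; lia.
Qed.

Lemma bounded_shift m k i v : i < m -> bounded k v ->
  bounded (m + k).-1 (relabel (addn i) v).
Proof. by move=> im; apply: (bounded_relabel (M := k)) => r; lia. Qed.

Section Disjoint.
Variables (k l a b : nat).
Hypothesis ab : a <> b.
Let a' := out b k a.
Let b' := out a l b.

Lemma bar_out_disjoint r : r <> a' -> out a' l (bar b k r) =
  bar b' k (out a' l r).
Proof. by rewrite /a' /b' /bar /out; do !case: ifP; lia. Qed.

Lemma bar_comm r : bar a' l (bar b' k r) = bar b' k (bar a' l r).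
Proof. by rewrite /a' /b' /bar /out; do !case: ifP; lia. Qed.

Lemma bar_block q : q < l -> bar b' k (a' + q) = a' + q.
Proof. by rewrite /a' /b' /bar /out; do !case: ifP; lia. Qed.

Lemma bar_eq r : (bar b k r == a') = (r == a').
Proof. by rewrite /a' /bar /out; do !case: ifP; lia. Qed.

(** Reversing the block at b keeps the place [a'] and every place of the block put in there, so it
    commutes with the insertion. *)
Lemma word_act_bar u z :
  word_act l a' (relabel (bar b k) u) (relabel (bar b' k) z) =
  relabel (bar b' k) (word_act l a' u z).
Proof.
elim: u => [//|[phi r] u IH] /=; rewrite /word_act1 /= bar_eq IH.
case: eqVneq => [_|/eqP ra]; last by rewrite /= bar_out_disjoint.
rewrite relabel_cat (@relabel_block _ _ _ (a') _); last exact: bar_block.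
by rewrite !relabel_comp; congr (_ ++ _); apply: eq_relabel => q;
  exact: bar_comm.
Qed.

(* The action of a letter after both of the places a and b have been replaced,
   by l and k places respectively. *)
Definition word_act2 (g : T * nat) z : seq (T * nat) :=
  if g.2 == a then block g.1 a' l ++ relabel (bar a' l) z
  else if g.2 == b then block g.1 b' k ++ relabel (bar b' k) z
  else (g.1, out a' l (out b k g.2)) :: z.

(** Letters of u at b create blocks that the second insertion only relabels. The result is symmetric
    in the two insertions except that v precedes w. *)
Lemma word_act_act u v w : bounded k v -> bounded l w ->
  word_act l a' (word_act k b u (relabel (addn b) v)) (relabel (addn a') w) =
  foldr word_act2 (relabel (addn b') v ++ relabel (addn a') w) u.
Proof.
move=> vk wl.
have barw : relabel (bar b' k) (relabel (addn a') w) = relabel (addn a') w.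
  rewrite relabel_comp; apply: eq_relabel_bounded wl _ => r; exact: bar_block.
have ab' : b <> a by exact: nesym.
elim: u => [|[phi r] u IH] /=.
  rewrite word_act_out.
    rewrite relabel_comp; congr (_ ++ _); apply: eq_relabel_bounded vk _ =>
      r rk /=.
    exact: out_block.
  rewrite (all_relabel (fun r => r != a')); elim: v vk => [//|g v IH] /=.
  move=> /andP[gk /IH ->]; rewrite andbT; apply/eqP.
  exact/nesym/out_neq.
rewrite {1}/word_act1 /word_act2 /=.
case: (eqVneq r b) => [->|rb].
  rewrite ifF; last by apply/eqP; exact: nesym.
  (* The word w is its own image under the reversal at b, which brings the goal into the form of
     [word_act_bar]. *)
  rewrite word_act_cat -{1}barw word_act_bar IH word_act_out; last first.
    by apply: (all_block (P := fun r => r != a')) => q qk; apply/eqP;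
      exact/nesym/out_neq.
  by rewrite (@relabel_block _ _ _ (b') _)// => q qk; exact: out_block.
case: (eqVneq r a) => [->|ra] /=; rewrite {1}/word_act1 /= -/a' ?eqxx ?IH//.
rewrite ifF//; apply/eqP => e; move/eqP: ra; apply.
by apply: (@out_inj b k); [exact/eqP|exact: nesym|].
Qed.

(** The prefix and the relabelling do not depend on z, so an exchange of v and w within z survives
    the action of u. Injectivity keeps distinct places distinct. *)
Lemma word_act2_relabel u : exists P p, injective p /\
  forall z, foldr word_act2 z u = P ++ relabel p z.
Proof.
elim: u => [|[phi r] u [P [p [pI IH]]]].
  by exists [::], id; split => // z; rewrite /= /relabel -[LHS]map_id;
    apply: eq_map => -[].
have barI i j : injective (bar i j) by apply: can_inj; exact: barK.
have [ra|ra] := boolP (r == a).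
  exists (block phi a' l ++ relabel (bar a' l) P), (bar a' l \o p).
  split=> [|z]; first exact: inj_comp.
  by rewrite /= /word_act2 /= ra IH relabel_cat relabel_comp catA.
have [rb|rb] := boolP (r == b).
  exists (block phi b' k ++ relabel (bar b' k) P), (bar b' k \o p).
  split=> [|z]; first exact: inj_comp.
  by rewrite /= /word_act2 /= (negbTE ra) rb IH relabel_cat relabel_comp catA.
exists ((phi, out a' l (out b k r)) :: P), p; split => // z.
by rewrite /= /word_act2 /= (negbTE ra) (negbTE rb) IH.
Qed.

End Disjoint.

Lemma word_act2C k l a b u z : a <> b ->
  foldr (word_act2 l k b a) z u = foldr (word_act2 k l a b) z u.
Proof.
move=> ab; elim: u => [//|[phi r] u /= ->]; rewrite /word_act2 /=.
case: (eqVneq r b) => [->|rb].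
  by rewrite ifF//; apply/eqP; exact: nesym.
case: (eqVneq r a) => [//|ra]; congr ((_, _) :: _).
by apply/esym/out_out => //; exact/eqP.
Qed.

Lemma word_act_shift l b c v z :
  word_act l (b + c) (relabel (addn b) v) (relabel (addn b) z) =
  relabel (addn b) (word_act l c v z).
Proof.
elim: v => [//|[phi r] v IH] /=; rewrite /word_act1 /= IH eqn_add2l.
case: eqVneq => [_|rc]; last by rewrite /= out_shift//; exact/eqP.
rewrite relabel_cat (@relabel_block _ _ _ (b + c) _); last by move=> q _;
  rewrite addnA.
rewrite !relabel_comp; congr (_ ++ _); apply: eq_relabel => q /=.
by rewrite /bar; do !case: ifP; lia.
Qed.

Section Nested.
Variables (k l b : nat).
Let K := (k + l).-1.

(** A block of k letters meets the place of insertion once. Cut into c, 1 and k - c - 1 letters, it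
    becomes three adjacent blocks that join into the large one. *)
Lemma word_act_block c phi z : c < k ->
  word_act l (b + c) (block phi b k) z =
  block phi b K ++ relabel (bar (b + c) l) z.
Proof.
move=> ck; have -> : k = c + (1 + (k - c.+1)) by lia.
have -> : K = c + (l + (k - c.+1)) by rewrite /K; lia.
rewrite !block_cat -!catA !word_act_cat.
have -> : word_act l (b + c) (block phi b c) z = block phi b c ++ z.
  rewrite word_act_out.
    by rewrite (@relabel_block _ _ _ (b) _)// => q qc; rewrite /out ifT//; lia.
  by apply: (all_block (P := fun r => r != b + c)) => q qc; apply/eqP; lia.
have -> y : word_act l (b + c) (block phi (b + c) 1) y =
    block phi (b + c) l ++ relabel (bar (b + c) l) y.
  by rewrite /= /word_act1 /= addn0 eqxx.
rewrite relabel_cat (@relabel_block _ _ _ (b) _); last first.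
  by move=> q qc; rewrite /bar ifF//; lia.
rewrite word_act_out.
  rewrite (@relabel_block _ _ _ (b + c + l) _)// => q qc.
  by rewrite /out ifF; lia.
by apply: (all_block (P := fun r => r != b + c)) => q qc; apply/eqP; lia.
Qed.

Section Mirror.
Variable c : nat.
Hypothesis ck : c < k.
Let a' := b + c.
Let a := b + (k.-1 - c).
(* Reverses the large block but keeps the order inside the inner one. *)
Let delta r := bar a l (bar b K r).

Lemma delta_block q : q < l -> delta (a' + q) = a + q.
Proof. by rewrite /delta /a /a' /bar /K; do !case: ifP; lia. Qed.

Lemma delta_bar r : delta (bar a' l r) = bar a l (delta r).
Proof.
have -> : bar a l (delta r) = bar b K r by exact: barK.
by rewrite /delta /a /a' /bar /K; do !case: ifP; lia.
Qed.

Lemma delta_out r : r <> a' -> delta (out a' l r) = out a l (bar b k r).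
Proof. by rewrite /delta /a /a' /bar /K /out; do !case: ifP; lia. Qed.

Lemma bar_mirror r : (bar b k r == a) = (r == a').
Proof. by rewrite /a /a' /bar; case: ifP; lia. Qed.

(** Reversing the outer block moves the place of insertion to its mirror image; [delta] is the
    corresponding relabelling of the composite block. *)
Lemma word_act_mirror u z :
  word_act l a (relabel (bar b k) u) (relabel delta z) =
  relabel delta (word_act l a' u z).
Proof.
elim: u => [//|[phi r] u IH] /=; rewrite /word_act1 /= bar_mirror IH.
case: eqVneq => [_|ra]; last by rewrite /= delta_out//; exact/eqP.
rewrite relabel_cat (@relabel_block _ _ _ (a) _); last exact: delta_block.
by rewrite !relabel_comp; congr (_ ++ _); apply: eq_relabel => q /=;
  rewrite delta_bar.
Qed.

End Mirror.

(** This is an equality of words, without relations. Each letter of u at b flips the sign and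
    reverses the large block, that is, it mirrors the place of w in the outer block and reverses the
    block of w. *)
Lemma word_act_nested c u v w : c < k -> bounded l w ->
  let a := b + (if word_sign u b then k.-1 - c else c) in
  word_act l a (word_act k b u (relabel (addn b) v)) (relabel (addn a) w) =
  word_act K b u (relabel (addn b) (word_act l c v (relabel (addn c) w))).
Proof.
move=> ck wl; elim: u => [|[phi r] u] /=.
  rewrite -word_act_shift relabel_comp; congr word_act.
  by apply: eq_relabel => q /=; rewrite addnA.
rewrite /word_sign /= oddD -/(word_sign u b) => IH.
rewrite /word_act1 /=; case: (eqVneq r b) => [_|rb] /=; last first.
  rewrite {1}/word_act1 /= IH; set a := b + _.
  have ca : (if word_sign u b then k.-1 - c else c) < k by case: ifP; lia.
  rewrite ifF; last by apply/eqP; exact/out_neq/ca/eqP.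
  by rewrite out_nested//; exact/eqP.
(* The place belonging to the remaining letters; the letter at b sends it to its mirror image
   [k.-1 - c']. *)
set c' := if word_sign u b then k.-1 - c else c in IH.
have c'k : c' < k by rewrite /c'; case: ifP; lia.
have -> : (if ~~ word_sign u b then k.-1 - c else c) = k.-1 - c'.
  by rewrite /c'; case: (word_sign u b) => /=; lia.
rewrite word_act_cat word_act_block; last by lia.
congr (_ ++ _).
have -> : relabel (addn (b + (k.-1 - c'))) w =
    relabel (fun r => bar (b + (k.-1 - c')) l (bar b K r))
      (relabel (addn (b + c')) w).
  rewrite relabel_comp; apply: eq_relabel_bounded wl _ => q ql /=.
  exact/esym/delta_block.
(* The reversal of the inner block cancels the one contained in [delta], and the reversal of the
   large block remains. *)
rewrite word_act_mirror// IH relabel_comp; apply: eq_relabel => q.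
exact: barK.
Qed.

End Nested.

Lemma word_act1_id i u : word_act 1 i u [::] = u.
Proof.
elim: u => [//|[phi r] u IH] /=; rewrite {1}/word_act1 /= IH.
case: eqVneq => [->|ri]; last by rewrite out1//; exact/eqP.
rewrite /block /= addn0; congr (_ :: _); rewrite -[RHS]map_id.
by apply: eq_map => -[psi q]; rewrite /bar /=; case: ifP => // qi;
  congr pair; lia.
Qed.

Lemma word_sign_cons g u t : word_sign (g :: u) t =
  (g.2 == t) (+) word_sign u t.
Proof. by rewrite /word_sign /= oddD; case: (_ == t). Qed.

Lemma word_sign_cat u v t : word_sign (u ++ v) t =
  word_sign u t (+) word_sign v t.
Proof. by rewrite /word_sign count_cat oddD. Qed.

Lemma word_sign_relabel p q u t : (forall r, (p r == t) = (r == q)) ->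
  word_sign (relabel p u) t = word_sign u q.
Proof.
move=> pq; rewrite /word_sign count_map (@eq_count _ _ (fun g => g.2 == q))//.
move=> g; exact: pq.
Qed.

Lemma word_sign_block phi i k r : r < k -> word_sign (block phi i k) (i + r).
Proof.
move=> rk; rewrite /word_sign /block count_map.
rewrite (eq_count (a2 := pred1 r)); last by move=> q /=; rewrite eqn_add2l.
by rewrite count_uniq_mem ?rev_uniq ?iota_uniq// mem_rev mem_iota /= add0n rk.
Qed.

Lemma word_sign_all u t : all (fun g => g.2 != t) u -> word_sign u t = false.
Proof.
by move=> ut; rewrite /word_sign (_ : count _ _ = 0)//; elim: u ut =>
  [//|g u IH] /=
  /andP[/negbTE -> /IH ->].
Qed.

(** A letter at i puts one letter on every place of the block and reverses what was there, so the
    parity of such letters decides both the added sign and the mirroring. *)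
Lemma word_sign_act_inner k i u z r : r < k ->
  word_sign (word_act k i u z) (i + r) =
  word_sign u i (+) word_sign z (i + (if word_sign u i then k.-1 - r else r)).
Proof.
elim: u r => [//|[phi s] u IH] r rk /=.
rewrite /word_act1 !word_sign_cons /=.
case: (eqVneq s i) => [_|/eqP si] /=.
  rewrite word_sign_cat word_sign_block//.
  rewrite (@word_sign_relabel _ (i + (k.-1 - r))); last first.
    by move=> q; rewrite /bar; case: ifP; lia.
  rewrite IH; last by lia.
  by case: (word_sign u i) => //=; rewrite subKn//; lia.
rewrite word_sign_cons /= (negbTE (_ : out i k s != i + r)); last first.
  by apply/eqP/out_neq.
exact: IH.
Qed.

Lemma word_sign_act_outer k i u z s : s <> i ->
  word_sign (word_act k i u z) (out i k s) =
  word_sign u s (+) word_sign z (out i k s).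
Proof.
move=> si; elim: u => [//|[phi r] u IH] /=.
rewrite /word_act1 word_sign_cons -addbA /=.
case: (eqVneq r i) => [->|/eqP ri] /=.
  rewrite word_sign_cat word_sign_all; last first.
    apply: (all_block (P := fun t => t != out i k s)) => q qk; apply/eqP.
    exact/nesym/out_neq.
  rewrite (@word_sign_relabel _ (out i k s)) ?IH.
    by rewrite (negbTE (_ : i != s))//; apply/eqP; exact: nesym.
  by move=> q; rewrite /bar /out; do !case: ifP; lia.
rewrite word_sign_cons /= IH; congr (_ (+) _).
by apply/eqP/eqP => [/out_inj|->//]; apply.
Qed.

End Words.

Lemma map_word_act (S T : Type) (f : S -> T) k i (u z : seq (S * nat)) :
  [seq (f g.1, g.2) | g <- word_act k i u z] =
  word_act k i [seq (f g.1, g.2) | g <- u] [seq (f g.1, g.2) | g <- z].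
Proof.
elim: u => [//|[phi r] u IH] /=; rewrite /word_act1 /= -IH; case: ifP => //= _.
rewrite map_cat /block -!map_comp; congr (_ ++ _).
by rewrite /relabel -!map_comp.
Qed.

(** * The layers of D_n *)

Section Dwords.
Context {R : realType}.
Variable n : nat.
Implicit Types U V W : ips R.
Local Notation letters V := (seq (emb (std n) V * nat)).

Definition eval_word N V (u : letters V) : dgrp n N V :=
  (\big[*%g/1%g]_(g <- u) dgen N g.1 g.2)%g.

Definition emb_word V W (f : emb V W) (u : letters V) : letters W :=
  [seq (emb_comp f g.1, g.2) | g <- u].

Definition nat_word N V (u : seq (gen n N V)) : letters V :=
  [seq (g.1, nat_of_ord (g.2 : 'I_N)) | g <- u].

Lemma eval_cons N V g (u : letters V) :
  eval_word N (g :: u) = (dgen N g.1 g.2 * eval_word N u)%g.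
Proof. by rewrite /eval_word big_cons. Qed.

Lemma eval_cat N V (u v : letters V) : eval_word N (u ++ v) =
  (eval_word N u * eval_word N v)%g.
Proof. exact: big_cat. Qed.

Lemma word_cons N V g (u : seq (gen n N V)) :
  word (g :: u) = (dgen N g.1 (g.2 : 'I_N) * word u)%g.
Proof. by rewrite dgen_ord [RHS]dmulE; case: g. Qed.

Lemma eval_nat_word N V (u : seq (gen n N V)) : eval_word N (nat_word u)
  = word u.
Proof.
elim: u => [|g u IH]; first by rewrite /eval_word big_nil.
by rewrite word_cons /= eval_cons IH.
Qed.

Lemma bounded_nat_word N V (u : seq (gen n N V)) : bounded N (nat_word u).
Proof. by elim: u => [//|g u IH] /=; rewrite ltn_ord. Qed.

Lemma boundedP N V (u : letters V) : bounded N u -> exists u' : seq (gen n N V),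
  u = nat_word u'.
Proof.
elim: u => [_|[phi r] u IH /= /andP[rN /IH[u' ->]]]; first by exists [::].
by exists ((phi, Ordinal rN) :: u').
Qed.

Lemma evalP N V (x : dgrp n N V) : exists2 u, bounded N u & x = eval_word N u.
Proof.
exists (nat_word (Defs.letters x)); first exact: bounded_nat_word.
by rewrite eval_nat_word lettersK.
Qed.

Lemma dgrp_mapM j V W (f : emb V W) :
  {morph dgrp_map (n := n) (j := j) f : x y / (x * y)%g}.
Proof.
apply: dgrp_homM => [phi r|phi psi r s p _ _ rs]; first exact: dgen_invol.
by apply: dgen_comm rs; exact: perp_comp.
Qed.

Lemma dgrp_map1 j V W (f : emb V W) : dgrp_map f (1%g : dgrp n j V) = 1%g.
Proof. by rewrite -[1%g]/(word [::]) dgrp_mapE big_nil. Qed.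

Lemma dgrp_map_eval N V W (f : emb V W) (u : letters V) :
  dgrp_map f (eval_word N u) = eval_word N (emb_word f u).
Proof.
elim: u => [|[phi r] u IH]; first by rewrite /eval_word !big_nil dgrp_map1.
rewrite eval_cons dgrp_mapM IH /= eval_cons; congr (_ * _)%g => /=.
rewrite {1}/dgen /=; case: insubP => [r' _ rE|rN].
  by rewrite dgrp_mapE big_seq1 rE.
by rewrite dgrp_map1 /dgen insubN.
Qed.

Section Circ.
Variables (m k : nat) (i : 'I_m) (V : ips R).

Lemma dshift_eval (v : letters V) : bounded k v ->
  dshift i (eval_word k v) = eval_word _ (relabel (addn i) v).
Proof.
case/boundedP => v' ->; rewrite eval_nat_word dshiftE.
by rewrite /eval_word /relabel /nat_word !big_map.
Qed.

Lemma dbar_eval (z : letters V) :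
  dbar (k := k) i (eval_word _ z) = eval_word _ (relabel (bar i k) z).
Proof.
elim: z => [|g z IH]; first by rewrite /eval_word !big_nil dbar1.
by rewrite eval_cons dbarM IH dbar_gen /= eval_cons.
Qed.

Lemma dblock_eval (phi : emb (std n) V) :
  dblock k i phi = eval_word (m + k).-1 (block phi i k).
Proof.
rewrite /dblock /eval_word /block big_map -[in LHS](addn0 i) iotaDl -map_rev
  big_map.
by [].
Qed.

Lemma dact_eval (u z : letters V) : bounded m u ->
  dact i (eval_word m u) (eval_word _ z) =
    eval_word (m + k).-1 (word_act k i u z).
Proof.
case/boundedP => u' ->; rewrite eval_nat_word dactE.
elim: u' => [//|[phi r] u' IH] /=;
  rewrite IH /dact1 /word_act1 /= -/(nat_word u').
rewrite /out; case: ltngtP => ri; rewrite ?eval_cons//.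
by rewrite dblock_eval dbar_eval eval_cat.
Qed.

End Circ.

Definition word_circ k i V W (u : letters V) (v : letters W) : letters
  (V ⊕ W) :=
  word_act k i (emb_word (emb_inl V W) u)
    (relabel (addn i) (emb_word (emb_inr V W) v)).

Lemma bounded_emb_word N V W (f : emb V W) (u : letters V) :
  bounded N (emb_word f u) = bounded N u.
Proof. by rewrite /bounded all_map. Qed.

Lemma dcirc_eval m k (i : 'I_m) V W (u : letters V) (v : letters W) :
  bounded m u -> bounded k v ->
  dcirc i (eval_word m u) (eval_word k v) =
    eval_word (m + k).-1 (word_circ k i u v).
Proof.
move=> um vk; rewrite /dcirc !dgrp_map_eval dshift_eval ?bounded_emb_word//.
by rewrite dact_eval ?bounded_emb_word.
Qed.

Lemma bounded_word_circ m k (i : 'I_m) V W (u : letters V) (v : letters W) :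
  bounded m u -> bounded k v -> bounded (m + k).-1 (word_circ k i u v).
Proof.
move=> um vk; apply: bounded_act; rewrite ?bounded_emb_word//.
by apply: bounded_shift; rewrite ?bounded_emb_word.
Qed.

Lemma emb_word_comp U V W (g : emb V W) (f : emb U V) (u : letters U) :
  emb_word g (emb_word f u) = emb_word (emb_comp g f) u.
Proof. by rewrite /emb_word -map_comp; apply: eq_map => -[phi r] /=; congr pair;
  exact: embP. Qed.

Lemma emb_word_relabel V W (f : emb V W) p (u : letters V) :
  emb_word f (relabel p u) = relabel p (emb_word f u).
Proof. by rewrite /emb_word /relabel -!map_comp. Qed.

Lemma emb_word_act V W (f : emb V W) k i (u z : letters V) :
  emb_word f (word_act k i u z) = word_act k i (emb_word f u) (emb_word f z).
Proof. exact: (map_word_act (emb_comp f)). Qed.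

Lemma dsign_eval N V (u : letters V) (r : 'I_N) : bounded N u ->
  dsign (eval_word N u) r = word_sign u r.
Proof.
case/boundedP => u' ->; rewrite eval_nat_word dsignE /word_sign count_map.
by congr odd; apply: eq_count => g /=.
Qed.

(** Every letter of v passes every letter of w by the commutation relation: the images are
    orthogonal and the places distinct. *)
Lemma eval_commute N U V W (f : emb V U) (g : emb W U) k l
    (v : letters V) (w : letters W) (p q : nat -> nat) :
  bounded k v -> bounded l w -> (forall x y, dotp (f x) (g y) = 0) ->
  (forall r s, (r < k)%N -> (s < l)%N -> p r <> q s) ->
  eval_word N (relabel p (emb_word f v) ++ relabel q (emb_word g w)) =
  eval_word N (relabel q (emb_word g w) ++ relabel p (emb_word f v)).
Proof.
move=> + + fg pq; rewrite !eval_cat.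
elim: v => [|[phi r] v IH] /=;
  first by rewrite {1 4}/eval_word !big_nil mul1g mulg1.
move=> /andP[rk vk] wl; rewrite eval_cons -mulgA IH// !mulgA; congr (_ * _)%g.
elim: w wl {IH} => [|[psi s] w IH] /=;
  first by rewrite /eval_word big_nil mul1g mulg1.
move=> /andP[sl wl]; rewrite !eval_cons !mulgA /= dgen_comm; first last.
- exact: pq.
- by move=> x y /=; exact: fg.
by rewrite -!mulgA IH.
Qed.

Lemma layer_eqv_eval V a b (u v : letters V) : a = b ->
  eval_word a u = eval_word a v ->
    @layer_eqv R (D_layers n) V a b (eval_word a u) (eval_word b v).
Proof. by move=> e; case: b / e => uv; exists erefl. Qed.

Lemma dcirc_disjoint m k l (a b : 'I_m) (a' : 'I_(m + k).-1)
    (b' : 'I_(m + l).-1) U V W (x : dgrp n m U) (y : dgrp n k V)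
    (z : dgrp n l W) :
  a <> b -> a' = out b k a :> nat -> b' = out a l b :> nat ->
  @layer_eqv R (D_layers n) _ _ _ (dcirc a' (dcirc b x y) z)
    (dgrp_map (liso_swap23 U W V) (dcirc b' (dcirc a x z) y)).
Proof.
move=> ab a'E b'E; have aN := ltn_ord a'; have bN := ltn_ord b'.
have {}ab : a <> b :> nat by move=> e; apply: ab; exact: val_inj.
have ba : b <> a :> nat by exact: nesym.
have [u um ->] := evalP x; have [v vk ->] := evalP y; have [w wl ->] := evalP z.
rewrite !dcirc_eval ?bounded_word_circ// dgrp_map_eval.
apply: layer_eqv_eval; first by lia.
rewrite /word_circ !(emb_word_act, emb_word_relabel, emb_word_comp).
rewrite a'E b'E.
rewrite (@word_act_act _ k l a b)// ?bounded_emb_word//.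
rewrite (@word_act_act _ l k b a)// ?bounded_emb_word//
  (@word_act2C _ k l a b)//.
set u1 := emb_word _ u; set u2 := emb_word _ u.
have -> : u2 = u1 by congr emb_word; exact: embP.
set w1 := emb_word _ w; set w2 := emb_word _ w.
have -> : w2 = w1 by congr emb_word; exact: embP.
set v1 := emb_word _ v; set v2 := emb_word _ v.
have -> : v2 = v1 by congr emb_word; exact: embP.
have [P [p [pI pE]]] := word_act2_relabel k l a b u1.
(* The prefix P, produced by u, is common to both sides; what is left is v and w in opposite
   orders. *)
rewrite !pE !eval_cat; congr (_ * _)%g.
rewrite !relabel_cat !relabel_comp.
apply: (eval_commute _ vk wl) => [c d|r s rk sl /=].
  by rewrite /dotp /= /dsum_dot /= /dotp /= /dsum_dot /= /dotp /= !linear0l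
    !linear0r !addr0.
move=> /pI; rewrite -(out_block _ ba rk); apply: out_neq => //.
exact/nesym/out_neq.
Qed.

Lemma dcirc_nested m k l (b : 'I_m) (c : 'I_k) (a : 'I_(m + k).-1)
    U V W (x : dgrp n m U) (y : dgrp n k V) (z : dgrp n l W) :
  a = (b + (if dsign x b then k.-1 - c else c))%N :> nat ->
  @layer_eqv R (D_layers n) _ _ _
    (dgrp_map (liso_assoc U V W) (dcirc a (dcirc b x y) z))
    (dcirc b x (dcirc c y z)).
Proof.
have [u um ->] := evalP x; have [v vk ->] := evalP y; have [w wl ->] := evalP z.
rewrite dsign_eval// => aE; have aN := ltn_ord a; have ck := ltn_ord c.
rewrite !dcirc_eval ?bounded_word_circ// dgrp_map_eval.
apply: layer_eqv_eval; first by have := ltn_ord b; lia.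
congr eval_word; rewrite /word_circ
  !(emb_word_act, emb_word_relabel, emb_word_comp).
set u1 := emb_word _ u; set u2 := emb_word _ u.
have <- : u1 = u2 by congr emb_word; exact: embP.
set w1 := emb_word _ w; set w2 := emb_word _ w.
have <- : w1 = w2 by congr emb_word; exact: embP.
set v1 := emb_word _ v; set v2 := emb_word _ v.
have <- : v1 = v2 by congr emb_word; exact: embP.
have sgE : word_sign u b = word_sign u1 b by rewrite /word_sign /u1 count_map.
by rewrite aE sgE word_act_nested// bounded_emb_word.
Qed.

Lemma dcirc_map m k (i : 'I_m) V V' W W' (f : emb V V') (g : emb W W')
    (x : dgrp n m V) (y : dgrp n k W) :
  dcirc i (dgrp_map f x) (dgrp_map g y) = dgrp_map (emb_dsum f g) (dcirc i x y).
Proof.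
have [u um ->] := evalP x; have [v vk ->] := evalP y.
rewrite dcirc_eval// !dgrp_map_eval dcirc_eval ?bounded_emb_word//.
rewrite /word_circ !(emb_word_act, emb_word_relabel, emb_word_comp).
have emb0 (A B : ips R) (h : emb A B) : h 0 = 0.
  by rewrite -(subrr (0 : A)) embB subrr.
congr eval_word; congr word_act; [|congr relabel]; congr emb_word;
  apply: embP => t;
  by congr pair; rewrite /= emb0.
Qed.

Lemma dsign_map j V W (f : emb V W) (x : dgrp n j V) r :
  dsign (dgrp_map f x) r = dsign x r.
Proof.
have [u um ->] := evalP x.
by rewrite dgrp_map_eval !dsign_eval ?bounded_emb_word// /word_sign count_map.
Qed.

Lemma nat_sign_dsign N V (u : letters V) t : bounded N u -> (t < N)%N ->
  nat_sign (dsign (eval_word N u)) t = word_sign u t.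
Proof.
move=> uN tN; rewrite -[t]/(nat_of_ord (Ordinal tN)) nat_signE.
exact: dsign_eval.
Qed.

Lemma dsign_circ m k (i : 'I_m) V W (x : dgrp n m V) (y : dgrp n k W) t :
  dsign (dcirc i x y) t =
  sign_circ i k (nat_sign (dsign x)) (nat_sign (dsign y)) t.
Proof.
have [u um ->] := evalP x; have [v vk ->] := evalP y.
rewrite dcirc_eval// dsign_eval ?bounded_word_circ// /word_circ.
have signE (X Y : ips R) (h : emb X Y) (a : letters X) s :
    word_sign (emb_word h a) s = word_sign a s.
  by rewrite /word_sign count_map.
have im := ltn_ord i.
have [[r rk ->]|[s [sm si ->]]] := outP im (ltn_ord t).
  rewrite word_sign_act_inner// sign_circ_inner// signE nat_sign_dsign//.
  rewrite (@word_sign_relabel _ _ (if word_sign u i then k.-1 - r else r)%N).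
    by rewrite signE nat_sign_dsign//; case: ifP; lia.
  by move=> q; rewrite eqn_add2l.
rewrite word_sign_act_outer// sign_circ_outer// signE nat_sign_dsign//.
rewrite (word_sign_all (u := relabel _ _)) ?addbF// all_map /=.
elim: v vk => [//|[phi q] v IH] /= /andP[qk /IH ->]; rewrite andbT.
exact/eqP/nesym/out_neq.
Qed.

End Dwords.

(** * The topology of D_n *)

Section DgrpTopology.
Context {R : realType}.
Variable n : nat.
Implicit Types U V W : ips R.

Lemma continuous_prod_topology (K : topologicalType) (I : Type)
    (X : I -> topologicalType) (h : K -> prod_topology X) :
  (forall i, continuous (fun t => h t i)) -> continuous h.
Proof.
move=> ch t; apply/cvg_sup => i; move: t.
apply: (@continuous_comp_initial _ _ _ (fun f : prod_topology X => f i)).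
exact: ch.
Qed.

(** A word of continuous letters is a probe into one power of X followed by the quotient map. The
    letters form a tuple of maps so that each can be handled separately. *)
Lemma continuous_word (K : topologicalType) N V (i : nat)
    (h : i.-tuple (K -> gen n N V)) :
  compact [set: K] -> hausdorff_space K -> (forall s, continuous (tnth h s)) ->
  continuous (fun t => word [seq f t | f <- h]).
Proof.
move=> cK hK ch.
pose X i := kify (prod_topology (fun _ : 'I_i => gen n N V)).
pose w (t : K) : X i := fun s => tnth h s t.
have cw : continuous w.
  by apply: continuous_kify => //; exact: continuous_prod_topology.
have cq : continuous (fun x : X i => word (codom (x : 'I_i -> gen n N V))).
  apply/continuousP => A oA.
  have oA' : dgrp_open A := oA.
  (* Words of length i form the last summand of the i-th filtration stage. *)
  by have /sigT_openP/(_ ord_max) := oA' i.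
have -> : (fun t => word [seq f t | f <- h]) =
    (fun t => word (codom (w t : 'I_i -> gen n N V))).
  apply/funext => t; congr word.
  by rewrite -{1}(map_tnth_enum h) -map_comp.
by move=> t; apply: (@continuous_comp _ _ _ w _ t (cw t) (cq _)).
Qed.

(** The powers of X, over all lengths together, present the group as a quotient, so
    [probe_continuous2_quotient] reduces to words whose letters vary continuously. *)
Lemma probe_continuous2_dgrp N V (Z T : topologicalType)
    (f : dgrp n N V -> Z -> T) :
  (forall (K : topologicalType) (i : nat) (h : i.-tuple (K -> gen n N V))
     (c : K -> Z), compact [set: K] -> hausdorff_space K ->
     (forall s, continuous (tnth h s)) -> continuous c ->
     continuous (fun t => f (word [seq g t | g <- h]) (c t))) ->
  probe_continuous2 f.
Proof.
move=> cf.
pose X i := kify (prod_topology (fun _ : 'I_i => gen n N V)).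
apply: (@probe_continuous2_quotient nat X _ _ _
  (fun i x => word (codom (x : 'I_i -> gen n N V)))).
- by move=> i; exact: kify_cg.
- move=> x; exists (size (letters x)), (tnth (in_tuple (letters x))).
  rewrite -[RHS]lettersK; congr word.
  by rewrite -[RHS](map_tnth_enum (in_tuple (letters x))).
- move=> A oA; suff : dgrp_open A by [].
  by move=> i; apply/sigT_openP => s; exact: (oA s).
- move=> i K x c cK hK cx cc.
  pose h : i.-tuple (K -> gen n N V) := [tuple (fun t => x t s) | s < i].
  have -> : (fun t => f (word (codom (x t : 'I_i -> gen n N V))) (c t)) =
      (fun t => f (word [seq g t | g <- h]) (c t)).
    apply/funext => t; congr (f (word _) _).
    by rewrite /h /= -map_comp.
  apply: cf => // s; rewrite tnth_mktuple.
  pose P : topologicalType := prod_topology (fun _ : 'I_i => gen n N V).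
  have cx' : continuous (x : K -> P).
    move=> t; apply: (@continuous_comp K (kify P) P x id t (cx t)).
    exact: (@kify_continuous P (x t)).
  move=> t; apply: (@continuous_comp K P (gen n N V) x (fun f => f s) t
    (cx' t)).
  exact: (@proj_continuous 'I_i (fun=> gen n N V) s (x t)).
Qed.

(** The factors are replaced by words one at a time, the first test space K serving as parameter
    space for the second step. On words the product is concatenation. *)
Lemma continuous_dmul N V (K : topologicalType) (x y : K -> dgrp n N V) :
  compact [set: K] -> hausdorff_space K -> continuous x -> continuous y ->
  continuous (fun t => (x t * y t)%g).
Proof.
move: K x y.
suff : probe_continuous2 (fun x y : dgrp n N V => (x * y)%g) by [].
apply: probe_continuous2_dgrp => K i h y cK hK ch cy.
suff : probe_continuous2 (fun (y : dgrp n N V) (t : K) =>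
    (word [seq g t | g <- h] * y)%g).
  move=> cf; exact: (cf K y id cK hK cy (fun=> cvg_id)).
apply: probe_continuous2_dgrp => L j h' c cL hL ch' cc.
(* The letters of the first word, pulled back to the new test space along c. *)
pose hc : i.-tuple (L -> gen n N V) := [tuple (tnth h s \o c) | s < i].
have -> : (fun t => (word [seq g (c t) | g <- h] * word
  [seq g t | g <- h'])%g) =
    (fun t => word [seq g t | g <- [tuple of hc ++ h']]).
  apply/funext => t; rewrite [LHS]dmulE; congr word.
  rewrite /= map_cat -map_comp; congr (_ ++ _).
  by rewrite -{1}(map_tnth_enum h) -map_comp.
apply: continuous_word => // s.
case: (split_ordP s) => s' ->.
  rewrite tnth_lshift tnth_mktuple => t.
  by apply: continuous_comp; [exact: cc|exact: ch].
by rewrite tnth_rshift.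
Qed.

Lemma continuous_dgen N V (K : topologicalType) (phi : K -> emb (std n) V) r :
  compact [set: K] -> hausdorff_space K -> continuous phi ->
  continuous (fun t => dgen N (phi t) r).
Proof.
move=> cK hK cphi; rewrite /dgen; case: insubP => [r' _ _|_]; last first.
  by move=> t; exact: cvg_cst.
apply: (@continuous_word K N V 1 [tuple (fun t => (phi t, r'))]) => // s.
rewrite [s]ord1; apply: continuous_pair => // t; exact: cvg_cst.
Qed.

Lemma continuous_dprod N V (K : topologicalType) (I : Type) (r : seq I)
    (F : I -> K -> dgrp n N V) :
  compact [set: K] -> hausdorff_space K -> (forall i, continuous (F i)) ->
  continuous (fun t => \big[*%g/1%g]_(i <- r) F i t)%g.
Proof.
move=> cK hK cF; elim: r => [|i r IH].
  by under eq_fun do rewrite big_nil; move=> t; exact: cvg_cst.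
by under eq_fun do rewrite big_cons; exact: continuous_dmul.
Qed.

Lemma continuous_gen_dgen N M V W (K : topologicalType) (p : nat -> nat)
    (e : K -> emb V W) (h : K -> gen n N V) :
  compact [set: K] -> hausdorff_space K -> continuous e -> continuous h ->
  continuous (fun t => dgen M (emb_comp (e t) (h t).1) (p ((h t).2 : 'I_N))).
Proof.
move=> cK hK ce ch.
apply: (@continuous_discrete K (discrete_topology 'I_N) (dgrp n M W)
  (fun r t => dgen M (emb_comp (e t) (h t).1) (p (r : 'I_N)))
    (fun t => (h t).2)).
  exact: (continuous_snd_comp ch).
move=> r; apply: continuous_dgen => //; apply: continuous_emb_comp => //.
exact: (continuous_fst_comp ch).
Qed.

Lemma dgrp_map_continuous N V W :
  probe_continuous2 (fun (f : emb V W) (x : dgrp n N V) => dgrp_map f x).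
Proof.
apply: probe_continuous2C; apply: probe_continuous2_dgrp.
move=> K i h f cK hK ch cf; under eq_fun do rewrite dgrp_mapE big_map big_tuple.
apply: continuous_dprod => // s.
exact: (@continuous_gen_dgen N N V W K id f (tnth h s) cK hK cf (ch s)).
Qed.

Lemma emb_comp_id V W (f : emb V W) : emb_comp (liso_id W) f = f.
Proof. exact: embP. Qed.

(** Covers both [dshift] and [dbar], which keep the embeddings and only move places. *)
Lemma probe_continuous_relabel N M V (p : nat -> nat)
    (f : dgrp n N V -> dgrp n M V) :
  (forall u, f (word u) =
    (\big[*%g/1%g]_(g <- u) dgen M g.1 (p (g.2 : 'I_N)))%g) ->
  probe_continuous f.
Proof.
move=> fE K x cK hK cx.
suff pf : probe_continuous2 (fun (x : dgrp n N V) (_ : K) => f x).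
  exact: (pf K x id cK hK cx (fun=> cvg_id)).
apply: probe_continuous2_dgrp => L i h c cL hL ch _.
under eq_fun do rewrite fE big_map big_tuple.
apply: continuous_dprod => // s.
under eq_fun do rewrite -[(tnth h s _).1]emb_comp_id.
apply: (continuous_gen_dgen _ _ (e := fun=> liso_emb (liso_id V))) => // t.
exact: cvg_cst.
Qed.

Lemma dcirc_continuous m k (i : 'I_m) V W :
  probe_continuous2 (@dcirc R n m k i V W).
Proof.
suff ca : probe_continuous2 (@dact R n m k i (V ⊕ W)).
  move=> K x y cK hK cx cy; apply: ca => //.
    by apply: (dgrp_map_continuous cK hK (a := fun=> emb_inl V W)) => // t;
      exact: cvg_cst.
  have cs : probe_continuous (@dshift R n m k i (V ⊕ W)).
    exact: (probe_continuous_relabel (@dshiftE R n m k i (V ⊕ W))).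
  apply: (cs K (fun t => dgrp_map (emb_inr V W) (y t))) => //.
  by apply: (dgrp_map_continuous cK hK (a := fun=> emb_inr V W)) => // t;
    exact: cvg_cst.
apply: probe_continuous2_dgrp => K j h z cK hK ch cz.
under eq_fun do rewrite dactE.
(* By induction only the outermost letter remains. Its place is locally constant, so the case of
   [dact1] may be fixed. *)
elim: j h ch => [|j IH] h ch; first by rewrite (tuple0 h).
case/tupleP: h ch => g h ch /=.
have cg : continuous g by move: (ch ord0); rewrite tnth0.
pose x t := foldr (@dact1 R n m k i (V ⊕ W)) (z t) [seq f t | f <- h].
have cx : continuous x.
  by apply: IH => s; move: (ch (lift ord0 s)); rewrite tnthS.
pose phi t := (g t).1; have cphi : continuous phi by exact:
  (continuous_fst_comp cg).
have cr : continuous (snd \o g) := continuous_snd_comp cg.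
apply: (@continuous_discrete K (discrete_topology 'I_m)
  (dgrp n (m + k).-1 (V ⊕ W))
  (fun r t => dact1 i (phi t, r) (x t)) (snd \o g)) => [|r].
  exact: cr.
case ri : ((r : 'I_m) < i)%N.
  under eq_fun do rewrite /dact1 /= ri.
  by apply: continuous_dmul => //; exact: continuous_dgen.
case rE : ((r : 'I_m) == i :> nat); last first.
  under eq_fun do rewrite /dact1 /= ri rE.
  by apply: continuous_dmul => //; exact: continuous_dgen.
under eq_fun do rewrite /dact1 /= ri rE.
apply: continuous_dmul => //.
  by apply: continuous_dprod => // q; exact: continuous_dgen.
have cb : probe_continuous (@dbar R n m k i (V ⊕ W)).
  exact: (probe_continuous_relabel (@dbarE R n m k i (V ⊕ W))).
exact: (cb K x cK hK cx).
Qed.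

Lemma dsign_continuous N V (r : 'I_N) :
  @probe_continuous (dgrp n N V) (discrete_topology bool) (fun x => dsign x r).
Proof.
move=> K x cK hK cx.
suff pf : probe_continuous2
    (fun (x : dgrp n N V) (_ : K) => dsign x r : discrete_topology bool).
  exact: (pf K x id cK hK cx (fun=> cvg_id)).
apply: probe_continuous2_dgrp => L i h c cL hL ch _.
under eq_fun do rewrite dsignE.
apply: continuous_into_discrete => t0.
(* A word has finitely many letters, so all places are constant on one neighbourhood, and with them
   the parity. *)
have near_places : \forall t \near t0, forall s,
    (tnth h s t).2 = (tnth h s t0).2 :> discrete_topology 'I_N.
  apply: (@filter_forall L _ (fun s t => (tnth h s t).2 = (tnth h s t0).2)
    (nbhs t0) _) => s.
  exact: (near_discrete t0 (continuous_snd_comp (ch s))).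
apply: filterS near_places => t places; congr odd.
rewrite !count_map -(map_tnth_enum h) !count_map; apply: eq_count => s /=.
by rewrite places.
Qed.

Lemma dgrp0_trivial V (x : dgrp n 0 V) : x = 1%g.
Proof.
have [u u0 ->] := evalP x; case: u u0 => [_|g u /andP[]//].
by rewrite /eval_word big_nil.
Qed.

Lemma D_is_layers : is_layers (@D_layers R n).
Proof.
split=> /=.
- move=> j V x; have [u _ ->] := evalP x; rewrite dgrp_map_eval;
  congr eval_word.
  rewrite -[RHS]map_id; apply: eq_map => -[phi r] /=.
  by rewrite emb_comp_id.
- move=> j U V W g f x; have [u _ ->] := evalP x.
  by rewrite !dgrp_map_eval emb_word_comp.
- exact: dgrp_map_continuous.
- exact: dcirc_continuous.
- exact: dcirc_map.
- exact: dsign_continuous.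
- exact: dsign_map.
- exact: dsign_circ.
- by move=> j V r; rewrite -[1%g]/(word [::]) dsignE.
- by move=> *; exact: dgrp_map1.
- exact: dgrp0_trivial.
- by move=> *; exact: dcirc_disjoint.
- by move=> *; exact: dcirc_nested.
- move=> m i V W x; have [u um ->] := evalP x.
  have -> : (1%g : dgrp n 1 W) = eval_word 1 [::] by rewrite /eval_word big_nil.
  rewrite dcirc_eval// dgrp_map_eval /word_circ /= word_act1_id.
  by apply: layer_eqv_eval => //; lia.
- move=> k i V W y; have [v vk ->] := evalP y.
  have -> : (1%g : dgrp n 1 V) = eval_word 1 [::] by rewrite /eval_word big_nil.
  rewrite dcirc_eval// dgrp_map_eval /word_circ /=.
  apply: layer_eqv_eval => //; congr eval_word.
  rewrite (@eq_relabel _ _ id) => [|r]; last by rewrite ord1.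
  by rewrite -[RHS]map_id; apply: eq_map => -[].
Qed.

Definition dsigns j V (x : dgrp n j V) : signs j := [ffun r => dsign x r].

Lemma dsigns_is_layers_map :
  @is_layers_map R (D_layers n) (H_layers R) dsigns.
Proof.
split=> /=.
- move=> j V K x cK hK cx; apply: continuous_into_discrete => t0.
  have ns : \forall t \near t0, forall r, dsign (x t) r = dsign (x t0) r.
    apply: (@filter_forall K _ (fun r t => dsign (x t) r = dsign (x t0) r)
      (nbhs t0) _) => r.
    exact: (near_discrete t0 (@dsign_continuous j V r K x cK hK cx)).
  by apply: filterS ns => t xt; apply/ffunP => r; rewrite !ffunE.
- by move=> j V W e x; apply/ffunP => r; rewrite !ffunE dsign_map.
- move=> m k i V W x y; apply/ffunP => t.
  rewrite ffunE dsign_circ -nat_signE nat_signs_circ//.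
  by congr (sign_circ _ _ _ _ _); apply/funext => s; rewrite /nat_sign;
    case: insubP => // s' _ _; rewrite ffunE.
- by move=> j V x r; rewrite ffunE.
- by move=> j V; apply/ffunP => r; rewrite !ffunE -[1%g]/(word [::]) dsignE.
Qed.

End DgrpTopology.

Local Close Scope ring_scope.
Local Close Scope quotient_scope.
Local Close Scope classical_set_scope.

Theorem theorem4p3p2 (R : realType) (n : nat) (hn : 0 < n) :
  exists (hD : is_operad (@calD R n)) (hH : is_operad (calH R)),
    inhabited (operad_map (Operad hD) (Operad hH)).
Proof.
exists (susp_operad_is_operad (@D_is_layers R n)).
exists (susp_operad_is_operad (H_is_layers R)).
constructor; exact: (susp_operad_map (dsigns_is_layers_map n)).
Qed.
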